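(* Let $p \in (1,\infty)\setminus\{2\}$. Then there exists a sectorial operator $A$ on $L_p(\mathbb{R})$ with bounded imaginary powers and $\omega(A) = \omega_{\mathrm{BIP}}(A) = 0$ which does not have a bounded $H^\infty$-calculus.
   Context: All Banach spaces are complex. For $\omega \in (0,\pi)$ let $\Sigma_\omega = \{z \in \mathbb{C}\setminus\{0\} : |\arg z| < \omega\}$, with $\arg z \in (-\pi,\pi]$. A closed densely defined operator $A$ with dense range on a Banach space $X$ is called sectorial if there is $\omega \in (0,\pi)$ such that $\sigma(A) \subset \overline{\Sigma_\omega}$ and $\sup_{\lambda \notin \overline{\Sigma_{\omega+\varepsilon}}} \|\lambda R(\lambda,A)\| < \infty$ for all $\varepsilon > 0$, where $R(\lambda,A) = (\lambda - A)^{-1}$; such operators are automatically injective. The sectorial angle $\omega(A)$ is the infimum of all such $\omega$. For $\sigma\in(0,\pi)$ let $H_0^\infty(\Sigma_\sigma)$ be the set of analytic $f:\Sigma_\sigma \to \mathbb{C}$ for which there are $C,\varepsilon>0$ with $|f(\lambda)| \le C|\lambda|^\varepsilon/(1+|\lambda|)^{2\varepsilon}$ on $\Sigma_\sigma$. For $A$ sectorial, $\sigma > \omega(A)$ and $f \in H_0^\infty(\Sigma_\sigma)$ put $f(A) = \frac{1}{2\pi i}\int_{\partial\Sigma_{\sigma'}} f(\lambda)R(\lambda,A)\,d\lambda$ for any $\omega(A)<\sigma'<\sigma$. $A$ has a bounded $H^\infty(\Sigma_\sigma)$-calculus if $f\mapsto f(A)$, $H_0^\infty(\Sigma_\sigma)\to\mathcal{B}(X)$,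 is bounded with respect to the supremum norm on $\Sigma_\sigma$, and $A$ has a bounded $H^\infty$-calculus if this holds for some $\sigma \in (\omega(A),\pi)$. For analytic $f$ on $\Sigma_\sigma$ with at most polynomial growth at $0$ and $\infty$, $f(A)$ is defined as a closed operator by $f(A) = (e^n)(A)^{-1}(e^n f)(A)$, where $e(\lambda)=\lambda/(1+\lambda)^2$ and $n$ is large enough that $e^nf\in H_0^\infty(\Sigma_\sigma)$. $A$ has bounded imaginary powers (BIP) if for all $t \in \mathbb{R}$ the operator $A^{it}$ associated to $\lambda \mapsto \lambda^{it}$ is bounded; in that case $\omega_{\mathrm{BIP}}(A) = \inf\{\omega \ge 0 : \text{there is } M\ge 0 \text{ with } \|A^{it}\| \le M e^{\omega|t|} \text{ for all } t\in\mathbb{R}\}$; otherwise $\omega_{\mathrm{BIP}}(A)=\infty$. *)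

(* Defs.v *)
From HB Require Import structures.
From mathcomp Require Import all_boot all_order all_algebra.
From mathcomp Require Import all_classical all_reals all_analysis.
From mathcomp Require Import measurable_realfun ess_sup_inf hoelder complex.

Set Implicit Arguments.
Unset Strict Implicit.
Unset Printing Implicit Defensive.

Import Order.TTheory GRing.Theory Num.Theory numFieldNormedType.Exports.
Import ComplexField.Normc.

Local Open Scope classical_set_scope.
Local Open Scope ring_scope.
Local Open Scope complex_scope.
Local Open Scope quotient_scope.

(* The library's Lp spaces contain real-valued functions only, and carry no
   vector space structure after the passage to the quotient; hence the
   construction of complex Lp spaces below. *)
Section ComplexLfun.
Context d (T : measurableType d) (R : realType).
Variables (mu : {measure set T -> \bar R}) (p : \bar R).

Definition cmeasurable (f : T -> R[i]) :=
  measurable_fun setT (fun t => complex.Re (f t)) /\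
  measurable_fun setT (fun t => complex.Im (f t)).

Definition cLfun : {pred T -> R[i]} :=
  mem [set f | cmeasurable f /\ finite_norm mu p (fun t => normc (f t))].

Lemma cLfunP f :
  f \in cLfun <-> cmeasurable f /\ finite_norm mu p (fun t => normc (f t)).
Proof. by split; rewrite inE. Qed.

Lemma measurable_normc f : cmeasurable f ->
  measurable_fun setT (fun t => normc (f t)).
Proof.
move=> [mr mi].
rewrite (_ : (fun _ => _) =
  Num.sqrt \o (fun t => complex.Re (f t) ^+ 2 + complex.Im (f t) ^+ 2)).
  apply: measurableT_comp.
    by apply: continuous_measurable_fun; exact: sqrt_continuous.
  by apply: measurable_funD; exact: measurable_funX.
by apply/funext => t /=; case: (f t).
Qed.

Hypothesis p1 : (1 <= p)%E.

Lemma normc_Lfun f : f \in cLfun -> (fun t => normc (f t)) \in Lfun mu p.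
Proof.
move=> /cLfunP[mf nf]; rewrite inE; apply/andP; split; rewrite inE //=.
exact: measurable_normc.
Qed.

Lemma normc_ge0 (x : R[i]) : 0 <= normc x.
Proof. by case: x => a b; exact: sqrtr_ge0. Qed.


Lemma le_Lnorm (f g : T -> R) :
  measurable_fun setT f -> measurable_fun setT g ->
  (forall t, 0 <= f t <= g t) ->
  ('N[mu]_p[EFin \o f] <= 'N[mu]_p[EFin \o g])%E.
Proof.
move=> mf mg fg; rewrite unlock.
have nfg t : (`|(f t)%:E| <= `|(g t)%:E|)%E.
  have /andP[f0 fgt] := fg t.
  by rewrite !abse_EFin lee_fin !ger0_norm// (le_trans f0).
case: p p1 => [r r1| _|//].
- have r0 : 0 < r by rewrite (lt_le_trans ltr01).
  apply: gt0_ler_poweR; rewrite ?invr_ge0 ?(ltW r0)//.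
  + by rewrite in_itv/= leey andbT integral_ge0// => t _; exact: poweR_ge0.
  + by rewrite in_itv/= leey andbT integral_ge0// => t _; exact: poweR_ge0.
  apply: ge0_le_integral => //.
  + by move=> t _; exact: poweR_ge0.
  + apply: (measurableT_comp (measurable_poweR _)).
    by apply: measurableT_comp => //; exact/measurable_EFinP.
  + apply: (measurableT_comp (measurable_poweR _)).
    by apply: measurableT_comp => //; exact/measurable_EFinP.
  + move=> t _; apply: gt0_ler_poweR => //; first exact: ltW.
      by rewrite in_itv/= leey andbT lee_fin normr_ge0.
    by rewrite in_itv/= leey andbT lee_fin normr_ge0.
  exact: nfg.
- by case: ifPn => // mu0; apply: le_ess_sup; exact: nearW.
Qed.

Lemma ae_eq_Lnorm (f g : T -> R) :
  measurable_fun setT f -> measurable_fun setT g ->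
  (\forall t \ae mu, f t = g t) ->
  ('N[mu]_p[EFin \o f] = 'N[mu]_p[EFin \o g])%E.
Proof.
move=> mf mg fg; rewrite unlock; case: p p1 => [r r1| _|//].
- congr poweR; apply: ge0_ae_eq_integral => //.
  + apply: (measurableT_comp (measurable_poweR _)).
    by apply: measurableT_comp => //; exact/measurable_EFinP.
  + apply: (measurableT_comp (measurable_poweR _)).
    by apply: measurableT_comp => //; exact/measurable_EFinP.
  + by move=> t _; exact: poweR_ge0.
  + by move=> t _; exact: poweR_ge0.
  + by apply: filterS fg => t /= -> _.
- by case: ifPn => // mu0; apply: eq_ess_sup; apply: filterS fg => t /= ->.
Qed.

Lemma cmeasurable_comb (a : R[i]) f g : cmeasurable f -> cmeasurable g ->
  cmeasurable (fun t => a * f t + g t).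
Proof.
move: a => [a b] [mfr mfi] [mgr mgi]; split.
  rewrite (_ : (fun _ => _) = (fun t => a * complex.Re (f t) -
      b * complex.Im (f t) + complex.Re (g t))); last first.
    by apply/funext => t; case: (f t) (g t) => [? ?] [? ?].
  apply: measurable_funD => //; apply: measurable_funB => //;
    exact: measurable_funM.
rewrite (_ : (fun _ => _) = (fun t => a * complex.Im (f t) +
    b * complex.Re (f t) + complex.Im (g t))); last first.
  by apply/funext => t; case: (f t) (g t) => [? ?] [? ?].
apply: measurable_funD => //; apply: measurable_funD => //;
  exact: measurable_funM.
Qed.

Lemma cLnormD f g : cmeasurable f -> cmeasurable g ->
  ('N[mu]_p[EFin \o (fun t => normc (f t + g t)%R)] <=
   'N[mu]_p[EFin \o (fun t => normc (f t))] +
   'N[mu]_p[EFin \o (fun t => normc (g t))])%E.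
Proof.
move=> mf mg; have nf := measurable_normc mf; have ng := measurable_normc mg.
apply: le_trans (eminkowski _ nf ng p1); apply: le_Lnorm.
- have := cmeasurable_comb 1 mf mg => /measurable_normc.
  by under eq_fun do rewrite mul1r.
- exact: measurable_funD.
- by move=> t; rewrite normc_ge0 /=; exact: le_normcD.
Qed.

Lemma cLnormZ (a : R[i]) f : f \in cLfun ->
  ('N[mu]_p[EFin \o (fun t => normc (a * f t)%R)] =
   (normc a)%:E * 'N[mu]_p[EFin \o (fun t => normc (f t))])%E.
Proof.
move=> /normc_Lfun nf.
have := LnormZ (Lfun_Sub p1 nf) (normc a); rewrite ger0_norm ?normc_ge0// => <-.
by congr Lnorm; apply/funext => t /=; rewrite normcM.
Qed.

Lemma cLfun_submod_closed : submod_closed cLfun.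
Proof.
split.
  apply/cLfunP; split; first by split; exact: measurable_cst.
  rewrite /finite_norm (_ : _ \o _ = cst 0%E) ?Lnorm0 ?ltry//.
    by rewrite gt_eqF// (lt_le_trans _ p1).
  by apply/funext => t; congr EFin; exact: normc0.
move=> a f g fL gL.
have [[mf nf] [mg ng]] := (proj1 (cLfunP _) fL, proj1 (cLfunP _) gL).
apply/cLfunP; split; first exact: cmeasurable_comb.
have maf : cmeasurable (fun t => a * f t).
  have := cmeasurable_comb a mf (g := cst 0).
  under eq_fun do rewrite addr0.
  by apply; split; exact: measurable_cst.
apply: le_lt_trans (cLnormD maf mg) _.
by rewrite lte_add_pinfty// cLnormZ// lte_mul_pinfty ?lee_fin ?normc_ge0.
Qed.

End ComplexLfun.

(* The proof of 1 <= p is a parameter of the type because its algebraic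
   structure depends on it. *)
Record cLfunType d (T : measurableType d) (R : realType)
    (mu : {measure set T -> \bar R}) (p : \bar R) (p1 : (1 <= p)%E) := CLfun {
  cLfun_val :> T -> R[i] ;
  cLfun_subproof : cLfun_val \in cLfun mu p }.

Section ComplexLspace.
Context d (T : measurableType d) (R : realType).
Variables (mu : {measure set T -> \bar R}) (p : \bar R) (p1 : (1 <= p)%E).

HB.instance Definition _ :=
  GRing.isSubmodClosed.Build R[i] (T -> R[i]) (cLfun mu p)
    (cLfun_submod_closed mu p1).

Local Notation cLfunType := (cLfunType mu p1).

HB.instance Definition _ := [isSub of cLfunType for @cLfun_val _ _ _ _ _ p1].
HB.instance Definition _ := [Choice of cLfunType by <:].
HB.instance Definition _ := [SubChoice_isSubLmodule of cLfunType by <:].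

Definition cLnull : {pred cLfunType} :=
  mem [set f : cLfunType | (f : T -> R[i]) = cst 0 %[ae mu]].

Lemma cLnullP (f : cLfunType) : f \in cLnull <-> (\forall t \ae mu, f t = 0).
Proof.
rewrite inE; split; apply: filterS => t /=; first exact.
by move=> ->.
Qed.

Lemma cLnull_zmod_closed : zmod_closed cLnull.
Proof.
split; first by apply/cLnullP; exact: nearW.
move=> f g /cLnullP f0 /cLnullP g0; apply/cLnullP.
by apply: filterS2 f0 g0 => t ft gt; rewrite -[LHS]/(f t - g t) ft gt subrr.
Qed.

HB.instance Definition _ :=
  GRing.isZmodClosed.Build cLfunType cLnull cLnull_zmod_closed.

Definition cLspace := Quotient.quot cLnull.
HB.instance Definition _ := Choice.on cLspace.
HB.instance Definition _ := EqQuotient.on cLspace.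
HB.instance Definition _ := GRing.Zmodule.on cLspace.

Lemma cLspace_eqP (f g : cLfunType) :
  \pi_cLspace f = \pi_cLspace g <-> (\forall t \ae mu, f t = g t).
Proof.
split.
  move/eqP; rewrite -Quotient.idealrBE => /cLnullP; apply: filterS => t.
  by move=> /eqP; rewrite subr_eq0 => /eqP.
move=> fg; apply/eqP; rewrite -Quotient.idealrBE; apply/cLnullP.
by apply: filterS fg => t ft; rewrite -[LHS]/(f t - g t) ft subrr.
Qed.

Definition cLscale (a : R[i]) (u : cLspace) : cLspace :=
  \pi_cLspace (a *: (repr u)).

Lemma cLscaleE a f : cLscale a (\pi_cLspace f) = \pi_cLspace (a *: f).
Proof.
apply/cLspace_eqP; have : \pi_cLspace (repr (\pi_cLspace f)) = \pi_cLspace f.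
  by rewrite reprK.
by move=> /cLspace_eqP; apply: filterS => t ft;
  rewrite -[LHS]/(a * repr (\pi_cLspace f) t) ft.
Qed.

Lemma cLpiD : {morph \pi_cLspace : f g / f + g}.
Proof. by move=> f g; exact: Quotient.pi_add. Qed.

Lemma cLpi0 : \pi_cLspace 0 = 0.
Proof. by apply: (addrI (\pi_cLspace 0)); rewrite -cLpiD !addr0. Qed.

Lemma cLscaleA a b u : cLscale a (cLscale b u) = cLscale (a * b) u.
Proof. by elim/quotW: u => f; rewrite (cLscaleE b) !cLscaleE scalerA. Qed.

Lemma cLscale1 : left_id 1 cLscale.
Proof. by elim/quotW => f; rewrite cLscaleE scale1r. Qed.

Lemma cLscaleDr : right_distributive cLscale +%R.
Proof.
move=> a; elim/quotW => f; elim/quotW => g.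
by rewrite -cLpiD !cLscaleE scalerDr cLpiD.
Qed.

Lemma cLscaleDl u : {morph cLscale^~ u : a b / a + b}.
Proof.
by elim/quotW: u => f a b; rewrite !cLscaleE scalerDl cLpiD.
Qed.

HB.instance Definition _ := GRing.Zmodule_isLmodule.Build R[i] cLspace
  cLscaleA cLscale1 cLscaleDr cLscaleDl.

Definition cLnorm (f : T -> R[i]) : R :=
  fine ('N[mu]_p[EFin \o (fun t => normc (f t))])%E.

Lemma cLnormK (f : cLfunType) :
  (cLnorm f)%:E = ('N[mu]_p[EFin \o (fun t => normc (f t))])%E.
Proof.
rewrite /cLnorm fineK// fin_numElt (lt_le_trans ltNy0) ?Lnorm_ge0//=.
by have /cLfunP[] := cLfun_subproof f.
Qed.

Definition cLspace_norm (u : cLspace) : R[i] := (cLnorm (repr u))%:C.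

Lemma cLspace_normE (f : cLfunType) :
  cLspace_norm (\pi_cLspace f) = (cLnorm f)%:C.
Proof.
have /cLspace_eqP fE : \pi_cLspace (repr (\pi_cLspace f)) = \pi_cLspace f.
  by rewrite reprK.
congr (_%:C); apply: EFin_inj; rewrite !cLnormK; apply: ae_eq_Lnorm => //.
- by apply: measurable_normc; have /cLfunP[] := cLfun_subproof (repr (\pi_cLspace f)).
- by apply: measurable_normc; have /cLfunP[] := cLfun_subproof f.
- by apply: filterS fE => t ->.
Qed.

Lemma cLspace_ler_normD u v :
  cLspace_norm (u + v) <= cLspace_norm u + cLspace_norm v.
Proof.
rewrite -[u]reprK -[v]reprK -cLpiD !cLspace_normE -rmorphD lecR.
rewrite -lee_fin EFinD !cLnormK; apply: cLnormD => //.
  by have /cLfunP[] := cLfun_subproof (repr u).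
by have /cLfunP[] := cLfun_subproof (repr v).
Qed.

Lemma cLspace_normrZ a u : cLspace_norm (a *: u) = `|a| * cLspace_norm u.
Proof.
rewrite -[u]reprK -[_ *: _]/(cLscale _ _) cLscaleE !cLspace_normE.
rewrite -[`|a|]/((normc a)%:C) -rmorphM; congr (_%:C).
apply: EFin_inj; rewrite EFinM !cLnormK -cLnormZ//.
exact: cLfun_subproof.
Qed.

Lemma cLspace_normr0_eq0 u : cLspace_norm u = 0 -> u = 0.
Proof.
elim/quotW: u => f; rewrite cLspace_normE => -[nf].
have nf0 : ('N[mu]_p[EFin \o (fun t => normc (f t))] = 0)%E.
  by rewrite -cLnormK nf.
have /cLfunP[/measurable_normc /measurable_EFinP mf _] := cLfun_subproof f.
rewrite -cLpi0; apply/cLspace_eqP.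
have := Lnorm_eq0_eq0 mf (lt_le_trans lte01 p1) nf0.
by apply: filterS => t /(_ I)[]; exact: eq0_normc.
Qed.

HB.instance Definition _ := Lmodule_isNormed.Build R[i] cLspace
  cLspace_ler_normD cLspace_normrZ cLspace_normr0_eq0.

End ComplexLspace.
Section Sectors.
Variable R : realType.
Implicit Types (z : R[i]) (w t : R).

(* The principal argument, in ]-pi, pi], of z != 0. *)
Definition carg z : R :=
  if 0 <= complex.Im z then acos (complex.Re z / normc z)
  else - acos (complex.Re z / normc z).

Definition cis t : R[i] := cos t +i* sin t.

Lemma normc_gt0 z : z != 0 -> 0 < normc z.
Proof.
by move=> z0; rewrite lt_neqAle normc_ge0 andbT eq_sym;
  apply: contra z0 => /eqP/eq0_normc ->.
Qed.

Lemma polar_acos (a b n : R) : 0 < n -> n ^+ 2 = a ^+ 2 + b ^+ 2 ->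
  [/\ -1 <= a / n <= 1, cos (acos (a / n)) = a / n
    & sin (acos (a / n)) = `|b| / n].
Proof.
move=> n0 n2; have n0' := lt0r_neq0 n0.
have bn : 1 - (a / n) ^+ 2 = (b / n) ^+ 2.
  rewrite !expr_div_n -[1](divff (x := n ^+ 2)) ?sqrf_eq0//.
  by rewrite -mulrBl {1}n2 addrAC subrr add0r.
have x1 : -1 <= a / n <= 1.
  rewrite -ler_norml -(@ler_pXn2r _ 2) ?nnegrE// expr1n real_normK ?num_real//.
  by rewrite -subr_ge0 bn sqr_ge0.
split=> //; first by rewrite acosK// in_itv.
by rewrite sin_acos// bn sqrtr_sqr normrM normfV (gtr0_norm n0).
Qed.

Lemma cargP z : z != 0 ->
  - pi < carg z <= pi /\ z = (normc z)%:C * cis (carg z).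
Proof.
move=> z0; have n0 := normc_gt0 z0.
have n2 : normc z ^+ 2 = complex.Re z ^+ 2 + complex.Im z ^+ 2.
  by case: z {z0 n0} => a b /=; rewrite sqr_sqrtr// addr_ge0 ?sqr_ge0.
have n0' := lt0r_neq0 n0.
rewrite /carg; move: (normc z) n0 n0' n2 => n n0 n0' n2.
case: z z0 n2 => a b _ /= n2.
have [x1 ca sa] := polar_acos n0 n2.
case: ifPn => [b0|]; last rewrite -ltNge => b0.
  split.
    by rewrite acos_lepi// andbT (lt_le_trans _ (acos_ge0 x1))// oppr_lt0 pi_gt0.
  rewrite /cis ca sa ger0_norm//; apply/eqP; rewrite eq_complex /=.
  by rewrite !mul0r subr0 addr0 ![n * _]mulrC !divfK// !eqxx.
split.
  apply/andP; split.
    rewrite ltrN2 acos_ltpi//; case/andP: x1 => x1 ->; rewrite andbT.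
    rewrite lt_neqAle x1 andbT; apply/eqP => xE.
    have := sa; rewrite -xE acosN1 sinpi => /esym/eqP.
    by rewrite mulf_eq0 invr_eq0 (negbTE n0') orbF normr_eq0 lt_eqF.
  by rewrite (le_trans _ (pi_ge0 R))// oppr_le0 acos_ge0.
rewrite /cis cosN sinN ca sa ltr0_norm//; apply/eqP; rewrite eq_complex /=.
by rewrite !mul0r subr0 addr0 mulNr opprK ![n * _]mulrC !divfK// !eqxx.
Qed.

Definition cexp z : R[i] := (expR (complex.Re z))%:C * cis (complex.Im z).

Definition clog z : R[i] := ln (normc z) +i* carg z.

Definition sector w : set R[i]^o := [set z : R[i] | z != 0 /\ `|carg z| < w].

Definition analytic_on (D : set R[i]^o) (f : R[i] -> R[i]) :=
  forall z : R[i]^o, D z -> derivable (f : R[i]^o -> R[i]^o) z 1.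

Definition H0inf s : set (R[i] -> R[i]) := [set f |
  analytic_on (sector s) f /\
  exists C e : R, [/\ 0 < C, 0 < e & forall z, sector s z ->
    normc (f z) <= C * normc z `^ e / (1 + normc z) `^ (2 * e)]].

End Sectors.

Section Bochner.
Context d (T : measurableType d) (R : realType) (X : normedModType R[i]).
Variable mu : {measure set T -> \bar R}.

(* The norm of a module normed over R[i] takes its values in R[i]. *)
Definition rnorm (x : X) : R := complex.Re `|x|.

(* A list of pairs (E, c) stands for the simple function \sum 1_E c. *)
Definition simple_fun (s : seq (set T * X)) (t : T) : X :=
  \sum_(a <- s) (\1_(a.1) t : R)%:C *: a.2.

Definition simple_int (s : seq (set T * X)) : X :=
  \sum_(a <- s) (fine (mu a.1))%:C *: a.2.

(* Measurability is explicit because the library integral of a non-measurable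
   nonnegative function is a lower integral. *)
Definition is_bochner_int (D : set T) (g : T -> X) (y : X) :=
  exists s : nat -> seq (set T * X),
  [/\ forall k a, a \in s k ->
        [/\ measurable a.1, a.1 `<=` D & (mu a.1 < +oo)%E],
      forall k, measurable_fun D (fun t => rnorm (g t - simple_fun (s k) t)),
      (fun k => \int[mu]_(t in D) (rnorm (g t - simple_fun (s k) t))%:E)%E
        @ \oo --> 0%E
    & (fun k => simple_int (s k)) @ \oo --> y].

Definition bochner_int (D : set T) (g : T -> X) : X :=
  xget 0 (is_bochner_int D g).

End Bochner.

(* An unbounded operator is represented by its graph. *)
Definition operator (R : realType) (X : normedModType R[i]) := set (X * X).

Section Sectorial.
Context (R : realType) (X : normedModType R[i]).
Implicit Types (A B : operator X) (l : R[i]) (w s : R).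

Definition linear_operator A :=
  [/\ A (0, 0),
      forall (a : R[i]) u v, A u -> A v -> A (a *: u + v)
    & forall y, A (0, y) -> y = 0].

Definition dom A : set X := fst @` A.
Definition range_op A : set X := snd @` A.

Definition bounded_by (S : X -> X) (M : R) :=
  forall x, rnorm (S x) <= M * rnorm x.

(* (l - A)^-1, to be used only for l in the resolvent set. *)
Definition resolvent A l (y : X) : X := xget 0 [set x | A (x, l *: x - y)].

Definition resolvent_set A : set R[i]^o := [set l : R[i] |
  (forall y, exists! x, A (x, l *: x - y)) /\
  exists M, bounded_by (resolvent A l) M].

Definition spectrum A := ~` resolvent_set A.

Definition sectorial_of A w :=
  spectrum A `<=` closure (sector w) /\
  forall e, 0 < e -> exists M, forall l : R[i]^o, ~ closure (sector (w + e)) l ->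
    bounded_by (fun x => (l : R[i]) *: resolvent A l x) M.

Definition sectorial A :=
  [/\ linear_operator A, closed A, dense (dom A), dense (range_op A)
    & exists w, 0 < w < pi /\ sectorial_of A w].

Definition sectorial_angle A : R :=
  inf [set w | 0 < w < pi /\ sectorial_of A w].

(* The integral of F(l) dl along the boundary of sector s, which comes in from
   infinity on the ray of angle s and goes out on the ray of angle - s. *)
Definition sector_contour_int s (F : R[i] -> X) : X :=
  bochner_int lebesgue_measure `]0, +oo[%classic
    (fun r : R => cis (- s) *: F (r%:C * cis (- s))) -
  bochner_int lebesgue_measure `]0, +oo[%classic
    (fun r : R => cis s *: F (r%:C * cis s)).

(* f(A) x for f in H0inf s, as a Bochner integral in X of the norm continuous
   and absolutely integrable function f(l) R(l, A) x; its value does not depend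
   on s'. *)
Definition calc0 A s (f : R[i] -> R[i]) (x : X) : X :=
  xget 0 [set y | forall s', sectorial_angle A < s' < s ->
    y = (2 * pi%:C * 'i%C)^-1 *:
        sector_contour_int s' (fun l => f l *: resolvent A l x)].

Definition has_bounded_Hinf_of A s :=
  exists C, forall f, H0inf s f ->
    bounded_by (calc0 A s f) (C * sup [set normc (f z) | z in sector s]).

Definition has_bounded_Hinf A :=
  exists s, sectorial_angle A < s < pi /\ has_bounded_Hinf_of A s.

Definition regularizer (l : R[i]) : R[i] := l / (1 + l) ^+ 2.

(* f(A) = (e^n)(A)^-1 (e^n f)(A) for f of polynomial growth at 0 and at
   infinity; the operator does not depend on n. *)
Definition calc A s (f : R[i] -> R[i]) : operator X :=
  [set u | exists n, [/\ (0 < n)%N,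
    H0inf s (fun l => regularizer l ^+ n * f l)
    & calc0 A s (fun l => regularizer l ^+ n) u.2 =
      calc0 A s (fun l => regularizer l ^+ n * f l) u.1]].

(* A^it; the operator does not depend on s. *)
Definition imaginary_power A (t : R) : operator X :=
  [set u | exists s, sectorial_angle A < s < pi /\
     calc A s (fun l => cexp (t%:C * 'i%C * clog l)) u].

Definition everywhere_bounded_by B (M : R) :=
  dom B = setT /\ forall x y, B (x, y) -> rnorm y <= M * rnorm x.

Definition BIP A :=
  forall t, exists M, everywhere_bounded_by (imaginary_power A t) M.

Definition omega_BIP A : \bar R :=
  if `[< BIP A >] then
    ereal_inf [set w%:E | w in [set w | 0 <= w /\ exists M, 0 <= M /\
      forall t, everywhere_bounded_by (imaginary_power A t)
                  (M * expR (w * `|t|))]]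
  else +oo%E.

End Sectorial.

Section LpR.
Variables (R : realType) (p : R).

Lemma lt1_lee1 : 1 < p -> (1 <= p%:E)%E.
Proof. by move=> p1; rewrite lee_fin ltW. Qed.

Definition Lp_R (p1 : 1 < p) : normedModType R[i] :=
  cLspace (@lebesgue_measure R) (lt1_lee1 p1).

End LpR.

(* Main.v *)
Require Import Defs.
From HB Require Import structures.
From mathcomp Require Import all_boot all_order all_algebra.
From mathcomp Require Import all_classical all_reals all_analysis.
From mathcomp Require Import measurable_realfun ess_sup_inf hoelder complex ring lra zify.

(* Cut R into blocks of 2n+1 intervals of equal length (up to two translated
   copies). A sequence (c_m) acts on the L_p-functions of a block as the circulant
   matrix with eigenvalues c_0, ..., c_2n, and A acts with eigenvalues 17^m on all
   blocks. Summation by parts reduces circulant matrices whose eigenvalues have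
   bounded variation to partial sums of the finite Fourier series, hence to a
   discrete Hilbert transform; Cotlar's identity, interpolation and duality bound
   it on l_p uniformly in n. Since 17^m increases, the resolvents
   1 / (l - 17^m) have variation O(1 / |l|) outside every sector, so A is sectorial
   of angle 0. The imaginary powers have eigenvalues (17^(it))^m: up to a multiple
   of 2 pi / (2n+1) in the angle, which only permutes the intervals, these have
   bounded variation, so the imaginary powers are uniformly bounded. On the other
   hand sums of c_m 4e(l / 17^m) with |c_m| <= 1 are bounded uniformly on sectors
   and are within 1/2 of c_m at l = 17^m. A bounded H^infty-calculus would therefore
   bound all circulant matrices with |c_m| <= 1 uniformly on l_p, and quadratic
   Gauss sums refute this for p <> 2. *)

Set Implicit Arguments.
Unset Strict Implicit.
Unset Printing Implicit Defensive.

Import Order.TTheory GRing.Theory Num.Theory numFieldNormedType.Exports.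
Import ComplexField.Normc.

Local Open Scope classical_set_scope.
Local Open Scope ring_scope.
Local Open Scope complex_scope.

(** A bounded calculus would make the characters of the cyclic groups of order 2n+1 uniformly
    unconditional in l_p, which fails unless p = 2. Imaginary powers ask much less: along nodes in
    geometric progression their eigenvalues are nearly characters themselves, and characters act as
    translations. Hence the lacunary spectrum and the circulant matrices. The order is odd because
    completing the square in the Gauss sum needs an inverse of 2. A single block would carry a
    bounded calculus, so everything lies in uniformity in n: in the matrix bounds the constants are
    chosen before the size.

    The definitions speak of Bochner integrals along rays, the argument of eigenvalues. The bridge
    is Cauchy's formula at the points 17^m. It is obtained by differentiating ray integrals with
    respect to the angle, from the dilation invariance of dr/r, and from one explicit integral for
    4e(l/a). Riemann sums carry it from scalars to operators; their convergence is not uniform over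
    the blocks, so vectors are first truncated to finitely many blocks. *)

Section NormC.
Variable R : realType.
Implicit Types x y : R[i].

Lemma normcD x y : normc (x + y) <= normc x + normc y.
Proof. exact: le_normcD. Qed.

Lemma normc_opp x : normc (- x) = normc x.
Proof. exact: normcN. Qed.

Lemma normc_sum (I : Type) (r : seq I) (P : pred I) (F : I -> R[i]) :
  normc (\sum_(i <- r | P i) F i) <= \sum_(i <- r | P i) normc (F i).
Proof.
elim/big_ind2 : _ => [|a b c d ab cd|//]; first by rewrite normc0.
by rewrite (le_trans (normcD _ _))// lerD.
Qed.

Lemma normcX x k : normc (x ^+ k) = normc x ^+ k.
Proof. by elim: k => [|k IH]; rewrite ?normc1// !exprS normcM IH. Qed.

Lemma normc_real (r : R) : normc r%:C = `|r|.
Proof. by rewrite /normc /= expr0n addr0 sqrtr_sqr. Qed.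

Lemma normc_nat k : normc k%:R = k%:R :> R.
Proof. by rewrite -(rmorph_nat (real_complex R)) normc_real ger0_norm. Qed.

Lemma normc_conj x : normc (conjc x) = normc x.
Proof. by case: x => a b /=; rewrite sqrrN. Qed.

Lemma mul_conjc x : x * conjc x = ((normc x) ^+ 2)%:C.
Proof.
case: x => a b /=; rewrite sqr_sqrtr ?addr_ge0 ?sqr_ge0//.
by apply/eqP; rewrite eq_complex /=; apply/andP; split; apply/eqP; ring.
Qed.

End NormC.

(** * Interpolation and the Cotlar identity for l_p bounds of matrices *)

Section PowerSums.
Variable R : realType.

(** Convexity of the p-th power in tangent form: Young's inequality at the mean s = S / W bounds
    each s^(p-1) y_i, and summing with the weights leaves W s^p. The total weight is only bounded by
    W, which is the form used below as a triangle inequality. *)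
Lemma powR_jensen (I : finType) (w y : I -> R) (W p : R) : 1 <= p ->
  (forall i, 0 <= w i) -> (forall i, 0 <= y i) -> 0 < W -> \sum_i w i <= W ->
  (\sum_i w i * y i) `^ p <= W `^ (p - 1) * \sum_i w i * y i `^ p.
Proof.
move=> p1 w0 y0 W0 wW.
have S0 : 0 <= \sum_i w i * y i by apply: sumr_ge0 => i _; exact: mulr_ge0.
have [->|pn1] := eqVneq p 1.
  rewrite subrr powRr0 mul1r powRr1// ler_sum// => i _; by rewrite powRr1.
have {}p1 : 1 < p by rewrite lt_neqAle eq_sym pn1.
have p0 : 0 < p by lra.
have p10 : 0 < p - 1 by lra.
set S := \sum_i w i * y i; set s := S / W.
have s0 : 0 <= s by rewrite divr_ge0// ltW.
have SE : S = W * s by rewrite /s mulrC divfK// gt_eqF.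
have ineq i : s `^ (p - 1) * y i <= s `^ p * (1 - p^-1) + y i `^ p / p.
  have q0 : 0 < p / (p - 1) by rewrite divr_gt0.
  have := @conjugate_powR R (s `^ (p - 1)) (y i) (p / (p - 1)) p
     (powR_ge0 _ _) (y0 i) q0 p0.
  have -> : (p / (p - 1))^-1 = 1 - p^-1.
    by rewrite invf_div mulrBl divff ?gt_eqF// mul1r.
  rewrite -powRrM (_ : (p - 1) * (p / (p - 1)) = p); last first.
    by rewrite mulrCA divff ?mulr1// gt_eqF.
  by apply; rewrite subrK.
have := @ler_sum _ _ (index_enum I) xpredT _ _
  (fun i _ => ler_wpM2l (w0 i) (ineq i)).
under eq_bigr do rewrite mulrCA.
rewrite -mulr_sumr -/S.
under [leRHS]eq_bigr do rewrite mulrDr [X in _ + X]mulrA.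
rewrite big_split /= -!mulr_suml.
set T := \sum_i w i * y i `^ p => H.
have Ws : W * s `^ p <= T.
  have e1 : s `^ (p - 1) * S = W * s `^ p.
    by rewrite SE mulrCA [_ * s]mulrC mulr_powRB1.
  have : W * s `^ p <= W * (s `^ p * (1 - p^-1)) + T / p.
    rewrite -e1 (le_trans H)// lerD2r ler_wpM2r// mulr_ge0 ?powR_ge0//.
    by rewrite subr_ge0 invf_le1// ltW.
  have pV : 0 < p^-1 by rewrite invr_gt0.
  move=> H2; rewrite -(@ler_pM2r _ p^-1)//.
  move: H2; rewrite [1 - _]addrC; nra.
rewrite SE powRM ?(ltW W0)// -(@mulr_powRB1 _ W)// ?(ltW W0)//.
rewrite mulrAC mulrC ler_wpM2l ?powR_ge0//.
Qed.

Lemma powRD_le (a b p : R) : 0 <= a -> 0 <= b -> 0 <= p ->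
  (a + b) `^ p <= 2 `^ p * (a `^ p + b `^ p).
Proof.
move=> a0 b0 p0.
wlog ab : a b a0 b0 / a <= b.
  by case: (leP a b) => [ab /(_ a b)|/ltW ab /(_ b a)];
    rewrite // addrC [X in _ <= _ * X]addrC; apply.
apply: (@le_trans _ _ ((2 * b) `^ p)).
  by rewrite ge0_ler_powR// ?nnegrE; lra.
by rewrite powRM// ler_wpM2l ?powR_ge0// lerDr powR_ge0.
Qed.

Lemma powRXl (a s : R) l : 0 <= a -> (a ^+ l) `^ s = (a `^ s) ^+ l.
Proof.
move=> a0; elim: l => [|l IH]; first by rewrite !expr0 powR1.
by rewrite !exprS powRM ?exprn_ge0// IH.
Qed.

Lemma powRVl (a s : R) : 0 <= a -> (a^-1) `^ s = (a `^ s)^-1.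
Proof. by move=> a0; rewrite -powR_inv1// -powRrM mulN1r powRN. Qed.

(** A geometric sum is at most q / (q - 1) times its last term, and the last admissible term is at
    most Y. It evaluates the sums over dyadic levels in the interpolation argument. *)
Lemma geometric_below (q c Y : R) (n : nat) : 1 < q -> 0 < c -> 0 <= Y ->
  \sum_(i < n | q ^+ i * c <= Y) q ^+ i * c <= Y * (q / (q - 1)).
Proof.
move=> q1 c0 Y0; have q0 : 0 < q by lra.
have q10 : 0 < q - 1 by lra.
elim: n => [|n IH].
  by rewrite big_ord0 mulr_ge0// divr_ge0// ltW.
rewrite big_mkcond big_ord_recr /= -big_mkcond /=; case: ifPn => [nY|_]; last by rewrite addr0.
apply: (@le_trans _ _ (\sum_(i < n.+1) q ^+ i * c)).
  rewrite big_ord_recr /= lerD2r big_mkcond ler_sum// => i _.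
  by case: ifP => // _; rewrite mulr_ge0 ?exprn_ge0// ltW.
rewrite -mulr_suml.
have -> : \sum_(i < n.+1) q ^+ i = (q ^+ n.+1 - 1) / (q - 1).
  by rewrite subrX1 mulrAC divff ?mul1r// gt_eqF.
rewrite mulrAC [leRHS]mulrA ler_pM2r ?invr_gt0//.
rewrite exprS mulrBl mul1r; nra.
Qed.

Variable n : nat.
Implicit Types (A : 'M[R[i]]_n) (x : 'I_n -> R[i]) (p B : R).

Definition mv A x (j : 'I_n) : R[i] := \sum_k A j k * x k.

Definition psum p x : R := \sum_j normc (x j) `^ p.

(** [B] bounds the p-th power of the operator norm on l_p. Keeping p-th powers avoids roots, and is
    why scaling by W multiplies bounds by W^p. *)
Definition lpb p B A := forall x, psum p (mv A x) <= B * psum p x.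

Lemma psum_ge0 p x : 0 <= psum p x.
Proof. by apply: sumr_ge0 => j _; exact: powR_ge0. Qed.

Lemma lpbW p B B' A : B <= B' -> lpb p B A -> lpb p B' A.
Proof. by move=> BB h x; rewrite (le_trans (h x))// ler_wpM2r ?psum_ge0. Qed.

Lemma mvM A A' x : mv (A *m A') x =1 mv A (mv A' x).
Proof.
move=> j; rewrite /mv; under eq_bigr do rewrite mxE mulr_suml.
rewrite exchange_big /=; apply: eq_bigr => k _; rewrite mulr_sumr.
by apply: eq_bigr => l _; rewrite mulrA.
Qed.

Lemma eq_mv A x y : x =1 y -> mv A x =1 mv A y.
Proof. by move=> xy j; apply: eq_bigr => k _; rewrite xy. Qed.

Lemma eq_psum p x y : x =1 y -> psum p x = psum p y.
Proof. by move=> xy; apply: eq_bigr => k _; rewrite xy. Qed.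

(** The triangle inequality for operator norms in p-th powers: Jensen's inequality with the weights
    |d i| is applied in each coordinate. *)
Lemma lpb_sum (I : finType) (d : I -> R[i]) (M : I -> 'M[R[i]]_n) (W : R) p B :
  1 <= p -> 0 < W -> 0 <= B -> \sum_i normc (d i) <= W ->
  (forall i, lpb p B (M i)) -> lpb p (W `^ p * B) (\sum_i d i *: M i).
Proof.
move=> p1 W0 B0 dW MB x.
have mvE j : mv (\sum_i d i *: M i) x j = \sum_i d i * mv (M i) x j.
  rewrite /mv; under eq_bigr do rewrite summxE mulr_suml.
  rewrite exchange_big /=; apply: eq_bigr => i _; rewrite mulr_sumr.
  by apply: eq_bigr => k _; rewrite mxE mulrA.
apply: (@le_trans _ _ (\sum_j W `^ (p - 1) * \sum_i normc (d i) * normc (mv (M i) x j) `^ p)).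
  apply: ler_sum => j _; rewrite mvE.
  apply: le_trans (powR_jensen p1 _ _ W0 dW); last 2 first.
  - by move=> i; exact: normc_ge0.
  - by move=> i; exact: normc_ge0.
  rewrite ge0_ler_powR ?nnegrE ?normc_ge0//; first by lra.
    by apply: sumr_ge0 => i _; rewrite mulr_ge0 ?normc_ge0.
  by apply: le_trans (normc_sum _ _ _) _; apply: ler_sum => i _; rewrite normcM.
rewrite -mulr_sumr exchange_big /=.
under eq_bigr do rewrite -mulr_sumr.
rewrite -mulrA (_ : W `^ p = W `^ (p - 1) * W); last first.
  by rewrite mulrC mulr_powRB1 ?(ltW W0)//; lra.
rewrite -!mulrA ler_wpM2l ?powR_ge0//.
apply: (@le_trans _ _ (\sum_i normc (d i) * (B * psum p x))).
  by apply: ler_sum => i _; rewrite ler_wpM2l ?normc_ge0//; exact: MB.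
by rewrite -mulr_suml ler_wpM2r// mulr_ge0// psum_ge0.
Qed.

Lemma psumD p x y : 0 <= p ->
  psum p (fun j => x j + y j) <= 2 `^ p * (psum p x + psum p y).
Proof.
move=> p0; rewrite /psum -big_split /= mulr_sumr; apply: ler_sum => j _.
apply: le_trans (powRD_le _ _ p0); rewrite ?normc_ge0//.
by rewrite ge0_ler_powR ?nnegrE ?addr_ge0 ?normc_ge0// normcD.
Qed.

Lemma lpb1 p : lpb p 1 (1%:M : 'M[R[i]]_n).
Proof.
move=> x; rewrite mul1r le_eqVlt; apply/orP; left; apply/eqP; apply: eq_psum => j.
rewrite /mv (bigD1 j)//= mxE eqxx mul1r big1 ?addr0// => k kj.
by rewrite mxE eq_sym (negbTE kj) mul0r.
Qed.

Lemma lpb_diag p B A (d e : 'I_n -> R[i]) :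
  (forall j, normc (d j) = 1) -> (forall j, normc (e j) = 1) ->
  lpb p B A -> lpb p B (\matrix_(j, k) (d j * A j k * e k)).
Proof.
move=> d1 e1 AB x.
have -> : psum p x = psum p (fun k => e k * x k).
  by apply: eq_bigr => k _; rewrite normcM e1 mul1r.
apply: le_trans (AB _); rewrite le_eqVlt; apply/orP; left; apply/eqP.
apply: eq_bigr => j _; rewrite -[normc (mv A _ j)]mul1r -(d1 j) -normcM.
congr (normc _ `^ _); rewrite /mv mulr_sumr; apply: eq_bigr => k _.
by rewrite mxE !mulrA.
Qed.

(* Marcinkiewicz' argument: for each dyadic level split x at that level. *)
Lemma lpb_interpolation p q B A : 2 < p -> p < q -> 0 <= B ->
  lpb 2 B A -> lpb q B A ->
  lpb p (4 `^ p * B * (2 `^ (p - 2) / (2 `^ (p - 2) - 1)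
                     + 2 `^ (q - p) / (2 `^ (q - p) - 1))) A.
Proof.
move=> p2 pq B0 A2 Aq x.
have p0 : 0 < p by lra.
have qp0 : 0 < q - p by lra.
have p20 : 0 < p - 2 by lra.
pose y := mv A x.
(* [L] is so large that the levels from 2^-L to 2^L enclose half of every nonzero |y_i|. A zero
   entry contributes 0 to the sum, the inverse of 0 being 0. *)
pose L := (Num.truncn (\sum_i (normc (y i) + 2 / normc (y i)))).+1.
have L0 : \sum_i (normc (y i) + 2 / normc (y i)) < L%:R.
  exact: truncnS_gt.
have yL i : normc (y i) + 2 / normc (y i) < L%:R.
  apply: le_lt_trans L0; rewrite (bigD1 i)//= lerDl sumr_ge0// => k _.
  by rewrite addr_ge0 ?divr_ge0 ?normc_ge0.
have L2 : L%:R <= 2 ^+ L :> R.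
  by rewrite -natrX ler_nat ltnW// ltn_expl.
pose b (l : nat) : R := 2 ^+ l / 2 ^+ L.
have b0 l : 0 < b l by rewrite divr_gt0 ?exprn_gt0.
pose n' := (L + L).+1.
pose hi l j := if b l < normc (x j) then x j else 0.
pose lo l j := if b l < normc (x j) then 0 else x j.
have xE l : x =1 (fun j => hi l j + lo l j).
  by move=> j; rewrite /hi /lo; case: ifP; rewrite ?addr0 ?add0r.
have yE l j : y j = mv A (hi l) j + mv A (lo l) j.
  rewrite /y (eq_mv _ (xE l)) /mv -big_split /=.
  by apply: eq_bigr => k _; rewrite mulrDr.
(* At each level the large entries are measured in l_2 and the small ones in l_q. The powers of
   [b l] are those for which both sums over the levels become geometric and end at |x_j|^p. *)
pose w l i := b l `^ (p - 2) * normc (mv A (hi l) i) `^ 2 +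
              b l `^ (p - q) * normc (mv A (lo l) i) `^ q.
have w0 l i : 0 <= w l i by rewrite addr_ge0 ?mulr_ge0 ?powR_ge0.
have bp l s : b l `^ (p - s) * b l `^ s = b l `^ p.
  by rewrite -powRD ?subrK// (gt_eqF (b0 l)) implybT.
(* Take the level with b_k <= |y_i| / 2 < b_(k+1). Then |y_i| <= 4 b_k, and one of the two parts of
   y_i has modulus at least b_k, so the single term [w k i] suffices. *)
have step1 i : normc (y i) `^ p <= 4 `^ p * \sum_(l < n') w l i.
  have [->|yi0] := eqVneq (normc (y i)) 0.
    rewrite powR0 ?gt_eqF// mulr_ge0 ?powR_ge0// sumr_ge0// => l _; exact: w0.
  have {}yi0 : 0 < normc (y i) by rewrite lt_neqAle eq_sym yi0 normc_ge0.
  have yiL := yL i.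
  have ex : exists k, normc (y i) / 2 < b k.
    exists (L + L)%N; rewrite /b exprD mulfK ?expf_neq0//.
    apply: lt_le_trans L2; apply: lt_trans yiL.
    have : 0 <= 2 / normc (y i) by rewrite divr_ge0// ltW.
    by lra.
  have [k ky kmin] := ex_minnP ex.
  have b0y : b 0%N <= normc (y i) / 2.
    rewrite /b expr0 mul1r -[leRHS]invrK lef_pV2 ?posrE ?exprn_gt0 ?invr_gt0 ?divr_gt0//.
    rewrite invf_div (le_trans _ L2)// ltW// (le_lt_trans _ yiL)//.
    by rewrite lerDr normc_ge0.
  case: k ky kmin => [|k] ky kmin.
    by move: ky; rewrite ltNge b0y.
  have kn : (k < n')%N.
    rewrite /n' ltnS -ltnS; apply: (leq_trans (kmin _ _)); last exact: leqnSn.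
    rewrite /b exprD mulfK ?expf_neq0//.
    apply: lt_le_trans L2; apply: lt_trans yiL.
    have : 0 <= 2 / normc (y i) by rewrite divr_ge0// ltW.
    by lra.
  have bky : b k <= normc (y i) / 2.
    by rewrite leNgt; apply/negP => /kmin; rewrite ltnn.
  have bk4 : normc (y i) <= 4 * b k.
    have bS : b k.+1 = 2 * b k by rewrite /b exprS mulrA.
    by move: ky; rewrite bS; set bb := b k; clear; lra.
  rewrite (bigD1 (Ordinal kn))//= mulrDr.
  apply: (@le_trans _ _ (4 `^ p * w k i)); last first.
    by rewrite lerDl mulr_ge0 ?powR_ge0// sumr_ge0// => l _; exact: w0.
  apply: (@le_trans _ _ ((4 * b k) `^ p)).
    by rewrite ge0_ler_powR ?nnegrE ?normc_ge0// ?mulr_ge0 ?ltW.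
  rewrite powRM// ?(ltW (b0 _))// ler_wpM2l ?powR_ge0//.
  have uv : b k <= normc (mv A (hi k) i) \/ b k <= normc (mv A (lo k) i).
    apply/orP; rewrite leNgt -implybE; apply/implyP => hb.
    have := normcD (mv A (hi k) i) (mv A (lo k) i); rewrite -yE.
    by move: hb bky; clear; lra.
  rewrite /w; case: uv => uv.
    apply: (@le_trans _ _ (b k `^ (p - 2) * normc (mv A (hi k) i) `^ 2)).
      rewrite -(bp k 2) ler_wpM2l ?powR_ge0// ge0_ler_powR ?nnegrE ?normc_ge0//.
      by rewrite ltW.
    by rewrite lerDl mulr_ge0 ?powR_ge0.
  apply: (@le_trans _ _ (b k `^ (p - q) * normc (mv A (lo k) i) `^ q)).
    rewrite -(bp k q) ler_wpM2l ?powR_ge0// ge0_ler_powR ?nnegrE ?normc_ge0//.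
      by clear -p2 pq; lra.
    by rewrite ltW.
  by rewrite lerDr mulr_ge0 ?powR_ge0.
have step2 l : \sum_i w l i <= B * \sum_j (b l `^ (p - 2) * normc (hi l j) `^ 2 +
              b l `^ (p - q) * normc (lo l j) `^ q).
  rewrite /w big_split /= -!mulr_sumr big_split /= -!mulr_sumr mulrDr.
  by rewrite mulrCA [X in _ <= _ + X]mulrCA lerD// ler_wpM2l ?powR_ge0//;
    [exact: A2|exact: Aq].
have bE l s : b l `^ s = (2 `^ s) ^+ l * (2 `^ s) ^- L.
  by rewrite /b powRM ?exprn_ge0 ?invr_ge0 ?exprn_ge0// powRVl ?exprn_ge0// !powRXl.
have xp0 j (s : R) : s != 0 -> x j = 0 -> normc (x j) `^ s = 0.
  by move=> s0 ->; rewrite normc0 powR0.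
have q2 s : 0 < s -> 1 < 2 `^ s :> R.
  move=> s0; have := @gt0_ltr_powR R s s0 1 2.
  by rewrite powR1 !nnegrE ltr1n; apply.
have L0' s : 0 < (2 `^ s) ^- L :> R by rewrite invr_gt0 exprn_gt0// powR_gt0.
have xps j s : x j != 0 -> normc (x j) `^ (p - s) * normc (x j) `^ s = normc (x j) `^ p.
  by move=> xj; rewrite -powRD ?subrK// (gt_eqF (normc_gt0 xj)) implybT.
have step3 j : \sum_(l < n') (b l `^ (p - 2) * normc (hi l j) `^ 2) <=
    2 `^ (p - 2) / (2 `^ (p - 2) - 1) * normc (x j) `^ p.
  have [xj0|xj0] := eqVneq (x j) 0.
    rewrite xp0 ?gt_eqF// mulr0 big1// => l _.
    by rewrite /hi xj0 if_same normc0 powR0 ?mulr0// gt_eqF.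
  apply: (@le_trans _ _ ((\sum_(l < n' | (2 `^ (p - 2)) ^+ l * (2 `^ (p - 2)) ^- L <=
       normc (x j) `^ (p - 2)) (2 `^ (p - 2)) ^+ l * (2 `^ (p - 2)) ^- L) *
       normc (x j) `^ 2)).
    rewrite mulr_suml [leRHS]big_mkcond; apply: ler_sum => l _; rewrite /hi -!bE.
    case: (ltP (b l) (normc (x j))) => bx; last first.
      rewrite normc0 powR0 ?gt_eqF// mulr0; case: ifP => // _.
      by rewrite mulr_ge0 ?powR_ge0.
    rewrite ge0_ler_powR ?nnegrE ?normc_ge0//; [exact: ltW|exact: ltW|exact: ltW].
  rewrite -(xps j 2 xj0) mulrA ler_wpM2r ?powR_ge0// [leRHS]mulrC.
  by apply: geometric_below; rewrite ?powR_ge0//; exact: q2.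
have step4 j : \sum_(l < n') (b l `^ (p - q) * normc (lo l j) `^ q) <=
    2 `^ (q - p) / (2 `^ (q - p) - 1) * normc (x j) `^ p.
  have q0 : 0 < q by clear -p2 pq; lra.
  have [xj0|xj0] := eqVneq (x j) 0.
    rewrite xp0 ?gt_eqF// mulr0 big1// => l _.
    by rewrite /lo xj0 if_same normc0 powR0 ?mulr0// gt_eqF.
  have pqE : p - q = - (q - p) by rewrite opprB.
  apply: (@le_trans _ _ ((\sum_(l < n' | (2 `^ (q - p)) ^+ l * (2 `^ (q - p)) ^- L <=
       normc (x j) `^ (p - q)) (2 `^ (q - p)) ^+ l * (2 `^ (q - p)) ^- L) *
       normc (x j) `^ q)).
    (* The exponent p - q is negative, so the levels are summed from the top to obtain an increasing
       geometric sum. *)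
    rewrite mulr_suml [leRHS]big_mkcond (reindex_inj rev_ord_inj) /=.
    apply: ler_sum => l _; rewrite /lo.
    have bl : (2 `^ (q - p)) ^+ l * (2 `^ (q - p)) ^- L = b (n' - l.+1)%N `^ (p - q).
      rewrite pqE powRN bE invfM invrK mulrC.
      have lL : (l <= L + L)%N by rewrite -ltnS.
      have Q0 : (2 `^ (q - p)) ^+ (L + L - l) != 0 by rewrite expf_neq0// gt_eqF// powR_gt0.
      rewrite /n' subSS; apply: (mulIf Q0).
      rewrite [RHS]mulrAC mulVf// mul1r -mulrA -exprD subnKC// exprD mulKf//.
    rewrite bl; set m := (n' - l.+1)%N.
    case: (ltP (b m) (normc (x j))) => bx.
      rewrite normc0 powR0 ?gt_eqF// mulr0; case: ifP => // _.
      by rewrite mulr_ge0 ?powR_ge0.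
    rewrite ifT// pqE !powRN lef_pV2 ?posrE ?powR_gt0 ?normc_gt0//.
    rewrite ge0_ler_powR ?nnegrE ?normc_ge0//; exact: ltW.
  rewrite -(xps j q xj0) mulrA ler_wpM2r ?powR_ge0// [leRHS]mulrC.
  by apply: geometric_below; rewrite ?powR_ge0//; exact: q2.
apply: (@le_trans _ _ (\sum_i 4 `^ p * \sum_(l < n') w l i)).
  exact: ler_sum.
rewrite -mulr_sumr -!mulrA ler_wpM2l ?powR_ge0//.
rewrite exchange_big /=; apply: (@le_trans _ _ (\sum_(l < n') (B * \sum_j (b l `^ (p - 2) * normc (hi l j) `^ 2 +
              b l `^ (p - q) * normc (lo l j) `^ q)))).
  by apply: ler_sum => l _; exact: step2.
rewrite -mulr_sumr ler_wpM2l// exchange_big /= mulr_sumr; apply: ler_sum => j _.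
by rewrite big_split /= mulrDl lerD.
Qed.

(* With |y| = |Ax|^(p-1), the p-sum of Ax is the pairing of Ax with y, that is
   of x with Ay up to sign; Young's inequality then absorbs half of it. *)
Lemma lpb_dual p B A : 1 < p -> 0 < B -> A^T = - A ->
  lpb (p / (p - 1)) B A -> lpb p (2 * (2 * B) `^ (p - 1)) A.
Proof.
move=> p1 B0 AT Ab x.
have p0 : 0 < p by lra.
have p10 : 0 < p - 1 by lra.
pose q := p / (p - 1); have q0 : 0 < q by rewrite divr_gt0.
pose z := mv A x.
pose y j := (normc (z j) `^ (p - 2))%:C * conjc (z j).
have ny j : normc (y j) = normc (z j) `^ (p - 1).
  rewrite /y normcM normc_real ger0_norm ?powR_ge0// normc_conj.
  have [->|zj] := eqVneq (z j) 0.
    by rewrite normc0 mulr0 powR0// gt_eqF.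
  rewrite -{2}[normc (z j)]powRr1 ?normc_ge0// -powRD ?(gt_eqF (normc_gt0 zj)) ?implybT//.
  by congr (_ `^ _); ring.
have nyq j : normc (y j) `^ q = normc (z j) `^ p.
  by rewrite ny -powRrM /q mulrCA divff ?mulr1// gt_eqF.
have zy j : z j * y j = (normc (z j) `^ p)%:C.
  rewrite /y mulrCA mul_conjc -rmorphM; congr (_%:C).
  have [->|zj] := eqVneq (z j) 0.
    by rewrite normc0 expr0n mulr0 powR0// gt_eqF.
  by rewrite -powR_mulrn ?normc_ge0// -powRD ?subrK// (gt_eqF (normc_gt0 zj)) implybT.
have pair : \sum_j z j * y j = - \sum_k x k * mv A y k.
  rewrite /z /mv; under eq_bigr do rewrite mulr_suml.
  rewrite exchange_big /= -sumrN; apply: eq_bigr => k _.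
  rewrite mulr_sumr -sumrN; apply: eq_bigr => j _.
  have -> : A k j = - A j k by move/matrixP/(_ j k): AT; rewrite !mxE.
  by ring.
set S := psum p z.
have SE : S%:C = \sum_j z j * y j.
  by rewrite rmorph_sum /=; apply: eq_bigr => j _; rewrite zy.
have S0 : 0 <= S := psum_ge0 _ _.
have SE1 : S <= \sum_k normc (x k) * normc (mv A y k).
  have -> : S = normc S%:C by rewrite normc_real ger0_norm.
  rewrite SE pair normc_opp (le_trans (normc_sum _ _ _))// ler_sum// => k _.
  by rewrite normcM.
(* t^q = 2B, so that the bound B in l_q leaves exactly S / 2 to be absorbed. *)
pose t : R := (2 * B) `^ q^-1.
have t0 : 0 < t by rewrite powR_gt0 ?mulr_gt0.
have young k : normc (x k) * normc (mv A y k) <=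
    t `^ p * normc (x k) `^ p + (2 * B)^-1 * normc (mv A y k) `^ q.
  set a := normc (x k); set b := normc (mv A y k).
  have a0 : 0 <= a := normc_ge0 _.
  have b0 : 0 <= b := normc_ge0 _.
  have pq1 : p^-1 + q^-1 = 1.
    by rewrite /q invf_div mulrBl divff ?gt_eqF// mul1r addrC subrK.
  have := @conjugate_powR R (t * a) (b / t) p q (mulr_ge0 (ltW t0) a0)
    (divr_ge0 b0 (ltW t0)) p0 q0 pq1.
  have -> : t * a * (b / t) = a * b by field; rewrite gt_eqF.
  move=> /le_trans; apply.
  apply: lerD.
    rewrite powRM ?(ltW t0)// ler_pdivrMr// ler_peMr ?mulr_ge0 ?powR_ge0//.
    exact: ltW.
  rewrite powRM ?invr_ge0 ?(ltW t0)// powRVl ?(ltW t0)// /t -powRrM mulVf ?gt_eqF//.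
  rewrite powRr1 ?mulr_ge0// ?(ltW B0)// [leRHS]mulrC ler_pdivrMr// ler_peMr//.
    by rewrite mulr_ge0 ?powR_ge0// invr_ge0 mulr_ge0// ltW.
  by rewrite /q ler_pdivlMr// mul1r; lra.
have SE2 : S <= t `^ p * psum p x + (2 * B)^-1 * (B * S).
  apply: (le_trans SE1); apply: (@le_trans _ _ (t `^ p * psum p x + (2 * B)^-1 * psum q (mv A y))).
    by rewrite /psum !mulr_sumr -big_split /= ler_sum.
  rewrite lerD2l ler_wpM2l ?invr_ge0 ?mulr_ge0 ?(ltW B0)//.
  apply: (le_trans (Ab _)); rewrite ler_wpM2l ?(ltW B0)//.
  by rewrite /psum /S /psum; under eq_bigr do rewrite nyq.
have tp : t `^ p = (2 * B) `^ (p - 1).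
  by rewrite /t -powRrM /q; congr (_ `^ _); field; rewrite !gt_eqF.
have e : (2 * B)^-1 * (B * S) = S / 2 by field; rewrite gt_eqF.
move: SE2; rewrite e tp -[2 * _ * psum _ _]mulrA.
by rewrite -/S; set u := _ * psum p x; clear; lra.
Qed.

Section Cotlar.
Variable A : 'M[R[i]]_n.
Hypothesis AT : A^T = - A.
Hypothesis three_term : forall i j k, i != j -> i != k -> j != k ->
  A i j * A i k = A j k * (A i j - A i k).

Let Aopp j k : A k j = - A j k.
Proof. by move/matrixP/(_ j k): AT; rewrite !mxE. Qed.

Let Adiag i : A i i = 0.
Proof.
have /eqP := Aopp i i; rewrite -subr_eq0 opprK -mulr2n mulrn_eq0 /=.
by move/eqP.
Qed.

(** The discrete counterpart of (Hf)^2 = 2 H(f Hf) + f^2. The three-term relation, a partial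
    fraction identity for the Cauchy kernel, rewrites each product of two entries of row i with
    distinct indices; the coinciding indices produce the terms with squared entries that stand for
    f^2. *)
Lemma cotlar_identity x i :
  mv A x i ^+ 2 = 2 * mv A (fun j => x j * mv A x j) i +
   (\sum_j A i j ^+ 2 * x j ^+ 2 + 2 * x i * \sum_j A i j ^+ 2 * x j).
Proof.
have key j k : A i j * A i k = A i j * A j k + A i k * A k j +
   ((j == k)%:R * A i j ^+ 2 + (i == j)%:R * A i k ^+ 2 + (i == k)%:R * A i j ^+ 2).
  rewrite (Aopp j k).
  have [<-|jk] := eqVneq j k.
    by have [<-|ij] := eqVneq i j; rewrite ?Adiag /=; ring.
  have [<-|ij] := eqVneq i j; first by rewrite ?Adiag /=; ring.
  have [<-|ik] := eqVneq i k.
    by rewrite ?Adiag (Aopp i j) /=; ring.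
  by rewrite three_term//=; ring.
rewrite expr2 {1 2}/mv big_distrl /=.
under eq_bigr do rewrite big_distrr /=.
have -> : \sum_j \sum_k A i j * x j * (A i k * x k) =
  \sum_j \sum_k A i j * (x j * (A j k * x k)) +
  (\sum_j \sum_k A i k * (x k * (A k j * x j)) +
  (\sum_j \sum_k (j == k)%:R * A i j ^+ 2 * (x j * x k) +
  (\sum_j \sum_k (i == j)%:R * A i k ^+ 2 * (x j * x k) +
  \sum_j \sum_k (i == k)%:R * A i j ^+ 2 * (x j * x k)))).
  rewrite -!big_split; apply: eq_bigr => j _; rewrite -!big_split.
  apply: eq_bigr => k _ /=; rewrite mulrACA key; ring.
have s1 : \sum_j \sum_k A i j * (x j * (A j k * x k)) = mv A (fun j => x j * mv A x j) i.
  by apply: eq_bigr => j _; rewrite -!mulr_sumr.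
have s2 : \sum_j \sum_k A i k * (x k * (A k j * x j)) = mv A (fun j => x j * mv A x j) i.
  by rewrite exchange_big /=; apply: eq_bigr => j _; rewrite -!mulr_sumr.
have s3 : \sum_j \sum_k (j == k)%:R * A i j ^+ 2 * (x j * x k) = \sum_j A i j ^+ 2 * x j ^+ 2.
  apply: eq_bigr => j _; rewrite (bigD1 j)//= eqxx mul1r -expr2 big1 ?addr0// => k kj.
  by rewrite eq_sym (negbTE kj) !mul0r.
have s4 : \sum_j \sum_k (i == j)%:R * A i k ^+ 2 * (x j * x k) = x i * \sum_j A i j ^+ 2 * x j.
  rewrite (bigD1 i)//= eqxx [X in _ + X]big1 ?addr0; last first.
    by move=> j ji; rewrite big1// => k _; rewrite eq_sym (negbTE ji) !mul0r.
  by rewrite mulr_sumr; apply: eq_bigr => k _; rewrite /= mul1r; ring.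
have s5 : \sum_j \sum_k (i == k)%:R * A i j ^+ 2 * (x j * x k) = x i * \sum_j A i j ^+ 2 * x j.
  rewrite mulr_sumr; apply: eq_bigr => j _; rewrite (bigD1 i)//= eqxx big1 ?addr0.
    by rewrite /= mul1r; ring.
  by move=> k ki; rewrite eq_sym (negbTE ki) !mul0r.
by rewrite s1 s2 s3 s4 s5; ring.
Qed.

Hypothesis row1 : forall i, \sum_j normc (A i j) ^+ 2 <= 1.

(** The l_2q norm of Ax is governed by the l_q norm of (Ax)^2, which Cotlar's identity reduces to A
    applied to x * Ax and to terms controlled by the row sums. The product x * Ax is split by a
    weighted arithmetic-geometric inequality so that the part with Ax can be absorbed. *)
Lemma lpb_double q B : 1 <= q -> 0 < B -> lpb q B A ->
  lpb (2 * q) (2 * (2 * (2 `^ q * 2 `^ q * B) ^+ 2 + 2 `^ q * 2 `^ q * (2 `^ q + 1))) A.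
Proof.
move=> q1 B0 Aq x.
have q0 : 0 < q by lra.
pose y := mv A x.
set G := 2 `^ q * 2 `^ q.
have G0 : 0 < G by rewrite mulr_gt0// powR_gt0.
have pow2q (t : R[i]) : normc t `^ (2 * q) = (normc t ^+ 2) `^ q.
  by rewrite powRrM -(powR_mulrn 2 (normc_ge0 t)).
have nn (t : R[i]) : 0 <= normc t ^+ 2 by rewrite exprn_ge0 ?normc_ge0.
pose X := psum (2 * q) x; pose Y := psum (2 * q) y.
pose E i := \sum_j A i j ^+ 2 * x j ^+ 2 + 2 * x i * \sum_j A i j ^+ 2 * x j.
have Ebound i : normc (E i) `^ q <=
   \sum_j normc (A i j) ^+ 2 * (2 `^ q * (2 `^ q * normc (x j) `^ (2 * q) + normc (x i) `^ (2 * q))).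
  apply: (@le_trans _ _ ((\sum_j normc (A i j) ^+ 2 * (2 * normc (x j) ^+ 2 + normc (x i) ^+ 2)) `^ q)).
    rewrite ge0_ler_powR ?nnegrE ?normc_ge0 ?(ltW q0)//.
      apply: sumr_ge0 => j _; apply: mulr_ge0; first exact: nn.
      by apply: addr_ge0; [apply: mulr_ge0 => //|]; exact: nn.
    rewrite /E mulr_sumr -big_split /=; apply: (le_trans (normc_sum _ _ _)).
    apply: ler_sum => j _; apply: (le_trans (normcD _ _)).
    rewrite !(normcM, normcX) (_ : normc 2 = 2) ?normc_nat//.
    set a := normc (A i j); set b := normc (x j); set c := normc (x i).
    have : 0 <= a ^+ 2 * (b - c) ^+ 2 by rewrite mulr_ge0 ?sqr_ge0.
    by clear; nra.
  apply: (@le_trans _ _ (1 `^ (q - 1) * \sum_j normc (A i j) ^+ 2 * (2 * normc (x j) ^+ 2 + normc (x i) ^+ 2) `^ q)).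
    apply: powR_jensen => //.
    by move=> j; apply: addr_ge0; [apply: mulr_ge0 => //|]; exact: nn.
  rewrite powR1 mul1r; apply: ler_sum => j _; rewrite ler_wpM2l ?nn//.
  apply: le_trans (powRD_le (mulr_ge0 _ (nn _)) (nn _) (ltW q0)) _ => //.
  by rewrite powRM ?nn// !pow2q.
have Esum : \sum_i normc (E i) `^ q <= 2 `^ q * (2 `^ q + 1) * X.
  apply: (le_trans (ler_sum _ (fun i _ => Ebound i))).
  under eq_bigr do under eq_bigr do rewrite mulrCA mulrDr mulrCA.
  under eq_bigr do rewrite -mulr_sumr big_split /= -mulr_sumr.
  rewrite -mulr_sumr -mulrA ler_wpM2l ?powR_ge0// big_split /= [leRHS]mulrDl mul1r -mulr_sumr.
  apply: lerD.
    rewrite ler_wpM2l ?powR_ge0// exchange_big /= /X /psum; apply: ler_sum => j _.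
    rewrite -mulr_suml -[leRHS]mul1r ler_wpM2r ?powR_ge0//.
    apply: le_trans (row1 j); apply: ler_sum => k _.
    by rewrite Aopp normc_opp.
  apply: ler_sum => j _; rewrite -mulr_suml -[leRHS]mul1r ler_wpM2r ?powR_ge0//.
(* This weight makes the coefficient G * B * D of [Y] on the right equal to 1/2. *)
pose D := (2 * G * B)^-1.
have D0 : 0 < D by rewrite invr_gt0 !mulr_gt0.
pose d := D `^ q^-1.
have d0 : 0 < d by rewrite powR_gt0.
have dq : d `^ q = D by rewrite -powRrM mulVf ?gt_eqF// powRr1 ?ltW.
have dV0 : 0 <= d^-1 by rewrite invr_ge0 ltW.
have xyb : psum q (fun j => 2 * (x j * y j)) <= 2 `^ q * (D * Y + D^-1 * X).
  rewrite /psum /Y /X /psum !mulr_sumr -big_split /= mulr_sumr; apply: ler_sum => j _.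
  rewrite !pow2q.
  apply: (@le_trans _ _ ((d * normc (y j) ^+ 2 + d^-1 * normc (x j) ^+ 2) `^ q)).
    rewrite ge0_ler_powR ?nnegrE ?normc_ge0 ?(ltW q0)//.
      by exact: addr_ge0 (mulr_ge0 (ltW d0) (nn _)) (mulr_ge0 dV0 (nn _)).
    rewrite !normcM (_ : normc 2 = 2) ?normc_nat//.
    set a := normc (x j); set b := normc (y j).
    have : 0 <= d^-1 * (d * b - a) ^+ 2 by rewrite mulr_ge0 ?sqr_ge0.
    have -> : d^-1 * (d * b - a) ^+ 2 = d * b ^+ 2 + d^-1 * a ^+ 2 - 2 * (a * b).
      by field; rewrite gt_eqF.
    by rewrite subr_ge0.
  apply: le_trans (powRD_le (mulr_ge0 (ltW d0) (nn _)) (mulr_ge0 dV0 (nn _)) (ltW q0)) _.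
  by rewrite (powRM _ (ltW d0) (nn _)) (powRM _ dV0 (nn _)) (powRVl _ (ltW d0)) dq.
have mv2 i : 2 * mv A (fun j => x j * mv A x j) i = mv A (fun j => 2 * (x j * y j)) i.
  by rewrite /mv mulr_sumr; apply: eq_bigr => j _; rewrite mulrCA.
have Y1 : Y <= 2 `^ q * (B * (2 `^ q * (D * Y + D^-1 * X)) + 2 `^ q * (2 `^ q + 1) * X).
  have YE : Y = psum q (fun i => mv A (fun j => 2 * (x j * y j)) i + E i).
    by apply: eq_bigr => i _; rewrite pow2q -normcX cotlar_identity mv2.
  rewrite [leLHS]YE; apply: (le_trans (psumD _ _ (ltW q0))); rewrite ler_wpM2l ?powR_ge0//.
  apply: lerD; last exact: Esum.
  by apply: (le_trans (Aq _)); rewrite ler_wpM2l ?(ltW B0).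
have : Y <= G * B * D * Y + (G * B * D^-1 + G * (2 `^ q + 1)) * X.
  by apply: (le_trans Y1); rewrite le_eqVlt; apply/orP; left; apply/eqP; rewrite /G; ring.
have -> : G * B * D = 2^-1 by rewrite /D; field; rewrite !gt_eqF.
have -> : G * B * D^-1 = 2 * (G * B) ^+ 2 by rewrite /D invrK; ring.
rewrite -/G -/X -/Y -/y; set K := 2 * _ + _; clear; set a := K * X.
rewrite -[2 * K * X]mulrA -/a; lra.
Qed.

End Cotlar.

End PowerSums.

Section Cis.
Variable R : realType.
Implicit Types a b : R.

Lemma cisD a b : cis (a + b) = cis a * cis b.
Proof.
by rewrite /cis cosD sinD; apply/eqP; rewrite eq_complex /= eqxx /= addrC [X in _ + X]mulrC.
Qed.

Lemma cis0 : cis 0 = 1 :> R[i].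
Proof. by rewrite /cis cos0 sin0. Qed.

Lemma normc_cis a : normc (cis a) = 1.
Proof. by rewrite /cis /= cos2Dsin2 sqrtr1. Qed.

Lemma cis_neq0 a : cis a != 0.
Proof. by apply/eqP => h; have := normc_cis a; rewrite h normc0 => /eqP; rewrite eq_sym oner_eq0. Qed.

Lemma cisN a : cis (- a) = (cis a)^-1.
Proof. by apply: (mulfI (cis_neq0 a)); rewrite -cisD subrr cis0 mulfV// cis_neq0. Qed.

Lemma conj_cis a : conjc (cis a) = (cis a)^-1.
Proof. by rewrite -cisN /cis cosN sinN. Qed.

Lemma cisX a k : cis a ^+ k = cis (a *+ k).
Proof. by elim: k => [|k IH]; rewrite ?cis0// exprS IH -cisD mulrS. Qed.

Lemma cis_neq1 a : 0 < a < 2 * pi -> cis a != 1.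
Proof.
move=> /andP[a0 api]; apply/eqP => -[ca _].
have s0 : 0 < sin (a / 2).
  by apply: sin_gt0_pi; apply/andP; split; move: (pi_gt0 R) a0 api; clear; lra.
have := cosD (a / 2) (a / 2); rewrite -mulr2n -[a / 2 *+ 2]mulr_natr divfK// ca.
have := cos2Dsin2 (a / 2); rewrite !expr2; nra.
Qed.

End Cis.

(** * Circulant matrices and the discrete Hilbert transform *)

Section DFT.
Variables (R : realType) (n : nat).
Local Notation N := n.+1.

Definition omega : R[i] := cis (2 * pi / N%:R).

Lemma prim_omega : N.-primitive_root omega.
Proof.
apply/andP; split=> //; apply/forallP => i.
rewrite unity_rootE cisX; apply/eqP; have [iN|iN] := eqVneq i.+1 N.
  apply/eqP; rewrite iN -[_ *+ _]mulr_natr divfK ?pnatr_eq0//.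
  by rewrite mulr2n mulrDl !mul1r cisD /cis cospi sinpi; apply/eqP;
    rewrite eq_complex /=; apply/andP; split; apply/eqP; ring.
apply/negbTE/cis_neq1; rewrite -[_ *+ _]mulr_natr.
rewrite !mulr_gt0 ?pi_gt0 ?invr_gt0 ?ltr0n//= mulrAC ltr_pdivrMr ?ltr0n//.
rewrite ltr_pM2l ?mulr_gt0 ?pi_gt0// ltr_nat ltn_neqAle iN /=; exact: ltn_ord.
Qed.

Lemma normc_omega : normc omega = 1. Proof. exact: normc_cis. Qed.
Lemma omega_neq0 : omega != 0. Proof. exact: cis_neq0. Qed.

Lemma omega_ratio_neq1 (j l : 'I_N) : j != l -> omega ^+ j / omega ^+ l != 1.
Proof.
move=> jl; apply/eqP => e.
have /eqP : omega ^+ j = omega ^+ l.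
  by rewrite -[RHS]mul1r -e divfK// expf_neq0// omega_neq0.
rewrite (eq_prim_root_expr prim_omega) !modn_small ?ltn_ord// => /eqP h.
by move/eqP: jl; apply; exact: val_inj.
Qed.

Lemma omega_ratioX (j l : 'I_N) : (omega ^+ j / omega ^+ l) ^+ N = 1.
Proof.
by rewrite expr_div_n -!exprM ![(_ * N)%N]mulnC !exprM (prim_expr_order prim_omega) !expr1n divr1.
Qed.

Lemma sum_ratio (j l : 'I_N) :
  \sum_(m < N) (omega ^+ j / omega ^+ l) ^+ m = (N * (j == l))%:R.
Proof.
have [->|jl] := eqVneq j l.
  rewrite divff ?expf_neq0 ?omega_neq0// muln1.
  by under eq_bigr do rewrite expr1n; rewrite sumr_const card_ord.
have := subrX1 (omega ^+ j / omega ^+ l) N; rewrite omega_ratioX subrr => /esym/eqP.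
by rewrite mulf_eq0 subr_eq0 (negbTE (omega_ratio_neq1 jl)) /= => /eqP ->; rewrite muln0.
Qed.

(** Multiplication by w - 1 telescopes the sum. The simple pole on the right is what makes the
    sawtooth a discrete Hilbert transform. *)
Lemma sum_ratio_weighted (j l : 'I_N) : j != l ->
  \sum_(m < N) m%:R * (omega ^+ j / omega ^+ l) ^+ m =
  N%:R / (omega ^+ j / omega ^+ l - 1).
Proof.
move=> jl; set w := omega ^+ j / omega ^+ l; have w1 : w - 1 != 0 by rewrite subr_eq0; exact: omega_ratio_neq1.
apply: (mulIf w1); rewrite divfK// mulrC.
have key k : (w - 1) * \sum_(m < k) m%:R * w ^+ m =
    k%:R * w ^+ k - \sum_(m < k) w ^+ m * w.
  elim: k => [|k IH]; first by rewrite !big_ord0 mul0r mulr0 subr0.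
  by rewrite !big_ord_recr /= mulrDr IH exprS -[k.+1%:R]natr1; ring.
by rewrite key omega_ratioX mulr1 -mulr_suml sum_ratio (negbTE jl) muln0 mul0r subr0.
Qed.

(* The circulant matrix with eigenvalue [c m] on the character [j |-> omega^(jm)]. *)
Definition kmat (c : nat -> R[i]) : 'M[R[i]]_N :=
  \matrix_(j, l) (N%:R^-1 * \sum_(m < N) c m * (omega ^+ j / omega ^+ l) ^+ m).

Lemma kmatE c j l : kmat c j l = N%:R^-1 * \sum_(m < N) c m * (omega ^+ j / omega ^+ l) ^+ m.
Proof. by rewrite mxE. Qed.

Lemma eq_kmat c d : (forall m, (m < N)%N -> c m = d m) -> kmat c = kmat d.
Proof.
move=> cd; apply/matrixP => j l; rewrite !kmatE; congr (_ * _).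
by apply: eq_bigr => m _; rewrite cd.
Qed.

Lemma kmat1 : kmat (fun=> 1) = 1%:M.
Proof.
apply/matrixP => j l; rewrite kmatE mxE.
under eq_bigr do rewrite mul1r.
by rewrite sum_ratio natrM mulKf ?pnatr_eq0.
Qed.

Lemma kmatD c d : kmat (fun m => c m + d m) = kmat c + kmat d.
Proof.
apply/matrixP => j l; rewrite [RHS]mxE !kmatE -mulrDr -big_split /=.
by congr (_ * _); apply: eq_bigr => m _; rewrite mulrDl.
Qed.

Lemma kmatZ a c : kmat (fun m => a * c m) = a *: kmat c.
Proof.
apply/matrixP => j l; rewrite [RHS]mxE !kmatE mulrCA; congr (_ * _).
by rewrite mulr_sumr; apply: eq_bigr => m _; rewrite mulrA.
Qed.

Lemma kmat_sum (I : Type) (r : seq I) (c : I -> nat -> R[i]) :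
  kmat (fun m => \sum_(i <- r) c i m) = \sum_(i <- r) kmat (c i).
Proof.
elim: r => [|i r IH].
  rewrite big_nil; apply/matrixP => j l; rewrite kmatE mxE big1 ?mulr0// => m _.
  by rewrite big_nil mul0r.
by rewrite big_cons -IH -kmatD; apply: eq_kmat => m _; rewrite big_cons.
Qed.

Lemma kmatM c d : kmat c *m kmat d = kmat (fun m => c m * d m).
Proof.
apply/matrixP => j l; rewrite mxE kmatE.
under eq_bigr => k _.
  rewrite !kmatE mulrACA big_distrl /=.
  under eq_bigr do rewrite big_distrr /=.
  over.
rewrite -mulr_sumr.
rewrite (_ : \sum_(k < N) _ = N%:R * \sum_(m < N) c m * d m * (omega ^+ j / omega ^+ l) ^+ m); last first.
  rewrite exchange_big mulr_sumr /=; apply: eq_bigr => m _.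
  rewrite exchange_big /= (bigD1 m)//= [X in _ + X]big1 ?addr0 => [|m' m'm].
    rewrite (eq_bigr (fun=> c m * d m * (omega ^+ j / omega ^+ l) ^+ m)); last first.
      move=> k _; rewrite mulrACA -exprMn; congr (_ * _ ^+ _).
      by rewrite mulrA divfK// expf_neq0// omega_neq0.
    by rewrite sumr_const card_ord -[LHS]mulr_natl.
  transitivity (c m * d m' * (omega ^+ m) ^+ j / (omega ^+ m') ^+ l *
     \sum_(k < N) (omega ^+ m' / omega ^+ m) ^+ k).
    rewrite mulr_sumr; apply: eq_bigr => k _.
    rewrite !expr_div_n -!exprM (mulnC m j) (mulnC m' l) (mulnC m' k) (mulnC m k).
    set a1 := omega ^+ _; set a2 := omega ^+ _; set a3 := omega ^+ _; set a4 := omega ^+ _.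
    by rewrite -!mulrA; congr (_ * _); rewrite !mulrA; rewrite -!mulrA [LHS]mulrCA; ring.
  by rewrite sum_ratio (negbTE m'm) muln0 mulr0.
by rewrite -[_ / _ * _]mulrA mulKf ?pnatr_eq0.
Qed.

Lemma normcX_omega k : normc (omega ^+ k) = 1.
Proof. by rewrite normcX normc_omega expr1n. Qed.

Lemma conjX_omega k : conjc (omega ^+ k) = (omega ^+ k)^-1.
Proof. by rewrite /omega cisX conj_cis. Qed.

Lemma kmat_adj c j l : conjc (kmat c j l) = kmat (fun m => conjc (c m)) l j.
Proof.
rewrite !kmatE rmorphM /= fmorphV rmorph_nat rmorph_sum /=; congr (_ * _).
apply: eq_bigr => m _; rewrite rmorphM rmorphXn rmorphM fmorphV /= !conjX_omega.
by congr (_ * _ ^+ _); rewrite invrK mulrC.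
Qed.

Lemma kmat_quadratic c x :
  (\sum_j normc (mv (kmat c) x j) ^+ 2)%:C =
  \sum_k \sum_l conjc (x k) * kmat (fun m => (normc (c m) ^+ 2)%:C) k l * x l.
Proof.
rewrite rmorph_sum /=; under eq_bigr => j _.
  rewrite -mul_conjc mulrC /mv rmorph_sum /= big_distrl /=.
  under eq_bigr do rewrite big_distrr /=.
  over.
rewrite exchange_big /=; apply: eq_bigr => k _.
rewrite exchange_big /=; apply: eq_bigr => l _.
rewrite (@eq_kmat (fun m => (normc (c m) ^+ 2)%:C) (fun m => conjc (c m) * c m)); last first.
  by move=> m _; rewrite mulrC mul_conjc.
rewrite -kmatM [X in _ * X * _]mxE mulr_sumr mulr_suml; apply: eq_bigr => j _.
by rewrite rmorphM /= kmat_adj; ring.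
Qed.

(* Parseval: |c|^2 <= 1 splits the identity form into two nonnegative forms. *)
Lemma kmat_lp2 c : (forall m, (m < N)%N -> normc (c m) <= 1) -> lpb 2 1 (kmat c).
Proof.
move=> c1 x; rewrite mul1r /psum.
have p2 (y : 'I_N -> R[i]) : \sum_j normc (y j) `^ 2 = \sum_j normc (y j) ^+ 2.
  by apply: eq_bigr => j _; rewrite powR_mulrn ?normc_ge0.
rewrite !p2.
have sum0 (y : 'I_N -> R[i]) : 0 <= \sum_j normc (y j) ^+ 2.
  by apply: sumr_ge0 => j _; rewrite exprn_ge0 ?normc_ge0.
have [s sP] : exists s : nat -> R[i],
    forall m, (m < N)%N -> normc (c m) ^+ 2 + normc (s m) ^+ 2 = 1.
  exists (fun m => (Num.sqrt (1 - normc (c m) ^+ 2))%:C) => m mN.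
  rewrite normc_real ger0_norm ?sqrtr_ge0// sqr_sqrtr; first by rewrite addrC subrK.
  by rewrite subr_ge0 expr_le1 ?normc_ge0//; exact: c1.
have [u uP] : exists u : nat -> R[i], u = fun=> 1 by eexists.
have e : (\sum_j normc (mv (kmat c) x j) ^+ 2)%:C + (\sum_j normc (mv (kmat s) x j) ^+ 2)%:C
    = (\sum_j normc (x j) ^+ 2)%:C.
  have -> : \sum_j normc (x j) ^+ 2 = \sum_j normc (mv (kmat u) x j) ^+ 2.
    apply: eq_bigr => j _; rewrite uP kmat1 /mv (bigD1 j)//= mxE eqxx mul1r big1 ?addr0//.
    by move=> k kj; rewrite mxE eq_sym (negbTE kj) mul0r.
  rewrite !kmat_quadratic -big_split; apply: eq_bigr => k _ /=.
  rewrite -big_split; apply: eq_bigr => l _ /=.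
  rewrite -mulrDl -mulrDr; congr (_ * _ * _).
  have /matrixP/(_ k l) := kmatD (fun m => (normc (c m) ^+ 2)%:C)
    (fun m => (normc (s m) ^+ 2)%:C).
  rewrite [in X in _ = X -> _]mxE => <-.
  have /eq_kmat -> // : forall m, (m < N)%N ->
     (normc (c m) ^+ 2)%:C + (normc (s m) ^+ 2)%:C = (normc (u m) ^+ 2)%:C.
  by move=> m mN; rewrite -rmorphD /= sP// uP normc1 expr1n.
move/(congr1 (@complex.Re R)): e => /= <-.
by rewrite lerDl sum0.
Qed.

(* Up to a diagonal factor, the circulant matrix of the centred sawtooth. *)
Definition hilb : 'M[R[i]]_N :=
  \matrix_(j, l) if j == l then 0 else (N%:R * (omega ^+ j - omega ^+ l))^-1.

Lemma omega_sub_neq0 (j l : 'I_N) : j != l -> omega ^+ j - omega ^+ l != 0.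
Proof.
move=> jl; apply: contra (omega_ratio_neq1 jl); rewrite subr_eq0 => /eqP ->.
by rewrite divff// expf_neq0// omega_neq0.
Qed.

Lemma hilb_antisym : hilb^T = - hilb.
Proof.
apply/matrixP => j l; rewrite !mxE eq_sym; case: eqVneq => [_|jl]; first by rewrite oppr0.
by rewrite -invrN -mulrN opprB.
Qed.

Lemma hilb_three_term i j k : i != j -> i != k -> j != k ->
  hilb i j * hilb i k = hilb j k * (hilb i j - hilb i k).
Proof.
move=> ij ik jk; rewrite !mxE (negbTE ij) (negbTE ik) (negbTE jk).
have := omega_sub_neq0 ij; have := omega_sub_neq0 ik; have := omega_sub_neq0 jk.
set a := omega ^+ i; set b := omega ^+ j; set c := omega ^+ k => h1 h2 h3.
have : N%:R != 0 :> R[i] by rewrite pnatr_eq0.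
by move: (N%:R : R[i]) => d N0; field; rewrite N0 h1 h2 h3.
Qed.

(** The mean n / (2N) of the values m / N is subtracted, which makes the diagonal of the circulant
    matrix vanish. *)
Let saw (m : nat) : R[i] := m%:R / N%:R - n%:R / (2 * N%:R).

Lemma hilb_kmat j l : hilb j l * omega ^+ l = kmat saw j l.
Proof.
have N0 : N%:R != 0 :> R[i] by rewrite pnatr_eq0.
rewrite kmatE mxE; under eq_bigr do rewrite mulrBl.
rewrite sumrB -mulr_sumr sum_ratio.
have [->|jl] := eqVneq j l.
  rewrite mul0r muln1 divff ?expf_neq0 ?omega_neq0//.
  under eq_bigr do rewrite expr1n mulr1.
  rewrite -mulr_suml -natr_sum -(big_mkord xpredT (fun m => m)) bin2_sum.
  have : ('C(N, 2) * 2)%N = (N * n)%N by rewrite mulnC -mul_bin_diag bin1.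
  move=> /(congr1 (fun m => m%:R : R[i])); rewrite !natrM => h.
  have -> : 'C(N, 2)%:R = N%:R * n%:R / 2 :> R[i] by rewrite -h mulfK ?pnatr_eq0.
  by move: (n%:R : R[i]) (N%:R : R[i]) N0 => d e N0; field.
rewrite muln0 mulr0 subr0.
under eq_bigr do rewrite mulrAC.
rewrite -mulr_suml sum_ratio_weighted// mulrAC divff// mul1r invfM -mulrA.
congr (_ * _); have := omega_sub_neq0 jl; have := expf_neq0 l omega_neq0.
set a := omega ^+ j; set b := omega ^+ l => b0 ab0.
have -> : a / b - 1 = (a - b) / b by rewrite mulrBl divff.
by rewrite invf_div mulrC.
Qed.

Lemma hilb_lp2 : lpb 2 1 hilb.
Proof.
have -> : hilb = \matrix_(j, l) (1 * kmat saw j l * (omega ^+ l)^-1).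
  apply/matrixP => j l; rewrite [RHS]mxE -hilb_kmat mul1r mulfK//.
  by rewrite expf_neq0// omega_neq0.
apply: lpb_diag => [j|j|]; first exact: normc1.
  by rewrite normcV normcX_omega invr1.
apply: kmat_lp2 => m mN.
have -> : saw m = (m%:R / N%:R - n%:R / (2 * N%:R))%:C.
  by rewrite /saw rmorphB !rmorphM !fmorphV /= rmorphM !rmorph_nat.
have N0 : 0 < N%:R :> R by rewrite ltr0n.
rewrite normc_real ler_norml.
have m0 : 0 <= m%:R / N%:R :> R by rewrite divr_ge0.
have m1 : m%:R / N%:R <= 1 :> R by rewrite ler_pdivrMr// mul1r ler_nat ltnW.
have n0 : 0 <= n%:R / (2 * N%:R) :> R by rewrite divr_ge0// mulr_ge0.
have n1 : n%:R / (2 * N%:R) <= 1 :> R.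
  rewrite ler_pdivrMr ?mulr_gt0// mul1r -natrM ler_nat.
  by rewrite mul2n -addnn (leq_trans (leqnSn n)) ?leq_addr.
by move: (m%:R / N%:R : R) (n%:R / (2 * N%:R) : R) m0 m1 n0 n1; clear => a b *; apply/andP; split; lra.
Qed.

(** The l_2 bound applied to a unit vector controls a column; antisymmetry turns it into a row. *)
Lemma hilb_row1 i : \sum_j normc (hilb i j) ^+ 2 <= 1.
Proof.
have := hilb_lp2 (fun j => (i == j)%:R); rewrite mul1r /psum.
have -> : \sum_j normc ((i == j)%:R : R[i]) `^ 2 = 1.
  rewrite (bigD1 i)//= eqxx normc1 powR1 big1 ?addr0// => j.
  by rewrite eq_sym => /negbTE ->; rewrite normc0 powR0.
apply: le_trans; apply: ler_sum => j _; rewrite /mv (bigD1 i)//= eqxx mulr1.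
rewrite big1 ?addr0 => [|k ki]; last by rewrite eq_sym (negbTE ki) mulr0.
have : hilb i j = - hilb j i by have /matrixP/(_ j i) := hilb_antisym; rewrite !mxE.
by move=> ->; rewrite normc_opp powR_mulrn ?normc_ge0.
Qed.

End DFT.

(** * Uniform l_p bounds for circulant matrices of bounded variation *)

Section Riesz.
Variable R : realType.

(** Each application of [lpb_double] doubles the exponent, starting from 2. The new constant depends
    on the exponent and the old constant only, hence not on the size of the matrix. *)
Lemma hilb_lp_pow2 k : exists2 B, 0 < B & forall n, lpb (2 ^+ k.+1) B (hilb R n).
Proof.
elim: k => [|k [B B0 IH]]; first by exists 1 => // n; rewrite expr1; exact: hilb_lp2.
eexists; last first.
  move=> n; rewrite exprS.
  have k1 : 1 <= 2 ^+ k.+1 :> R by rewrite exprn_ege1// ler1n.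
  exact: (lpb_double (hilb_antisym R n) (@hilb_three_term R n) (@hilb_row1 R n) k1 B0 (IH n)).
have := powR_gt0 (2 ^+ k.+1) (@ltr0Sn R 1) => h.
by rewrite mulr_gt0// addr_gt0// !mulr_gt0 ?exprn_gt0 ?addr_gt0 ?mulr_gt0.
Qed.

Lemma hilb_lp_gt2 p : 2 < p -> exists2 B, 0 < B & forall n, lpb p B (hilb R n).
Proof.
move=> p2.
have [k pk] : exists k : nat, p < 2 ^+ k.+1 :> R.
  exists (Num.truncn p); apply: (lt_le_trans (truncnS_gt p)).
  by rewrite -natrX ler_nat ltnW// ltn_expl.
have [B B0 Bq] := hilb_lp_pow2 k.
have [B1 le1 leB] : exists2 B', 1 <= B' & B <= B'.
  by exists (1 + B); rewrite ?lerDl ?lerDr// ltW.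
eexists; last first.
  move=> n; apply: (@lpb_interpolation _ _ p (2 ^+ k.+1) B1) => //.
  - by rewrite (le_trans _ le1).
  - by apply: (lpbW le1); exact: hilb_lp2.
  - by apply: (lpbW leB); exact: Bq.
have h s : 0 < s -> 0 < 2 `^ s / (2 `^ s - 1) :> R.
  move=> s0; rewrite divr_gt0 ?powR_gt0// subr_gt0.
  by have := @gt0_ltr_powR R s s0 1 2; rewrite powR1 !nnegrE ltr1n; apply.
by rewrite !mulr_gt0 ?powR_gt0 ?addr_gt0 ?h ?subr_gt0// (lt_le_trans _ le1).
Qed.

Lemma hilb_lp p : 1 < p -> exists2 B, 0 < B & forall n, lpb p B (hilb R n).
Proof.
move=> p1; have [p2|p2|->] := ltgtP p 2; last 2 first.
- exact: hilb_lp_gt2.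
- by exists 1 => // n; exact: hilb_lp2.
have p10 : 0 < p - 1 by rewrite subr_gt0.
have [|B B0 Bq] := @hilb_lp_gt2 (p / (p - 1)).
  by rewrite ltr_pdivlMr//; lra.
exists (2 * (2 * B) `^ (p - 1)); first by rewrite mulr_gt0 ?powR_gt0 ?mulr_gt0.
by move=> n; apply: lpb_dual => //; exact: hilb_antisym.
Qed.

(** The variation over 0..n together with the modulus of the final value: the total mass of the
    coefficients produced by summation by parts. *)
Definition bvar (n : nat) (c : nat -> R[i]) : R :=
  normc (c n) + \sum_(m < n) normc (c m - c m.+1).

(** Off the diagonal the entry is a geometric sum (w^k - 1) / (w - 1), that is, the difference of
    two copies of [hilb] with unimodular diagonal factors. The diagonal, where [hilb] vanishes, is
    restored by the multiple k / (n+1) of the identity. *)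
Lemma partial_sum_hilb n k : (k <= n.+1)%N ->
  kmat n (fun m => (m < k)%:R) =
  k%:R / n.+1%:R *: 1%:M +
  (\matrix_(j, l) (omega R n ^+ (j * k) * hilb R n j l * (omega R n ^+ l / omega R n ^+ (l * k)))
   - \matrix_(j, l) (1 * hilb R n j l * omega R n ^+ l)).
Proof.
move=> kn; apply/matrixP => j l; rewrite !mxE.
have -> : \sum_(m < n.+1) (m < k)%:R * (omega R n ^+ j / omega R n ^+ l) ^+ m =
   \sum_(m < k) (omega R n ^+ j / omega R n ^+ l) ^+ m.
  rewrite [RHS](big_ord_widen n.+1 (fun m => (omega R n ^+ j / omega R n ^+ l) ^+ m))//.
  rewrite [RHS]big_mkcond; apply: eq_bigr => m _.
  by case: ifP => _; rewrite ?mul1r ?mul0r.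
have [->|jl] := eqVneq j l.
  rewrite divff ?expf_neq0 ?omega_neq0//; under eq_bigr do rewrite expr1n.
  by rewrite sumr_const card_ord !mulr0 !mul0r subr0 addr0 mulr1 mulrC.
rewrite mulr0 add0r.
have := subrX1 (omega R n ^+ j / omega R n ^+ l) k.
have := omega_ratio_neq1 R jl; rewrite -subr_eq0.
set S := \sum_(m < k) _ => w1 e.
have -> : S = ((omega R n ^+ j / omega R n ^+ l) ^+ k - 1) / (omega R n ^+ j / omega R n ^+ l - 1).
  by rewrite e mulrC mulKf.
rewrite expr_div_n -!exprM.
have := omega_sub_neq0 R jl; have := expf_neq0 l (omega_neq0 R n).
have := expf_neq0 (l * k) (omega_neq0 R n).
set a := omega R n ^+ j; set b := omega R n ^+ l.
set a' := omega R n ^+ (j * k); set b' := omega R n ^+ (l * k) => h1 h2 h3.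
have : n.+1%:R != 0 :> R[i] by rewrite pnatr_eq0.
by move: (n.+1%:R : R[i]) => d N0; field; rewrite N0 h1 h2 h3.
Qed.

Lemma abel_bvar n (c : nat -> R[i]) m : (m <= n)%N ->
  c m = c n * (m < n.+1)%:R + \sum_(k < n) (c k - c k.+1) * (m < k.+1)%:R.
Proof.
move=> mn; rewrite ltnS mn mulr1.
elim: n mn => [|n IH].
  by rewrite leqn0 => /eqP ->; rewrite big_ord0 addr0.
rewrite leq_eqVlt => /orP[/eqP->|mn].
  by rewrite big1 ?addr0// => k _; rewrite ltnS leqNgt ltn_ord mulr0.
rewrite big_ord_recr /= mn mulr1 {1}IH//; ring.
Qed.

(** In terms of operator norms the bound is linear in the variation W. The factor 3^p comes from the
    three matrices that make up a partial sum. *)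
Theorem kmat_lp p : 1 < p ->
  exists2 B, 0 < B & forall n c W, 0 < W -> bvar n c <= W ->
    lpb p (W `^ p * B) (kmat n c).
Proof.
move=> p1; have [B B0 Bh] := hilb_lp p1.
pose B1 := B + 1.
have P n k : (k <= n.+1)%N -> lpb p (3 `^ p * B1) (kmat n (fun m => (m < k)%:R : R[i])).
  move=> kn; rewrite partial_sum_hilb//.
  pose d (i : 'I_3) : R[i] := if i == 0 then k%:R / n.+1%:R else if i == 1 then 1 else - 1.
  pose M (i : 'I_3) : 'M[R[i]]_n.+1 := if i == 0 then 1%:M else if i == 1 then
    \matrix_(j, l) (omega R n ^+ (j * k) * hilb R n j l * (omega R n ^+ l / omega R n ^+ (l * k)))
    else \matrix_(j, l) (1 * hilb R n j l * omega R n ^+ l).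
  have -> : k%:R / n.+1%:R *: 1%:M +
  (\matrix_(j, l) (omega R n ^+ (j * k) * hilb R n j l * (omega R n ^+ l / omega R n ^+ (l * k)))
   - \matrix_(j, l) (1 * hilb R n j l * omega R n ^+ l)) = \sum_i d i *: M i.
    by rewrite !big_ord_recl big_ord0 /d /M /= addr0 scale1r scaleN1r.
  apply: lpb_sum => //; first exact: ltW.
  - by rewrite /B1 addr_ge0 ?ltW.
  - have d0 : d ord0 = k%:R / n.+1%:R by [].
    have d1 : d (lift ord0 ord0) = 1 by [].
    have d2 : d (lift ord0 (lift ord0 ord0)) = - 1 by [].
    rewrite !big_ord_recl big_ord0 addr0 d0 d1 d2 normc_opp normc1.
    rewrite normcM normcV !normc_nat.
    have : k%:R / n.+1%:R <= 1 :> R by rewrite ler_pdivrMr ?ltr0n// mul1r ler_nat.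
    by rewrite (_ : 3 = 1 + (1 + 1) :> R) ?lerD2r//; ring.
  - move=> i; rewrite /M; case: ifP => _.
      by apply: (@lpbW _ _ _ 1); [rewrite /B1 lerDr ltW|exact: lpb1].
    have BB1 : B <= B1 by rewrite /B1 lerDl.
    case: ifP => _; apply: (lpbW BB1); apply: lpb_diag => // j.
    - exact: normcX_omega.
    - by rewrite normcM normcV !normcX_omega invr1 mulr1.
    - exact: normc1.
    - exact: normcX_omega.
exists (3 `^ p * B1); first by rewrite mulr_gt0 ?powR_gt0 ?addr_gt0.
move=> n c W W0 cW.
pose d (i : 'I_n.+1) : R[i] := if (i < n)%N then c i - c i.+1 else c n.
have -> : kmat n c = \sum_i d i *: kmat n (fun m => (m < i.+1)%:R).
  have -> : kmat n c = kmat n (fun m => \sum_(i < n.+1) d i * (m < i.+1)%:R).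
    apply: eq_kmat => m; rewrite ltnS => mn; rewrite (abel_bvar c mn) big_ord_recr /=.
    rewrite /d /= ltnn addrC; congr (_ + _); apply: eq_bigr => i _.
    by rewrite ltn_ord.
  rewrite (kmat_sum _ _ (fun i m => d i * (m < i.+1)%:R)).
  by apply: eq_bigr => i _; rewrite kmatZ.
apply: lpb_sum => //; first exact: ltW.
- by rewrite mulr_ge0 ?powR_ge0// addr_ge0 ?ltW.
- apply: le_trans cW; rewrite /bvar big_ord_recr /d /= ltnn addrC lerD2l.
  by apply: ler_sum => i _; rewrite ltn_ord.
- by move=> i; exact: P.
Qed.

End Riesz.

Section RealNorm.
Variables (R : realType) (X : normedModType R[i]).
Implicit Types (x y : X) (a : R[i]).

Lemma rnormE x : (rnorm x)%:C = `|x|.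
Proof.
rewrite /rnorm; have := normr_ge0 x; rewrite lecE => /andP[/eqP im _].
by apply/eqP; rewrite eq_complex /= im !eqxx.
Qed.

Lemma rnorm_ge0 x : 0 <= rnorm x.
Proof. by have := normr_ge0 x; rewrite -rnormE -[0]/(0%:C) lecR. Qed.

Lemma rnorm0 : rnorm (0 : X) = 0.
Proof. by rewrite /rnorm normr0. Qed.

Lemma rnorm0_eq0 x : rnorm x = 0 -> x = 0.
Proof. by move=> x0; apply/eqP; rewrite -normr_eq0 -rnormE x0. Qed.

Lemma rnormD x y : rnorm (x + y) <= rnorm x + rnorm y.
Proof. by rewrite -lecR rmorphD /= !rnormE ler_normD. Qed.

Lemma rnormN x : rnorm (- x) = rnorm x.
Proof. by rewrite /rnorm normrN. Qed.

Lemma rnormB x y : rnorm (x - y) <= rnorm x + rnorm y.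
Proof. by rewrite -(rnormN y) rnormD. Qed.

Lemma rdistC x y : rnorm (x - y) = rnorm (y - x).
Proof. by rewrite -rnormN opprB. Qed.

Lemma rnormZ a x : rnorm (a *: x) = normc a * rnorm x.
Proof.
have : (rnorm (a *: x))%:C = (normc a * rnorm x)%:C.
  by rewrite rmorphM /= !rnormE normrZ.
by move=> /(congr1 (@complex.Re R)).
Qed.

End RealNorm.

(** * Block operators on L_p *)

Section Affine.
Variable R : realType.
Local Notation mu := (@lebesgue_measure R).
Local Notation RR := (measurableTypeR R).
Variables (a c : R).
Hypothesis a0 : 0 < a.

Let phi (x : RR) : RR := a * x + c.

Let mphi : measurable_fun setT phi.
Proof. by apply: measurable_funD => //; exact: measurable_funM. Qed.

Let nu : {measure set RR -> \bar R} :=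
  measure_function_pushforward__canonical__measure_function_Measure mu mphi.
Let A0 : {nonneg R} := NngNum (ltW a0).

(** Both sides are measures in [A] that agree on half-open intervals, so uniqueness of the Lebesgue
    measure applies. *)
Lemma lebesgue_measure_affine (A : set RR) : measurable A ->
  mu A = (a%:E * mu (phi @^-1` A))%E.
Proof.
move=> mA; rewrite (@lebesgue_measure_unique R (mscale A0 nu))// => X [[x1 x2] _ <-] /=.
rewrite /mscale /= /pushforward.
have -> : phi @^-1` `]x1, x2]%classic = `](x1 - c) / a, (x2 - c) / a]%classic.
  by apply/seteqP; split => x /=; rewrite !in_itv /= /phi ltr_pdivrMr// ler_pdivlMr//;
    rewrite ltrBlDr lerBrDr mulrC.
rewrite !lebesgue_measure_itv /= !lte_fin ltr_pM2r ?invr_gt0// ltrD2r.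
case: ifP => _; last by rewrite mule0.
by rewrite -!EFinB -EFinM; congr EFin; field; rewrite gt_eqF.
Qed.

Lemma ge0_integral_affine (D : set RR) (f : RR -> \bar R) :
  measurable D -> measurable_fun D f -> (forall x, D x -> 0 <= f x)%E ->
  (\int[mu]_(x in D) f x = a%:E * \int[mu]_(x in phi @^-1` D) f (a * x + c)%R)%E.
Proof.
move=> mD mf f0.
rewrite (@eq_measure_integral _ _ _ _ (mscale A0 nu)); last first.
  by move=> A mA _; exact: lebesgue_measure_affine.
rewrite ge0_integral_mscale//; congr (_ * _)%E.
rewrite (ge0_integral_pushforward mphi)//.
by move=> y /[1!inE]; exact: f0.
Qed.

End Affine.

Section Blocks.
Variable R : realType.
Local Notation mu := (@lebesgue_measure R).
Local Notation RR := (measurableTypeR R).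
Implicit Types (x : RR) (n j k : nat).

(* The unit interval [z, z+1[ is cut into 2|z|+1 pieces of equal length;
   [block x] is |z| and [piece x] the index of the piece of x. *)
Definition block x : nat := `|Num.floor x|%N.
Definition piece x : nat :=
  Num.truncn ((x - (Num.floor x)%:~R) * (block x).*2.+1%:R).
(** For n > 0 a cell has two components, one in [n, n+1[ and one in [-n, -n+1[. The translations
    [move] preserve the integer part on cells, so both components are treated simultaneously. *)
Definition cell n j : set RR := [set x | block x = n /\ piece x = j].
Definition move n j k (x : RR) : RR := x + (k%:R - j%:R) / n.*2.+1%:R.

Lemma piece_itv x :
  (piece x)%:R <= (x - (Num.floor x)%:~R) * (block x).*2.+1%:R < (piece x).+1%:R.
Proof.
apply: truncn_itv; rewrite mulr_ge0// subr_ge0.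
by have /andP[] := floor_itv x.
Qed.

Lemma piece_lt x : (piece x < (block x).*2.+1)%N.
Proof.
rewrite -(ltr_nat R); have /andP[h _] := piece_itv x; apply: le_lt_trans h _.
rewrite -[ltRHS]mul1r ltr_pM2r ?ltr0n//.
have /andP[_] := floor_itv x; rewrite intrD; lra.
Qed.

Lemma cell_ge n j : (n.*2.+1 <= j)%N -> cell n j = set0.
Proof.
move=> nj; apply/seteqP; split=> // x [/= xn xj].
by have := piece_lt x; rewrite xn xj ltnNge nj.
Qed.

Lemma cellP n j (z : int) x : (j < n.*2.+1)%N -> `|z|%N = n ->
  (cell n j x /\ Num.floor x = z) <->
  z%:~R + j%:R / n.*2.+1%:R <= x < z%:~R + j.+1%:R / n.*2.+1%:R.
Proof.
move=> jn zn.
have N0 : 0 < n.*2.+1%:R :> R by rewrite ltr0n.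
split.
  move=> [[xn xj] xz]; have := piece_itv x; rewrite xj xn xz.
  by rewrite -ler_pdivrMr// -ltr_pdivlMr// lerBrDl ltrBlDl.
move=> /andP[x1 x2].
have xz : Num.floor x = z.
  apply: floor_def; rewrite (le_trans _ x1) ?lerDl ?divr_ge0//=.
  rewrite (lt_le_trans x2)// intrD lerD2l// ler_pdivrMr// mul1r ler_nat//.
have xn : block x = n by rewrite /block xz.
split=> //; split=> //; rewrite /piece xn xz; apply: truncn_def.
by rewrite -ler_pdivrMr// -ltr_pdivlMr// lerBrDl ltrBlDl x1.
Qed.

Lemma cell_move n j k x : (k < n.*2.+1)%N -> cell n j x -> cell n k (move n j k x).
Proof.
move=> kn xE; have [xn xj] := xE.
have jn : (j < n.*2.+1)%N by rewrite -xj -xn piece_lt.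
pose z := Num.floor x.
have zn : `|z|%N = n by [].
have /(cellP x jn zn) : cell n j x /\ Num.floor x = z by [].
move=> /andP[h1 h2].
suff /(cellP _ kn zn)[] : z%:~R + k%:R / n.*2.+1%:R <= move n j k x
     < z%:~R + k.+1%:R / n.*2.+1%:R by [].
rewrite /move mulrBl; move: h1 h2; rewrite -!natr1 !mulrDl; lra.
Qed.

Lemma moveK n j k : cancel (move n j k) (move n k j).
Proof. by move=> x; rewrite /move -addrA -mulrDl; ring. Qed.

Lemma move_move n i j k x : move n j k (move n i j x) = move n i k x.
Proof. by rewrite /move -addrA -mulrDl; congr (_ + _ / _); ring. Qed.

Lemma preimage_move_cell n j k : (j < n.*2.+1)%N -> (k < n.*2.+1)%N ->
  move n j k @^-1` cell n k = cell n j.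
Proof.
move=> jn kn; apply/seteqP; split => x /=; last exact: cell_move.
by move=> /(cell_move jn); rewrite moveK.
Qed.

Lemma measurable_cell n j : measurable (cell n j).
Proof.
have [nj|jn] := leqP n.*2.+1 j; first by rewrite cell_ge.
pose I (z : int) : set RR := `[z%:~R + j%:R / n.*2.+1%:R, z%:~R + j.+1%:R / n.*2.+1%:R[%classic.
rewrite (_ : cell n j = I n%:Z `|` I (- n%:Z)).
  by apply: measurableU; exact: measurable_itv.
have IE z x : `|z|%N = n -> I z x <-> cell n j x /\ Num.floor x = z.
  by move=> zn; rewrite (cellP _ jn zn) /I /= in_itv.
apply/seteqP; split => x.
  move=> xE; have [xn _] := xE; rewrite /block in xn.
  have [z0|z0] := leP 0 (Num.floor x).
    by left; apply/IE => //; split=> //; rewrite -xn gez0_abs.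
  by right; apply/IE; rewrite ?abszN//; split=> //; rewrite -xn ltz0_abs// opprK.
by case=> /IE; rewrite ?abszN// => /(_ erefl)[].
Qed.

Definition blocks n : set RR := [set x | block x = n].

Lemma blocksE n : blocks n = \bigcup_j cell n j.
Proof.
apply/seteqP; split => x; first by move=> xn; exists (piece x).
by case=> j _ [].
Qed.

Lemma blocksE_ord n : blocks n = \big[setU/set0]_(j <- iota 0 n.*2.+1) cell n j.
Proof.
rewrite -bigcup_seq; apply/seteqP; split => x; last by case=> j _ [].
by move=> xn; exists (piece x) => //; apply: (etrans (mem_iota _ _ _)); rewrite -xn add0n piece_lt.
Qed.

Lemma setT_blocks : [set: RR] = \bigcup_n blocks n.
Proof. by apply/seteqP; split => // x _; exists (block x). Qed.

Lemma measurable_blocks n : measurable (blocks n).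
Proof. by rewrite blocksE; apply: bigcup_measurable => j _; exact: measurable_cell. Qed.

Lemma trivIset_blocks : trivIset setT blocks.
Proof. by move=> i j _ _ [x [<- <-]]. Qed.

Lemma measurable_fun_cells d (T : measurableType d) (f : RR -> T) :
  (forall n j, measurable_fun (cell n j) f) -> measurable_fun setT f.
Proof.
move=> mf; rewrite setT_blocks; apply/measurable_fun_bigcup.
  by move=> n; exact: measurable_blocks.
move=> n; rewrite blocksE; apply/measurable_fun_bigcup => // j.
exact: measurable_cell.
Qed.

Lemma measurable_move n j k : measurable_fun setT (move n j k).
Proof. by apply: measurable_funD => //; exact: measurable_cst. Qed.

Lemma integral_cell n j k (u : RR -> \bar R) :
  (j < n.*2.+1)%N -> (k < n.*2.+1)%N ->
  measurable_fun setT u -> (forall x, 0 <= u x)%E ->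
  (\int[mu]_(x in cell n k) u x = \int[mu]_(x in cell n j) u (move n j k x))%E.
Proof.
move=> jn kn mu' u0.
rewrite (@ge0_integral_affine R 1 ((k%:R - j%:R) / n.*2.+1%:R) ltr01)//.
- rewrite mul1e (_ : _ @^-1` _ = cell n j).
    by apply: eq_integral => x _; rewrite mul1r.
  rewrite -(preimage_move_cell jn kn); apply/seteqP.
  by split => x /=; rewrite mul1r.
- exact: measurable_cell.
- exact: measurable_funTS.
Qed.

(** This identifies L_p of a block with the L_p functions on its first cell with values in l_p of
    dimension 2n+1. A matrix bound can then be applied pointwise on that cell. *)
Lemma integral_blocks n (u : RR -> \bar R) :
  measurable_fun setT u -> (forall x, 0 <= u x)%E ->
  (\int[mu]_(x in blocks n) u x =
   \int[mu]_(x in cell n 0) \sum_(j < n.*2.+1) u (move n 0 j x))%E.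
Proof.
move=> mu' u0; rewrite blocksE_ord ge0_integral_bigsetU//.
- under [RHS]eq_integral do rewrite -(big_mkord xpredT (fun j => u (move n 0 j _))) /index_iota subn0.
  rewrite ge0_integral_sum//.
  + apply: eq_big_seq => j; rewrite mem_iota add0n => /andP[_ jn].
    exact: integral_cell.
  + exact: measurable_cell.
  + move=> j; apply: measurable_funTS; apply: (measurableT_comp mu').
    exact: measurable_move.
- by move=> j; exact: measurable_cell.
- exact: iota_uniq.
- by move=> i j _ _ [x [[_ <-] [_ <-]]].
- exact: measurable_funTS.
Qed.

Lemma integral_blocksT (u : RR -> \bar R) :
  measurable_fun setT u -> (forall x, 0 <= u x)%E ->
  (\int[mu]_x u x = \sum_(n <oo) \int[mu]_(x in blocks n) u x)%E.
Proof.
move=> mu' u0; rewrite [in LHS]setT_blocks ge0_integral_bigcup//.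
- by move=> n; exact: measurable_blocks.
- exact: measurable_funTS.
- exact: trivIset_blocks.
Qed.

End Blocks.

Section BlockOperators.
Local Open Scope quotient_scope.
Variables (R : realType) (p : R).
Hypothesis p1 : 1 < p.
Local Notation mu := (@lebesgue_measure R).
Local Notation RR := (measurableTypeR R).

(* A symbol attaches to the block n the eigenvalues c n m, m <= 2n, of a
   circulant matrix acting on the 2n+1 pieces. *)
Definition symbol := nat -> nat -> R[i].

Definition opf (c : symbol) (f : RR -> R[i]) (x : RR) : R[i] :=
  \sum_(k < (block x).*2.+1)
    kmat (block x).*2 (c (block x)) (inord (piece x)) k * f (move (block x) (piece x) k x).

Lemma opfE c f n (j : 'I_n.*2.+1) x : cell n j x ->
  opf c f x = mv (kmat n.*2 (c n)) (fun k => f (move n j k x)) j.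
Proof.
move=> [xn xj]; rewrite /opf; move: (piece x) xj => i ->.
move: (block x) xn => b bn; subst b.
by apply: eq_bigr => k _; rewrite inord_val.
Qed.

Lemma opfM c d f : opf c (opf d f) = opf (fun n m => c n m * d n m) f.
Proof.
apply/funext => x.
have xE : cell (block x) (Ordinal (piece_lt x)) x by [].
rewrite !(opfE _ _ xE) -kmatM mvM; apply: eq_mv => k.
have := cell_move (ltn_ord k) xE => /opfE ->.
by apply: eq_mv => l; rewrite move_move.
Qed.

Lemma opf1 f : opf (fun _ _ => 1) f = f.
Proof.
apply/funext => x; have xE : cell (block x) (Ordinal (piece_lt x)) x by [].
rewrite (opfE _ _ xE) kmat1 /mv (bigD1 (Ordinal (piece_lt x)))//= mxE eqxx mul1r.
rewrite big1 ?addr0; first by rewrite /move subrr mul0r addr0.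
by move=> k kx; rewrite mxE eq_sym (negbTE kx) mul0r.
Qed.

Lemma opf_lin c a f g : opf c (fun x => a * f x + g x) = fun x => a * opf c f x + opf c g x.
Proof.
apply/funext => x; rewrite /opf mulr_sumr -big_split /=; apply: eq_bigr => k _.
by rewrite mulrDr mulrCA.
Qed.

Lemma opf_sym_lin a c d f :
  opf (fun n m => a * c n m + d n m) f = fun x => a * opf c f x + opf d f x.
Proof.
apply/funext => x; rewrite /opf mulr_sumr -big_split /=; apply: eq_bigr => k _.
by rewrite kmatD kmatZ !mxE mulrDl mulrA.
Qed.

Lemma eq_opf c d f : (forall n m, (m <= n.*2)%N -> c n m = d n m) -> opf c f = opf d f.
Proof.
move=> cd; apply/funext => x; rewrite /opf.
by rewrite (@eq_kmat _ _ (c (block x)) (d (block x)))// => m; rewrite ltnS; exact: cd.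
Qed.

Lemma cmeasurable_sum (I : Type) (s : seq I) (a : I -> R[i]) (F : I -> RR -> R[i]) :
  (forall i, cmeasurable (F i)) -> cmeasurable (fun x => \sum_(i <- s) a i * F i x).
Proof.
move=> mF; elim: s => [|i s IH].
  by under eq_fun do rewrite big_nil; split; exact: measurable_cst.
by under eq_fun do rewrite big_cons; exact: cmeasurable_comb.
Qed.

Lemma cmeasurable_move (f : RR -> R[i]) n j k : cmeasurable f -> cmeasurable (f \o move n j k).
Proof.
by move=> [mr mi]; split; [apply: (measurableT_comp mr)|apply: (measurableT_comp mi)];
  exact: measurable_move.
Qed.

Lemma cmeasurable_opf c f : cmeasurable f -> cmeasurable (opf c f).
Proof.
move=> mf.
pose h n (j : 'I_n.*2.+1) x := \sum_k kmat n.*2 (c n) j k * f (move n j k x).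
have mh n j : cmeasurable (h n j).
  by apply: cmeasurable_sum => k; exact: cmeasurable_move.
suff E (r : R[i] -> RR) : (forall n j, measurable_fun setT (r \o h n j)) ->
    measurable_fun setT (r \o opf c f).
  by split; apply: E => n j; have [] := mh n j.
move=> mr; apply: measurable_fun_cells => n j.
have [nj|jn] := leqP n.*2.+1 j.
  by rewrite cell_ge//; exact: measurable_fun_set0.
apply: (@eq_measurable_fun _ _ _ _ _ (r \o h n (Ordinal jn))).
  by move=> x /[1!inE] xE; rewrite /= (@opfE c f n (Ordinal jn)).
exact: measurable_funTS.
Qed.

(** [K] bounds the operator norm itself, uniformly over the blocks; the p-th power converts to the
    convention of [lpb]. *)
Definition sym_bounded (c : symbol) (K : R) :=
  0 <= K /\ forall n, lpb p (K `^ p) (kmat n.*2 (c n)).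

Lemma integral_opf c K f : sym_bounded c K -> cmeasurable f ->
  (\int[mu]_x (normc (opf c f x) `^ p)%:E <= (K `^ p)%:E * \int[mu]_x (normc (f x) `^ p)%:E)%E.
Proof.
move=> [K0 cK] mf.
have mpow g : cmeasurable g -> measurable_fun setT (fun x : RR => (normc (g x) `^ p)%:E).
  move=> mg; apply/measurable_EFinP.
  apply: (measurableT_comp (measurable_powR p)); exact: measurable_normc.
have pow0 (g : RR -> R[i]) x : (0 <= (normc (g x) `^ p)%:E)%E by rewrite lee_fin powR_ge0.
have mo := mpow _ (cmeasurable_opf c mf); have mf' := mpow _ mf.
rewrite (integral_blocksT mo (pow0 _)) (integral_blocksT mf' (pow0 _)).
rewrite -nneseriesZl ?lee_fin ?powR_ge0//; last first.
  by move=> n _; apply: integral_ge0 => x _; exact: pow0.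
apply: lee_nneseries => [n _ _|n _]; first by apply: integral_ge0 => x _; exact: pow0.
rewrite (integral_blocks _ mo (pow0 _)) (integral_blocks _ mf' (pow0 _)).
have msum (g : RR -> R[i]) : cmeasurable g ->
    measurable_fun (cell n 0) (fun x => \sum_(j < n.*2.+1) (normc (g (move n 0 j x)) `^ p)%:E)%E.
  move=> mg; apply: emeasurable_sum => j.
  by apply: measurable_funTS; exact: (mpow (g \o move n 0 j) (cmeasurable_move _ _ _ mg)).
rewrite -ge0_integralZl ?lee_fin ?powR_ge0//; last 3 first.
- exact: measurable_cell.
- exact: msum.
- by move=> x _; apply: sume_ge0 => j _; exact: pow0.
apply: ge0_le_integral => //.
- exact: measurable_cell.
- by move=> x _; apply: sume_ge0 => j _; exact: pow0.
- by apply: msum; exact: cmeasurable_opf.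
- by apply: measurable_funeM; exact: msum.
move=> x xE; rewrite !sumEFin -EFinM lee_fin.
rewrite (eq_bigr (fun j : 'I_n.*2.+1 =>
   normc (mv (kmat n.*2 (c n)) (fun k : 'I_n.*2.+1 => f (move n 0 k x)) j) `^ p)).
  exact: cK.
move=> j _; have /opfE -> := cell_move (ltn_ord j) xE.
by congr (normc _ `^ _); apply: eq_mv => k; rewrite move_move.
Qed.

Lemma Lnorm_opf c K f : sym_bounded c K -> cmeasurable f ->
  ('N[mu]_p%:E[EFin \o (fun x => normc (opf c f x))] <=
   K%:E * 'N[mu]_p%:E[EFin \o (fun x => normc (f x))])%E.
Proof.
move=> cK mf; have [K0 _] := cK; rewrite unlock /=.
have p0 : 0 < p by rewrite (lt_trans ltr01).
have e (g : RR -> R[i]) : (\int[mu]_x `|(normc (g x))%:E| `^ p = \int[mu]_x (normc (g x) `^ p)%:E)%E.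
  by apply: eq_integral => x _; rewrite /= ger0_norm ?normc_ge0.
have int0 (g : RR -> R[i]) : (0 <= \int[mu]_x (normc (g x) `^ p)%:E)%E.
  by apply: integral_ge0 => x _; rewrite lee_fin powR_ge0.
have KE : K%:E = ((K `^ p)%:E `^ p^-1)%E.
  by rewrite poweR_EFin -powRrM mulfV ?gt_eqF// powRr1.
rewrite !e {1}KE -poweRM ?lee_fin ?powR_ge0//.
apply: gt0_ler_poweR; rewrite ?invr_ge0 ?(ltW p0)//; last exact: integral_opf.
- by rewrite in_itv /= leey andbT.
- by rewrite in_itv /= leey andbT mule_ge0 ?lee_fin ?powR_ge0.
Qed.

Lemma opf_cLfun c K f : sym_bounded c K -> f \in cLfun mu p%:E ->
  opf c f \in cLfun mu p%:E.
Proof.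
move=> cK /cLfunP[mf nf]; apply/cLfunP; split; first exact: cmeasurable_opf.
apply: le_lt_trans (Lnorm_opf cK mf) _.
by rewrite lte_mul_pinfty ?lee_fin//; case: cK.
Qed.

Local Notation X := (Lp_R p1).

Definition toLp (f : RR -> R[i]) (h : f \in cLfun mu p%:E) : X :=
  \pi_(cLspace mu (lt1_lee1 p1)) (CLfun (lt1_lee1 p1) h).

Lemma toLp_repr (u : X) : exists f, exists h : f \in cLfun mu p%:E, u = toLp h.
Proof.
exists (repr u : RR -> R[i]), (cLfun_subproof (repr u)).
by rewrite /toLp -[LHS]reprK; congr \pi_(_); case: (repr u).
Qed.

Lemma rnorm_toLp f (h : f \in cLfun mu p%:E) :
  (rnorm (toLp h))%:E = 'N[mu]_p%:E[EFin \o (fun x => normc (f x))]%E.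
Proof.
have := cLnormK (CLfun (lt1_lee1 p1) h) => /= <-; congr EFin.
by rewrite /rnorm -[`|_|]/(cLspace_norm _) /toLp cLspace_normE.
Qed.

Lemma toLp_eqP f g (hf : f \in cLfun mu p%:E) (hg : g \in cLfun mu p%:E) :
  toLp hf = toLp hg <-> (\forall t \ae mu, f t = g t).
Proof. exact: cLspace_eqP. Qed.

Lemma toLp_lin (a : R[i]) f g (hf : f \in cLfun mu p%:E) (hg : g \in cLfun mu p%:E)
   (h : (fun x => a * f x + g x) \in cLfun mu p%:E) :
  toLp h = a *: toLp hf + toLp hg.
Proof.
rewrite /toLp -[_ *: _]/(cLscale _ _) cLscaleE -cLpiD; congr \pi_(_).
exact/val_inj.
Qed.

Lemma cLfun_lin (a : R[i]) f g : f \in cLfun mu p%:E -> g \in cLfun mu p%:E ->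
  (fun x => a * f x + g x) \in cLfun mu p%:E.
Proof. exact: (cLfun_submod_closed mu (lt1_lee1 p1)).2. Qed.

(** Defined for every symbol through a representative, with value 0 if the image leaves L_p, so that
    no proof of boundedness is an argument. Only bounded symbols are ever evaluated. *)
Definition Phi (c : symbol) (u : X) : X :=
  if pselect (opf c (repr u) \in cLfun mu p%:E) is left h then toLp h else 0.

(** By linearity it is enough that the difference of two representatives, a function of norm 0, is
    sent to a function of norm 0. The norm bound gives this. *)
Lemma PhiE c K f (h : f \in cLfun mu p%:E) (ch : opf c f \in cLfun mu p%:E) :
  sym_bounded c K -> Phi c (toLp h) = toLp ch.
Proof.
move=> cK; rewrite /Phi.
set g := repr (toLp h).
have gE : toLp (cLfun_subproof g) = toLp h.
  by rewrite -[RHS]reprK -/g /toLp; congr \pi_(_); case: g.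
case: pselect => [h'|]; last by have := opf_cLfun cK (cLfun_subproof g).
have h1 := cLfun_lin (- 1) h (cLfun_subproof g).
have := toLp_lin h (cLfun_subproof g) h1; rewrite gE scaleN1r addNr => e0.
have h2 := opf_cLfun cK h1.
have n0 : toLp h2 = 0.
  apply: rnorm0_eq0; apply/eqP; rewrite eq_le rnorm_ge0 andbT.
  rewrite -lee_fin rnorm_toLp; have /cLfunP[mf1 _] := h1.
  apply: (le_trans (Lnorm_opf cK mf1)).
  by rewrite -(rnorm_toLp h1) e0 rnorm0 mule0.
have h3 := cLfun_lin (- 1) ch h'.
have : toLp h3 = toLp h2.
  by apply/toLp_eqP; apply: nearW => x; rewrite opf_lin.
rewrite n0 (toLp_lin ch h' h3) scaleN1r => /eqP.
by rewrite addrC subr_eq0 => /eqP.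
Qed.

Lemma Phi_bound c K u : sym_bounded c K -> rnorm (Phi c u) <= K * rnorm u.
Proof.
move=> cK; have [f [h ->]] := toLp_repr u.
rewrite (PhiE h (opf_cLfun cK h) cK) -lee_fin EFinM !rnorm_toLp.
by apply: Lnorm_opf => //; have /cLfunP[] := h.
Qed.

Lemma Phi_lin c K a u v : sym_bounded c K ->
  Phi c (a *: u + v) = a *: Phi c u + Phi c v.
Proof.
move=> cK; have [f [hf ->]] := toLp_repr u; have [g [hg ->]] := toLp_repr v.
rewrite -(toLp_lin hf hg (cLfun_lin a hf hg)).
have h1 := opf_cLfun cK hf; have h2 := opf_cLfun cK hg.
have h3 := opf_cLfun cK (cLfun_lin a hf hg).
rewrite (PhiE _ h1 cK) (PhiE _ h2 cK) (PhiE _ h3 cK).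
rewrite -(toLp_lin h1 h2 (cLfun_lin a h1 h2)).
by apply/toLp_eqP; apply: nearW => x; rewrite opf_lin.
Qed.

Lemma PhiD c K u v : sym_bounded c K -> Phi c (u + v) = Phi c u + Phi c v.
Proof. by move=> cK; rewrite -[u in LHS]scale1r (Phi_lin _ _ _ cK) scale1r. Qed.

Lemma Phi0 c K : sym_bounded c K -> Phi c 0 = 0.
Proof.
move=> cK; apply: (addrI (Phi c 0)); rewrite addr0 -(PhiD _ _ cK).
by rewrite addr0.
Qed.

Lemma PhiZ c K a u : sym_bounded c K -> Phi c (a *: u) = a *: Phi c u.
Proof. by move=> cK; rewrite -[_ *: u in LHS]addr0 (Phi_lin _ _ _ cK) (Phi0 cK) addr0. Qed.

Lemma PhiB c K u v : sym_bounded c K -> Phi c (u - v) = Phi c u - Phi c v.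
Proof. by move=> cK; rewrite (PhiD _ _ cK) -scaleN1r (PhiZ _ _ cK) scaleN1r. Qed.

Lemma sym_boundedM c d K L : sym_bounded c K -> sym_bounded d L ->
  sym_bounded (fun n m => c n m * d n m) (K * L).
Proof.
move=> [K0 cK] [L0 dL]; split; first exact: mulr_ge0.
move=> n x; rewrite -kmatM (eq_psum _ (mvM _ _ _)) powRM// -mulrA.
by apply: le_trans (cK _ _) _; rewrite ler_wpM2l ?powR_ge0//; exact: dL.
Qed.

Lemma PhiM c d K L u : sym_bounded c K -> sym_bounded d L ->
  Phi c (Phi d u) = Phi (fun n m => c n m * d n m) u.
Proof.
move=> cK dL; have cdK := sym_boundedM cK dL.
have [f [hf ->]] := toLp_repr u.
have h1 := opf_cLfun dL hf; have h2 := opf_cLfun cK h1; have h3 := opf_cLfun cdK hf.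
rewrite (PhiE _ h1 dL) (PhiE _ h2 cK) (PhiE _ h3 cdK).
by apply/toLp_eqP; apply: nearW => x; rewrite opfM.
Qed.

Lemma eq_sym_bounded c d K : (forall n m, (m <= n.*2)%N -> c n m = d n m) ->
  sym_bounded c K -> sym_bounded d K.
Proof.
move=> cd [K0 cK]; split; first exact: K0.
move=> n.
have <- : kmat n.*2 (c n) = kmat n.*2 (d n) by apply: eq_kmat => m; rewrite ltnS; exact: cd.
exact: cK.
Qed.

Lemma eq_Phi c d : (forall n m, (m <= n.*2)%N -> c n m = d n m) -> Phi c =1 Phi d.
Proof. by move=> cd u; rewrite /Phi (eq_opf _ cd). Qed.

Lemma sym_boundedW c K L : K <= L -> sym_bounded c K -> sym_bounded c L.
Proof.
move=> KL [K0 cK]; have L0 := le_trans K0 KL; split=> // n.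
by apply: lpbW (cK n); rewrite ge0_ler_powR ?nnegrE// (le_trans _ (ltW p1)).
Qed.

Lemma sym_bounded1 : sym_bounded (fun _ _ => 1) 1.
Proof. by split=> // n; rewrite powR1 kmat1; exact: lpb1. Qed.

Lemma Phi1 u : Phi (fun _ _ => 1) u = u.
Proof.
have [f [hf ->]] := toLp_repr u.
rewrite (PhiE _ (opf_cLfun sym_bounded1 hf) sym_bounded1).
by apply/toLp_eqP; apply: nearW => x; rewrite opf1.
Qed.

Lemma sym_bounded_lin a c d K L : sym_bounded c K -> sym_bounded d L ->
  exists L', sym_bounded (fun n m => a * c n m + d n m) L'.
Proof.
move=> cK dL; have M0 : 0 <= K + L by rewrite addr_ge0//; [case: cK|case: dL].
have KM : K <= K + L by rewrite lerDl; case: dL.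
have LM : L <= K + L by rewrite lerDr; case: cK.
pose W := normc a + 1.
have W0 : 0 < W by rewrite ltr_wpDl ?normc_ge0.
exists (W * (K + L)); split; first by rewrite mulr_ge0 ?(ltW W0).
move=> n; rewrite powRM ?(ltW W0)//.
pose e (i : 'I_2) := if i == 0 then a else 1.
pose M (i : 'I_2) := kmat n.*2 (if i == 0 then c n else d n).
have -> : kmat n.*2 (fun m => a * c n m + d n m) = \sum_i e i *: M i.
  by rewrite !big_ord_recl big_ord0 addr0 /e /M /= scale1r kmatD kmatZ.
apply: lpb_sum; rewrite ?powR_ge0//; first exact: ltW.
  have e1 : e (lift ord0 ord0) = 1 by [].
  by rewrite !big_ord_recl big_ord0 addr0 e1 normc1.
move=> i; rewrite /M; case: ifP => _.
  by have [_ /(_ n)] := sym_boundedW KM cK.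
by have [_ /(_ n)] := sym_boundedW LM dL.
Qed.

Lemma Phi_sym_lin a c d K L u : sym_bounded c K -> sym_bounded d L ->
  Phi (fun n m => a * c n m + d n m) u = a *: Phi c u + Phi d u.
Proof.
move=> cK dL; have [K' cdK] := sym_bounded_lin a cK dL.
have [f [hf ->]] := toLp_repr u.
have h1 := opf_cLfun cK hf; have h2 := opf_cLfun dL hf; have h3 := opf_cLfun cdK hf.
rewrite (PhiE _ h1 cK) (PhiE _ h2 dL) (PhiE _ h3 cdK).
rewrite -(toLp_lin h1 h2 (cLfun_lin a h1 h2)).
by apply/toLp_eqP; apply: nearW => x; rewrite opf_sym_lin.
Qed.

Lemma sym_bounded_bvar : exists2 B, 0 < B & forall c W, 0 < W ->
  (forall n, bvar n.*2 (c n) <= W) -> sym_bounded c (W * B).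
Proof.
have [B B0 hB] := kmat_lp p1; have p0 : 0 < p := lt_trans ltr01 p1.
exists (B `^ p^-1); first by rewrite powR_gt0.
move=> c W W0 cW; split; first by rewrite mulr_ge0 ?powR_ge0 ?ltW.
move=> n; rewrite powRM ?powR_ge0 ?(ltW W0)// -powRrM mulVf ?gt_eqF//.
by rewrite powRr1 ?(ltW B0)//; exact: hB.
Qed.

Definition cutoff (N : nat) : symbol := fun n _ => (n <= N)%:R.

(** Only finitely many finite matrices remain, so every symbol becomes bounded. Truncated vectors
    thus form a dense set on which unbounded symbols and inverses can be used freely. *)
Lemma sym_bounded_cut N c : exists K, sym_bounded (fun n m => cutoff N n m * c n m) K.
Proof.
have [B B0 hB] := sym_bounded_bvar.
pose b n := bvar n.*2 (c n).
have b0 n : 0 <= b n by rewrite addr_ge0 ?normc_ge0 ?sumr_ge0// => i _; exact: normc_ge0.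
exists ((1 + \sum_(n < N.+1) b n) * B); apply: hB.
  by rewrite ltr_wpDr// sumr_ge0.
move=> n; rewrite /cutoff; have [nN|Nn] := leqP n N; last first.
  rewrite /bvar mul0r normc0 add0r big1 => [|i _]; last by rewrite !mul0r subrr normc0.
  by rewrite addr_ge0 ?sumr_ge0.
rewrite (_ : bvar _ _ = b n); last first.
  rewrite /b /bvar mul1r; congr (_ + _); apply: eq_bigr => i _; by rewrite !mul1r.
have nN' : (n < N.+1)%N by [].
by rewrite (bigD1 (Ordinal nN'))//= addrCA lerDl addr_ge0// sumr_ge0.
Qed.

Lemma opf_cut N f x : opf (cutoff N) f x = (block x <= N)%:R * f x.
Proof.
have -> : opf (cutoff N) f x = (block x <= N)%:R * opf (fun _ _ => 1) f x.
  rewrite /opf mulr_sumr; apply: eq_bigr => k _; rewrite mulrA; congr (_ * _).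
  rewrite (@eq_kmat _ _ (cutoff N (block x)) (fun m => (block x <= N)%:R * 1)).
    by rewrite kmatZ mxE.
  by move=> m _; rewrite mulr1.
by rewrite opf1.
Qed.

Lemma sym_bounded_cut1 N : sym_bounded (cutoff N) 1.
Proof.
split=> // n; rewrite powR1 /cutoff; case: leqP => _; first by rewrite kmat1; exact: lpb1.
move=> x; rewrite mul1r (_ : kmat _ _ = 0); last first.
  by apply/matrixP => j k; rewrite kmatE mxE big1 ?mulr0// => m _; rewrite mul0r.
rewrite /psum big1 ?psum_ge0// => j _; rewrite /mv big1 ?normc0 ?powR0//.
  by rewrite gt_eqF// (lt_trans ltr01).
by move=> k _; rewrite mxE mul0r.
Qed.

(** Dominated convergence: the p-th power of the error is |f|^p on the blocks beyond N and 0
    elsewhere. *)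
Lemma Phi_cut_cvg u : (fun N => rnorm (Phi (cutoff N) u - u)) @ \oo --> (0 : R).
Proof.
have p0 : 0 < p := lt_trans ltr01 p1.
have [f [hf ->]] := toLp_repr u; have /cLfunP[mf nf] := hf.
have mpow (g : RR -> R[i]) : cmeasurable g -> measurable_fun setT (fun x : RR => (normc (g x) `^ p)%:E).
  move=> mg; apply/measurable_EFinP.
  apply: (measurableT_comp (measurable_powR p)); exact: measurable_normc.
pose g N (x : RR) : R[i] := - 1 * f x + opf (cutoff N) f x.
have hg N : g N \in cLfun mu p%:E.
  by apply: cLfun_lin => //; exact: opf_cLfun (sym_bounded_cut1 N) hf.
have gE N : Phi (cutoff N) (toLp hf) - toLp hf = toLp (hg N).
  rewrite (PhiE hf (opf_cLfun (sym_bounded_cut1 N) hf) (sym_bounded_cut1 N)).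
  by rewrite (toLp_lin hf (opf_cLfun (sym_bounded_cut1 N) hf)) scaleN1r addrC.
have gx N x : normc (g N x) `^ p = (N < block x)%:R * normc (f x) `^ p.
  rewrite /g opf_cut mulN1r; case: leqP => _.
    by rewrite mul1r addNr normc0 powR0 ?gt_eqF// mul0r.
  by rewrite mul0r addr0 normc_opp mul1r.
have int_pow (h : RR -> R[i]) (hh : h \in cLfun mu p%:E) :
    ((rnorm (toLp hh) `^ p)%:E = \int[mu]_x (normc (h x) `^ p)%:E)%E.
  rewrite -poweR_EFin rnorm_toLp.
  rewrite (@poweR_Lnorm _ _ _ mu (EFin \o (fun x => normc (h x))) p); last by rewrite gt_eqF.
  by apply: eq_integral => x _; rewrite /= ger0_norm ?normc_ge0.
have intf : mu.-integrable setT (fun x : RR => (normc (f x) `^ p)%:E).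
  apply/integrableP; split; first exact: mpow.
  under eq_integral do rewrite abse_EFin ger0_norm ?powR_ge0//.
  by rewrite -(int_pow _ hf) ltry.
have mg N : measurable_fun setT (fun x : RR => (normc (g N x) `^ p)%:E).
  by apply: mpow; have /cLfunP[] := hg N.
have cv0 (x : RR) : (fun N => (normc (g N x) `^ p)%:E) @ \oo --> 0%E.
  apply: cvg_near_cst; exists (block x) => // N /= bN.
  by rewrite gx ltnNge bN mul0r.
have dom (x : RR) N : (`|(normc (g N x) `^ p)%:E| <= (normc (f x) `^ p)%:E)%E.
  rewrite abse_EFin lee_fin ger0_norm ?powR_ge0// gx.
  by case: ltnP => _; rewrite ?mul1r// mul0r powR_ge0.
have [_ _] := @dominated_convergence _ _ _ mu _ measurableT
   (fun N x => (normc (g N x) `^ p)%:E) (fun=> 0%E) _ mg (measurable_cst _)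
   (aeW _ (fun x _ => cv0 x)) intf (aeW _ (fun x N _ => dom x N)).
rewrite integral0.
have -> : [sequence (\int[mu]_x (normc (g n x) `^ p)%:E)%E]_n =
    EFin \o (fun N => rnorm (Phi (cutoff N) (toLp hf) - toLp hf) `^ p).
  by apply/funext => N /=; rewrite gE int_pow.
move=> /fine_cvgP[_] cv; apply/cvgrPdist_lt => e e0.
have /cvgrPdist_lt/(_ (e `^ p)) := cv; rewrite powR_gt0// => /(_ isT).
apply: filterS => N /=; rewrite !sub0r !normrN ger0_norm ?powR_ge0// => h.
rewrite ger0_norm ?rnorm_ge0// ltNge; apply/negP => eN.
move: h; rewrite ltNge ge0_ler_powR ?nnegrE ?rnorm_ge0// ltW//.
Qed.

End BlockOperators.

(** * Complex derivatives along curves *)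

Section ComplexDerivative.
Variable R : realType.
Local Notation C := (R[i]^o).
Implicit Types (f g : C -> C) (z d : C).

Lemma normr_normc (x : R[i]) : `|x| = (normc x)%:C.
Proof. by []. Qed.

Lemma gt0_complex (e : R[i]) : 0 < e -> exists2 r : R, 0 < r & e = r%:C.
Proof.
case: e => a b; rewrite ltcE /= => /andP[/eqP b0 a0]; exists a => //.
by rewrite b0.
Qed.

Lemma near_complex z (P : set C) :
  nbhs z P <-> exists2 e : R, 0 < e & forall w, normc (w - z) < e -> P w.
Proof.
split.
  move=> /nbhs_ballP[e /= e0 eP]; have [r r0 re] := gt0_complex e0.
  exists r => // w wz; apply: eP; rewrite re -ball_normE /= normr_normc.
  by rewrite ltcR -normc_opp opprB.
move=> [e e0 eP]; apply/nbhs_ballP; exists e%:C => /=; first by rewrite ltcR.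
move=> w; rewrite -ball_normE /= normr_normc ltcR => zw; apply: eP.
by rewrite -normc_opp opprB.
Qed.

(** The increment form, without a quotient, includes h = 0 and therefore composes without case
    distinctions. *)
Lemma is_derive_normP f z d :
  is_derive z 1 f d <-> forall e : R, 0 < e -> exists2 r : R, 0 < r &
    forall h, normc h < r -> normc (f (z + h) - f z - d * h) <= e * normc h.
Proof.
have quot (h : C) : h != 0 -> normc (f (z + h) - f z - d * h) =
    normc (d - h^-1 *: (f (h *: 1 + z) - f z)) * normc h.
  move=> h0; rewrite -normcM -normc_opp mulrBl; congr (normc _).
  rewrite [h *: 1]mulr1 [h + z]addrC [_ *: _]mulrC mulfVK// opprB.
  by rewrite addrC.
split.
  move=> [df dE] e e0.
  have : (fun h : C => h^-1 *: (f (h *: (1 : C) + z) - f z) : C) @ (0 : C)^' --> d by rewrite -dE; exact: df.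
  have e0' : (0 : R[i]) < e%:C by rewrite ltcR.
  move=> /cvgrPdist_le/(_ _ e0'); rewrite /dnbhs => /near_complex[r r0 rP].
  exists r => // h hr; have [->|h0] := eqVneq h 0.
    by rewrite addr0 subrr mulr0 subr0 normc0 mulr0.
  rewrite quot// ler_wpM2r ?normc_ge0//.
  have := rP h; rewrite subr0 => /(_ hr h0).
  by rewrite /= normr_normc lecR.
move=> H.
have cv : (fun h : C => h^-1 *: (f (h *: (1 : C) + z) - f z) : C) @ (0 : C)^' --> d.
  apply/cvgrPdist_le => e /gt0_complex[r r0 ->].
  have [s s0 sP] := H _ r0; rewrite /dnbhs; apply/near_complex; exists s => // h.
  rewrite subr0 => hs h0; have := sP _ hs; rewrite quot// ler_pM2r ?normc_gt0//.
  by rewrite normr_normc lecR.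
by apply: DeriveDef; [apply/cvg_ex; exists d|exact: cvg_lim].
Qed.

Lemma complex_deriveM f g z (df dg : C) : is_derive z 1 f df -> is_derive z 1 g dg ->
  is_derive z 1 (fun w => f w * g w) (f z * dg + g z * df).
Proof. exact: is_deriveM. Qed.

Lemma complex_deriveV f z (df : C) : f z != 0 -> is_derive z 1 f df ->
  is_derive z 1 (fun w => (f w)^-1) (- (f z) ^- 2 * df).
Proof.
move=> fz [h <-]; apply: DeriveDef; first exact: derivableV.
exact: deriveV.
Qed.

(** [T] is instantiated with real parameters and with complex variables, [nT] being the absolute
    value, so that one proof of the chain rule serves curves and holomorphic functions. *)
Definition tangent (T : zmodType) (nT : T -> R) (c : T -> R[i]) (t : T) (L : T -> R[i]) :=
  forall e : R, 0 < e -> exists2 r : R, 0 < r &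
    forall h, nT h < r -> normc (c (t + h) - c t - L h) <= e * nT h.

Lemma tangent_comp (T : zmodType) (nT : T -> R) (c : T -> R[i]) t L (K : R) f (df : C) :
  (forall h, 0 <= nT h) -> 0 <= K -> (forall h, normc (L h) <= K * nT h) ->
  tangent nT c t L -> is_derive (c t : C) 1 f df ->
  tangent nT (f \o c) t (fun h => df * L h).
Proof.
move=> nT0 K0 LK cd fd e e0.
have m0 : 0 < K + 1 by rewrite ltr_wpDl.
have n0 : 0 < normc df + 1 by rewrite ltr_wpDl ?normc_ge0.
have e1 : 0 < e / 2 / (K + 1) by rewrite !divr_gt0.
have e2 : 0 < e / 2 / (normc df + 1) by rewrite !divr_gt0.
have [r r0 rP] := (is_derive_normP _ _ _).1 fd _ e1.
have [s s0 sP] := cd _ e2; have [s1 s10 s1P] := cd _ ltr01.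
have rm : 0 < r / (K + 1) by rewrite divr_gt0.
exists (Num.min (Num.min s s1) (r / (K + 1))) => [|h].
  by rewrite !lt_min s0 s10 rm.
rewrite !lt_min => /andP[/andP[/sP hs /s1P hs1]]; rewrite ltr_pdivlMr// => hr.
pose k := c (t + h) - c t.
have kh : normc k <= (K + 1) * nT h.
  rewrite /k -[_ - c t](subrK (L h)) (le_trans (normcD _ _))//.
  by rewrite mulrDl addrC lerD ?LK.
have kr : normc k < r by apply: (le_lt_trans kh); rewrite mulrC.
have kE : c t + k = c (t + h) by rewrite /k addrC subrK.
have := rP k kr; rewrite kE => H /=.
have -> : f (c (t + h)) - f (c t) - df * L h =
   (f (c (t + h)) - f (c t) - df * k) + df * (k - L h) by ring.
apply: (le_trans (normcD _ _)); rewrite normcM -/k.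
apply: (@le_trans _ _ (e / 2 * nT h + e / 2 * nT h)); last by rewrite -mulrDl -splitr.
apply: lerD.
  apply: (le_trans H); apply: (@le_trans _ _ (e / 2 / (K + 1) * ((K + 1) * nT h))).
    by rewrite ler_wpM2l// ltW.
  by rewrite mulrA divfK// gt_eqF.
apply: (@le_trans _ _ (normc df * (e / 2 / (normc df + 1) * nT h))).
  by rewrite ler_wpM2l ?normc_ge0.
rewrite mulrA ler_wpM2r// mulrCA ler_piMr ?ler_pdivrMr ?mul1r ?lerDl//.
by rewrite divr_ge0// ltW.
Qed.

Definition itcurve (c : R -> R[i]) (t : R) (d : R[i]) :=
  tangent (fun h : R => `|h|) c t (fun h => h%:C * d).

Lemma curve_comp f (c : R -> R[i]) t (d : R[i]) (df : C) :
  itcurve c t d -> is_derive (c t : C) 1 f df -> itcurve (f \o c) t (df * d).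
Proof.
move=> cd fd.
have nb (h : R) : normc (h%:C * d) <= normc d * `|h| by rewrite normcM normc_real mulrC.
move=> e e0; have [r r0 rP] := tangent_comp (fun h => normr_ge0 h) (normc_ge0 d) nb cd fd e0.
by exists r => // h /rP; rewrite mulrCA.
Qed.

Lemma complex_derive_comp f g z (df dg : C) :
  is_derive z 1 g dg -> is_derive (g z) 1 f df -> is_derive z 1 (fun w => f (g w)) (df * dg).
Proof.
move=> /is_derive_normP gd fd; apply/is_derive_normP => e e0.
have nb (h : C) : normc (dg * h) <= normc dg * normc h by rewrite normcM.
have [r r0 rP] := tangent_comp (@normc_ge0 R) (normc_ge0 dg) nb gd fd e0.
by exists r => // h /rP; rewrite mulrA.
Qed.

Lemma Re_normc (x : R[i]) : `|complex.Re x| <= normc x.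
Proof.
case: x => a b /=; rewrite -sqrtr_sqr ler_sqrt ?addr_ge0 ?sqr_ge0//.
by rewrite lerDl sqr_ge0.
Qed.

Lemma Im_normc (x : R[i]) : `|complex.Im x| <= normc x.
Proof.
case: x => a b /=; rewrite -sqrtr_sqr ler_sqrt ?addr_ge0 ?sqr_ge0//.
by rewrite lerDr sqr_ge0.
Qed.

Lemma normc_ReIm (x : R[i]) : normc x <= `|complex.Re x| + `|complex.Im x|.
Proof.
case: x => a b /=; rewrite -[leRHS]ger0_norm ?addr_ge0// -sqrtr_sqr.
rewrite ler_sqrt ?sqr_ge0// sqrrD !real_normK ?num_real// lerD2r lerDl.
by rewrite mulrn_wge0// mulr_ge0.
Qed.

Lemma ReB (x y : R[i]) : complex.Re (x - y) = complex.Re x - complex.Re y.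
Proof. by case: x y => ? ? [? ?]. Qed.

Lemma ImB (x y : R[i]) : complex.Im (x - y) = complex.Im x - complex.Im y.
Proof. by case: x y => ? ? [? ?]. Qed.

Lemma ReZ (h : R) (x : R[i]) : complex.Re (h%:C * x) = h * complex.Re x.
Proof. by case: x => a b /=; rewrite mul0r subr0. Qed.

Lemma ImZ (h : R) (x : R[i]) : complex.Im (h%:C * x) = h * complex.Im x.
Proof. by case: x => a b /=; rewrite mul0r addr0. Qed.

Lemma is_derive_real_normP (f : R -> R) (t d : R) :
  is_derive t 1 f d <-> (forall e : R, 0 < e -> exists2 r : R, 0 < r &
    forall h, `|h| < r -> `|f (t + h) - f t - h * d| <= e * `|h|).
Proof.
have quot h : h != 0 -> `|f (t + h) - f t - h * d| =
    `|d - h^-1 *: (f (h *: (1 : R) + t) - f t)| * `|h|.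
  move=> h0; have -> : h *: (1 : R) = h by exact: mulr1.
  rewrite -normrM -normrN mulrBl -[_ *: _]/(h^-1 * _) mulrAC mulVf// mul1r [h + t]addrC.
  by rewrite opprB mulrC.
split.
  move=> [df dE] e e0.
  have : (fun h : R => h^-1 *: (f (h *: (1 : R) + t) - f t) : R) @ (0 : R)^' --> d.
    by rewrite -dE; exact: df.
  move=> /cvgrPdist_le/(_ _ e0); rewrite /dnbhs => /nbhs_ballP[r /= r0 rP].
  exists r => // h hr; have [->|h0] := eqVneq h 0.
    by rewrite addr0 subrr mul0r subr0 normr0 mulr0.
  rewrite quot// ler_wpM2r//; apply: rP => //.
  by rewrite /ball /= sub0r normrN.
move=> H.
have cv : (fun h : R => h^-1 *: (f (h *: (1 : R) + t) - f t) : R) @ (0 : R)^' --> d.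
  apply/cvgrPdist_le => e e0; have [s s0 sP] := H _ e0.
  rewrite /dnbhs; apply/nbhs_ballP; exists s => //= h.
  rewrite /ball /= sub0r normrN => hs h0; have := sP _ hs.
  by rewrite quot// ler_pM2r ?normr_gt0.
by apply: DeriveDef; [apply/cvg_ex; exists d|exact: cvg_lim].
Qed.

Lemma curve_ReIm (c : R -> R[i]) (t : R) (d : R[i]) :
  is_derive t 1 (fun t => complex.Re (c t)) (complex.Re d) ->
  is_derive t 1 (fun t => complex.Im (c t)) (complex.Im d) -> itcurve c t d.
Proof.
move=> /is_derive_real_normP dr /is_derive_real_normP di e e0.
have e2 : 0 < e / 2 by rewrite divr_gt0.
have [r r0 rP] := dr _ e2; have [s s0 sP] := di _ e2.
exists (Num.min r s) => [|h]; first by rewrite lt_min r0.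
rewrite lt_min => /andP[/rP h1 /sP h2].
rewrite (le_trans (normc_ReIm _))// !ReB !ImB ReZ ImZ.
by rewrite [e]splitr mulrDl lerD.
Qed.

Lemma curve_Re (c : R -> R[i]) (t : R) (d : R[i]) : itcurve c t d ->
  is_derive t 1 (fun t => complex.Re (c t)) (complex.Re d).
Proof.
move=> H; apply/is_derive_real_normP => e /H[r r0 rP]; exists r => // h /rP.
by apply: le_trans; rewrite -ReZ -!ReB Re_normc.
Qed.

Lemma curve_scale (z : R[i]) (t : R) : itcurve (fun u => u%:C * z) t z.
Proof.
move=> e e0; exists 1 => // h _.
have -> : (t + h)%:C * z - t%:C * z - h%:C * z = 0 by rewrite rmorphD /=; ring.
by rewrite normc0 mulr_ge0// ltW.
Qed.

Lemma curve_cis (t : R) : itcurve (fun u => cis u) t ('i%C * cis t).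
Proof.
have -> : 'i%C * cis t = (- sin t) +i* cos t.
  by apply/eqP; rewrite eq_complex /=; apply/andP; split; apply/eqP; ring.
exact: curve_ReIm.
Qed.

Lemma cexpD (z w : R[i]) : cexp (z + w) = cexp z * cexp w.
Proof.
case: z w => a b [c d]; rewrite /cexp /= expRD cisD rmorphM /=; ring.
Qed.

Lemma cexp0_derive : is_derive (0 : C) 1 (fun w : C => cexp w : C) 1.
Proof.
apply/is_derive_normP => e e0.
(* The remainder is split below as e^x (e^(iy) - 1 - iy) + (e^x - 1) iy + (e^x - 1 - x). The three
   terms cost 2, 1 and 1 times e'|h|, whence the quarter; e' <= 1 is used for e^x <= 2. *)
pose e' := Num.min 1 (e / 4).
have e'0 : 0 < e' by rewrite lt_min ltr01 divr_gt0.
have e'1 : e' <= 1 by rewrite ge_min lexx.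
have e'4 : e' <= e / 4 by rewrite ge_min lexx orbT.
have [r r0 rP] := curve_cis 0 e'0.
have [s s0 sP] := (is_derive_real_normP (@expR R) 0 (expR 0)).1 (is_derive_expR 0) _ e'0.
exists (Num.min (Num.min r s) (e' / 2)) => [|h]; first by rewrite !lt_min r0 s0 divr_gt0.
rewrite !lt_min => /andP[/andP[hr hs] he].
have := rP (complex.Im h); have := sP (complex.Re h).
rewrite !add0r cis0 expR0 !mulr1.
move=> /(_ (le_lt_trans (Re_normc h) hs)) H1 /(_ (le_lt_trans (Im_normc h) hr)) H2.
have -> : cexp 0 = 1 :> R[i] by rewrite /cexp /= expR0 cis0 mulr1.
rewrite mul1r.
set x := complex.Re h in H1 *; set y := complex.Im h in H2 *.
have hE : h = x%:C + y%:C * 'i%C.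
  by rewrite /x /y; case: (h) => a b; apply/eqP; rewrite eq_complex /=; apply/andP; split; apply/eqP; ring.
have -> : cexp h - 1 - h = (expR x)%:C * (cis y - 1 - y%:C * 'i%C) +
    ((expR x - 1)%:C * (y%:C * 'i%C) + (expR x - 1 - x)%:C).
  by rewrite {2}hE /cexp -/x -/y !rmorphB /= rmorph1; ring.
have nx : `|x| <= normc h := Re_normc h.
have ny : `|y| <= normc h := Im_normc h.
have ni : normc ('i%C : R[i]) = 1 by rewrite /= expr0n expr1n add0r sqrtr1.
have ex1 : `|expR x - 1| <= e' .
  rewrite -[_ - 1](subrK x) (le_trans (ler_normD _ _))//.
  have : e' * `|x| <= `|x| by rewrite ler_piMl.
  move: H1 nx he; set u := `|_ - _ - _|; set v := `|x|; lra.
have ex2 : expR x <= 2.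
  by move: ex1; rewrite ler_norml => /andP[_]; move: e'1; lra.
apply: (@le_trans _ _ (2 * (e' * normc h) + (e' * normc h + e' * normc h))); last first.
  have : e' * normc h <= e / 4 * normc h by rewrite ler_wpM2r ?normc_ge0.
  by set u := _ * normc h; set v := _ * normc h; have : e * normc h = 4 * v; [rewrite /v; field|lra].
apply: (le_trans (normcD _ _)); apply: lerD.
  rewrite normcM normc_real ger0_norm ?expR_ge0// ler_pM ?expR_ge0 ?normc_ge0//.
  by rewrite (le_trans H2)// ler_wpM2l// ltW.
apply: (le_trans (normcD _ _)); apply: lerD.
  by rewrite !normcM !normc_real ni mulr1 ler_pM.
by rewrite normc_real (le_trans H1)// ler_wpM2l// ltW.
Qed.

Lemma normc_cexp (z : R[i]) : normc (cexp z) = expR (complex.Re z).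
Proof. by rewrite /cexp normcM normc_cis mulr1 normc_real ger0_norm ?expR_ge0. Qed.

Lemma cexp_derive (z : C) : is_derive z 1 (fun w : C => cexp w : C) (cexp z).
Proof.
have n0 : 0 < normc (cexp z) by rewrite normc_cexp expR_gt0.
apply/is_derive_normP => e e0.
have [r r0 rP] := (is_derive_normP _ _ _).1 cexp0_derive _ (divr_gt0 e0 n0).
exists r => // h /rP; rewrite add0r mul1r.
have -> : cexp 0 = 1 :> R[i] by rewrite /cexp /= expR0 cis0 mulr1.
have -> : cexp (z + h) - cexp z - cexp z * h = cexp z * (cexp h - 1 - h).
  by rewrite cexpD; ring.
move=> /(ler_wpM2l (normc_ge0 (cexp z))); rewrite -normcM => /le_trans; apply.
by rewrite le_eqVlt; apply/orP; left; apply/eqP; field; rewrite gt_eqF.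
Qed.

(* On the plane slit along the negative half-line the argument is the double
   of the angle with vertex at the opposite point of the circle. *)
Lemma carg_polar (r t : R) : 0 < r -> - pi < t <= pi -> carg (r%:C * cis t) = t.
Proof.
move=> r0 /andP[t1 t2]; rewrite /carg.
have nE : normc (r%:C * cis t) = r by rewrite normcM normc_cis mulr1 normc_real gtr0_norm.
rewrite nE ReZ ImZ /= mulrAC divff ?gt_eqF// mul1r.
have [t0|t0] := leP 0 t.
  rewrite mulr_ge0 ?(ltW r0)//.
    by rewrite cosK// in_itv /= t0.
  by apply: sin_ge0_pi; rewrite t0.
rewrite lt_geF.
  by rewrite -cosN cosK ?opprK// in_itv /= oppr_ge0 (ltW t0) lerNl ltW.
rewrite pmulr_rlt0// -[t]opprK sinN oppr_lt0 sin_gt0_pi//.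
by rewrite oppr_gt0 t0 ltrNl.
Qed.

Lemma normc_polar (r t : R) : 0 <= r -> normc (r%:C * cis t) = r.
Proof. by move=> r0; rewrite normcM normc_cis mulr1 normc_real ger0_norm. Qed.

Lemma polar_neq0 (r t : R) : 0 < r -> r%:C * cis t != 0.
Proof.
move=> r0; apply/eqP => h; have := @normc_polar r t (ltW r0).
by rewrite h normc0 => /eqP; rewrite lt_eqF.
Qed.

Lemma polarE (z : R[i]) : z != 0 -> z = (normc z)%:C * cis (carg z).
Proof. by move=> /cargP[]. Qed.

Lemma sector_polar (r t w : R) : 0 < r -> `|t| < w -> w <= pi -> sector w (r%:C * cis t).
Proof.
move=> r0 tw wpi; have := lt_le_trans tw wpi; rewrite ltr_norml => /andP[t1 t2].
by split; [exact: polar_neq0|rewrite carg_polar// t1 ltW].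
Qed.

Lemma sectorP (w : R) (z : R[i]) : sector w z ->
  exists r t, [/\ 0 < r, `|t| < w & z = r%:C * cis t].
Proof.
move=> [z0 zw]; exists (normc z), (carg z); split=> //; first exact: normc_gt0.
exact: polarE.
Qed.

(** The half-angle formula. Being a single expression on the slit plane, it yields the continuity of
    the argument, which the case distinction in [carg] hides. *)
Lemma slit_carg (z : R[i]) : z != 0 -> `|carg z| < pi ->
  0 < normc z + complex.Re z /\ carg z = 2 * atan (complex.Im z / (normc z + complex.Re z)).
Proof.
move=> z0 zpi; set n := normc z; set t := carg z in zpi *.
have n0 : 0 < n by exact: normc_gt0.
have zE : z = n%:C * cis t := polarE z0.
have [xE yE] : complex.Re z = n * cos t /\ complex.Im z = n * sin t.
  by rewrite zE ReZ ImZ.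
pose u := t / 2; have tE : t = u + u by rewrite /u -splitr.
have cu : 0 < cos u.
  apply: cos_gt0_pihalf; move: zpi; rewrite ltr_norml /u => /andP[h1 h2].
  by apply/andP; split; lra.
have h1 : 1 + cos t = 2 * cos u ^+ 2.
  rewrite tE cosD; have := cos2Dsin2 u; rewrite -!expr2; lra.
have h2 : sin t = 2 * (sin u * cos u) by rewrite tE sinD; ring.
split; first by rewrite xE -{1}[n]mulr1 -mulrDr h1 !mulr_gt0// exprn_gt0.
have -> : complex.Im z / (n + complex.Re z) = tan u.
  rewrite xE yE -{2}[n]mulr1 -mulrDr h1 h2 /tan; field.
  by rewrite !gt_eqF.
rewrite tanK; first by rewrite tE; ring.
rewrite in_itv /=; move: zpi; rewrite ltr_norml /u => /andP[? ?].
by apply/andP; split; lra.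
Qed.

Lemma real_part_slit (z : R[i]) : 0 < normc z + complex.Re z -> z != 0 /\ `|carg z| < pi.
Proof.
move=> zp; have z0 : z != 0.
  by apply: contraL zp => /eqP ->; rewrite normc0 addr0 ltxx.
split=> //; have [/andP[h1 h2] zE] := cargP z0.
rewrite ltr_norml h1 lt_neqAle h2 andbT /=; apply/eqP => cpi.
move: zp; rewrite {2}zE cpi ReZ /= cospi mulrN1 subrr.
by rewrite ltxx.
Qed.

(** Neighbourhoods with real radii: the limit rules for real-valued functions become available for
    functions of a complex variable. *)
Definition cnbhs (z : R[i]) : set_system R[i] :=
  filter_from [set e : R | 0 < e] (fun e => [set w | normc (w - z) < e]).

#[local] Instance cnbhs_filter (z : R[i]) : ProperFilter (cnbhs z).
Proof.
apply: filter_from_proper => [|e e0]; last by exists z; rewrite /= subrr normc0.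
apply: filter_from_filter; first by exists 1 => /=.
move=> e d e0 d0; exists (Num.min e d); first by rewrite /= lt_min e0.
by move=> w /=; rewrite lt_min => /andP[].
Qed.

Lemma cnbhs_cvgP (u : R[i] -> R) z (l : R) : u @ cnbhs z --> l <->
  forall e : R, 0 < e -> exists2 r : R, 0 < r & forall h, normc h < r -> `|u (z + h) - l| < e.
Proof.
split.
  move=> /cvgrPdist_lt uc e /uc [r r0 rP]; exists r => // h hr.
  by rewrite distrC; apply: rP => /=; rewrite addrC addKr.
move=> H; apply/cvgrPdist_lt => e /H[r r0 rP]; exists r => // w /= wr.
have wE : z + (w - z) = w by rewrite addrC subrK.
by rewrite distrC -{1}wE; exact: rP.
Qed.

Lemma normc_dist (z w : R[i]) : `|normc z - normc w| <= normc (z - w).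
Proof.
have h1 := normcD (z - w) w; have h2 := normcD (w - z) z.
rewrite !subrK in h1 h2; rewrite -(normc_opp (w - z)) opprB in h2.
by rewrite ler_norml; apply/andP; split; lra.
Qed.

Lemma continuous_normc z : @normc R @ cnbhs z --> normc z.
Proof.
apply/cnbhs_cvgP => e e0; exists e => // h; apply: le_lt_trans.
by rewrite (le_trans (normc_dist _ _))// addrC addKr.
Qed.

Lemma continuous_ReC z : @complex.Re R @ cnbhs z --> complex.Re z.
Proof.
apply/cnbhs_cvgP => e e0; exists e => // h; apply: le_lt_trans.
by rewrite -ReB (le_trans (Re_normc _))// addrC addKr.
Qed.

Lemma continuous_ImC z : @complex.Im R @ cnbhs z --> complex.Im z.
Proof.
apply/cnbhs_cvgP => e e0; exists e => // h; apply: le_lt_trans.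
by rewrite -ImB (le_trans (Im_normc _))// addrC addKr.
Qed.

Lemma clog_continuous z : 0 < normc z + complex.Re z ->
  forall e : R, 0 < e -> exists2 r : R, 0 < r & forall h, normc h < r ->
    normc (clog (z + h) - clog z) < e.
Proof.
move=> zp e e0; have [z0 zpi] := real_part_slit zp.
have cp : (fun w => normc w + complex.Re w) @ cnbhs z --> normc z + complex.Re z.
  by apply: cvgD; [exact: continuous_normc|exact: continuous_ReC].
have [r1 r10 r1P] := (cnbhs_cvgP _ _ _).1 cp _ zp.
pose v (w : R[i]) := 2 * atan (complex.Im w / (normc w + complex.Re w)).
have cv : v @ cnbhs z --> v z.
  apply: cvgM; first exact: cvg_cst.
  apply: (@cvg_comp _ _ _ (fun w : R[i] => complex.Im w / (normc w + complex.Re w))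
    (@atan R) _ _ _ _ (@continuous_atan R _)).
  apply: cvgM; first exact: continuous_ImC.
  by apply: cvgV => //; rewrite gt_eqF.
have cl : (fun w => ln (normc w)) @ cnbhs z --> ln (normc z).
  apply: (@cvg_comp _ _ _ (@normc R) (@ln R) _ _ _ (@continuous_normc z)).
  by apply: continuous_ln; exact: normc_gt0.
have [r2 r20 r2P] := (cnbhs_cvgP _ _ _).1 cv _ (divr_gt0 e0 (@ltr0Sn R 1)).
have [r3 r30 r3P] := (cnbhs_cvgP _ _ _).1 cl _ (divr_gt0 e0 (@ltr0Sn R 1)).
exists (Num.min r1 (Num.min r2 r3)) => [|h]; first by rewrite !lt_min r10 r20.
rewrite !lt_min => /and3P[/r1P h1 /r2P h2 /r3P h3].
have zhp : 0 < normc (z + h) + complex.Re (z + h).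
  by move: h1; rewrite ltr_norml => /andP[h1 _]; lra.
have [zh0 zhpi] := real_part_slit zhp.
rewrite (le_lt_trans (normc_ReIm _))// ReB ImB /= addrC [e]splitr ltrD//.
by rewrite (slit_carg z0 zpi).2 (slit_carg zh0 zhpi).2.
Qed.

Lemma cexp_clog z : z != 0 -> cexp (clog z) = z.
Proof.
move=> z0; rewrite /cexp /clog /= lnK ?posrE ?normc_gt0//.
by rewrite -polarE.
Qed.

(** Differentiation of an inverse: with k = clog (z + h) - clog z, the derivative of [cexp] gives |h
    - zk| <= e'|k|. The first bound on e' yields |z||k| <= 2|h|, the second one the required
    precision. *)
Lemma clog_derive z : 0 < normc z + complex.Re z ->
  is_derive z 1 (fun w : C => clog w : C) z^-1.
Proof.
move=> zp; have [z0 _] := real_part_slit zp.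
have n0 : 0 < normc z := normc_gt0 z0.
apply/is_derive_normP => e e0.
pose e' := Num.min (normc z / 2) (e * normc z ^+ 2 / 2).
have e'0 : 0 < e' by rewrite lt_min !divr_gt0 ?mulr_gt0 ?exprn_gt0.
have [d d0 dP] := (is_derive_normP _ _ _).1 (cexp_derive (clog z)) _ e'0.
have [r r0 rP] := clog_continuous zp d0.
exists (Num.min r (normc z)) => [|h]; first by rewrite lt_min r0.
rewrite lt_min => /andP[/rP /dP + hz].
have zh0 : z + h != 0.
  apply/eqP => zh; move: hz; have -> : h = - z by apply/eqP; rewrite -addr_eq0 addrC zh.
  by rewrite normc_opp ltxx.
set k := clog (z + h) - clog z.
rewrite [clog z + k]addrC subrK !cexp_clog// [z + h]addrC addrK => H.
have e1 : e' <= normc z / 2 by rewrite ge_min lexx.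
have e2 : e' <= e * normc z ^+ 2 / 2 by rewrite ge_min lexx orbT.
have k1 : normc z * normc k <= 2 * normc h.
  have : normc z * normc k <= normc h + normc z / 2 * normc k.
    rewrite -normcM -[z * k](subKr h) (le_trans (normcD _ _))// lerD2l normc_opp.
    by rewrite (le_trans H)// ler_wpM2r ?normc_ge0.
  by rewrite mulrAC; set u := normc z * normc k; lra.
have -> : k - z^-1 * h = - (z^-1 * (h - z * k)).
  by rewrite mulrBr mulrA mulVf// mul1r opprB.
rewrite normc_opp normcM normcV mulrC ler_pdivrMr// (le_trans H)//.
apply: (@le_trans _ _ (e * normc z ^+ 2 / 2 * normc k)).
  by rewrite ler_wpM2r ?normc_ge0.
have : e * normc z / 2 * (normc z * normc k) <= e * normc z / 2 * (2 * normc h).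
  by rewrite ler_wpM2l// divr_ge0// mulr_ge0// ltW.
set a := normc z; set b := normc k; set c := normc h.
have -> : e * a / 2 * (a * b) = e * a ^+ 2 / 2 * b by ring.
have -> : e * a / 2 * (2 * c) = e * c * a by field.
by [].
Qed.
End ComplexDerivative.

(** * Cauchy's formula on sectors *)

Section RayIntegrals.
Variable R : realType.
Local Notation C := (R[i]^o).
Local Notation mu := (@lebesgue_measure R).
Local Notation RR := (measurableTypeR R).

Definition ray : set RR := `]0, +oo[%classic.
Definition majorant (r : R) : R := (1 + r) ^- 2.

Lemma measurable_ray : measurable ray.
Proof. exact: measurable_itv. Qed.

Lemma rayP r : ray r <-> 0 < r.
Proof. by rewrite /ray /= in_itv /= andbT. Qed.

Lemma maj_gt0 r : 0 < r -> 0 < majorant r.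
Proof. by move=> r0; rewrite invr_gt0 exprn_gt0// addr_gt0. Qed.

Lemma measurable_ray_continuous (u : R -> R) :
  (forall r, 0 < r -> {for r, continuous u}) -> measurable_fun ray u.
Proof.
move=> cu; apply: open_continuous_measurable_fun; first exact: interval_open.
by move=> r /[1!inE] /rayP; exact: cu.
Qed.

Lemma integrable_maj : mu.-integrable ray (EFin \o majorant).
Proof.
pose D0 : set RR := `[0, +oo[%classic.
have mD0 : measurable D0 by exact: measurable_itv.
have int1 : mu.-integrable D0 (EFin \o (fun x : RR => (oneDsqr x)^-1)).
  apply/integrableP; split.
    apply/measurable_EFinP; apply: measurable_funTS.
    apply: continuous_measurable_fun; exact: continuous_oneDsqrV.
  under eq_integral => x _.
    rewrite /= ger0_norm ?invr_ge0 ?(le_trans ler01 (oneDsqr_ge1 x))//.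
    over.
  by rewrite integral0y_oneDsqr ltry.
have sub : ray `<=` D0.
  by move=> r /rayP r0; rewrite /D0 /= in_itv /= andbT ltW.
have int2 := integrableS mD0 measurable_ray sub int1.
apply: (le_integrable measurable_ray _ _ int2).
  apply/measurable_EFinP; apply: measurable_ray_continuous => r r0.
  apply: cvgV; first by rewrite gt_eqF// exprn_gt0// addr_gt0.
  apply: (@cvg_comp _ _ _ (fun x : R => 1 + x) (fun x : R => x ^+ 2)).
    by apply: cvgD; [exact: cvg_cst|exact: cvg_id].
  exact: exprn_continuous.
move=> r /rayP r0 /=; rewrite lee_fin /majorant !ger0_norm ?invr_ge0 ?exprn_ge0//.
- rewrite lef_pV2 ?posrE ?(lt_le_trans ltr01 (oneDsqr_ge1 r))//; last first.
    by rewrite exprn_gt0// addr_gt0.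
  by rewrite /oneDsqr; nra.
- by rewrite addr_ge0 ?ltW.
Qed.

Lemma integrable_Zmaj (K : R) : mu.-integrable ray (EFin \o (fun r => K * majorant r)).
Proof. exact: (integrableZl measurable_ray K integrable_maj). Qed.

Lemma integrable_ray (u : R -> R) (K : R) :
  (forall r, 0 < r -> {for r, continuous u}) ->
  (forall r, 0 < r -> `|u r| <= K * majorant r) -> mu.-integrable ray (EFin \o u).
Proof.
move=> cu uK; apply: (le_integrable measurable_ray _ _ (integrable_Zmaj K)).
  by apply/measurable_EFinP; exact: measurable_ray_continuous.
by move=> r /rayP r0 /=; rewrite lee_fin (le_trans (uK _ r0))// ler_norm.
Qed.

Lemma integral_affine (a c : R) (D : set RR) (f : RR -> R) : 0 < a -> measurable D ->
  mu.-integrable D (EFin \o f) ->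
  (\int[mu]_(x in D) (f x)%:E = a%:E * \int[mu]_(x in [set x | D (a * x + c)%R]) (f (a * x + c)%R)%:E)%E.
Proof.
move=> a0 mD intf; have /integrableP[mf _] := intf.
have fin := integrable_fin_num mD intf.
have mp : measurable_fun D (EFin \o f)^\+%E by exact: measurable_funepos.
have mn : measurable_fun D (EFin \o f)^\-%E by exact: measurable_funeneg.
have ep := @ge0_integral_affine R a c a0 D _ mD mp (fun x _ => funepos_ge0 _ x).
have en := @ge0_integral_affine R a c a0 D _ mD mn (fun x _ => funeneg_ge0 _ x).
have ip := integrable_fin_num mD (integrable_funepos mD intf).
pose P := (\int[mu]_(x in (fun x : RR => (a * x + c)%R) @^-1` D) (EFin \o f)^\+ (a * x + c)%R)%E.
pose N := (\int[mu]_(x in (fun x : RR => (a * x + c)%R) @^-1` D) (EFin \o f)^\- (a * x + c)%R)%E.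
have e1 : (\int[mu]_(x in D) (f x)%:E = a%:E * P - a%:E * N)%E.
  by rewrite -ep -en; exact: integralE.
have e2 : (\int[mu]_(x in [set x | D (a * x + c)%R]) (f (a * x + c)%R)%:E = P - N)%E.
  rewrite integralE /P /N; congr (_ - _)%E; apply: eq_integral => x _;
    by rewrite ?funeposE ?funenegE.
have Pf : P \is a fin_num.
  have : (a%:E * P)%E \is a fin_num by rewrite -ep.
  move=> h; rewrite ge0_fin_numE; last by apply: integral_ge0 => x _; exact: funepos_ge0.
  rewrite ltey; apply/eqP => hi; move: h.
  by rewrite hi gt0_muley ?lte_fin.
by rewrite e1 e2; apply/esym; apply: muleBr => //; exact: (fin_num_adde_defr _ Pf).
Qed.

Lemma Rintegral_scale (a : R) (f : R -> R) : 0 < a ->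
  mu.-integrable ray (EFin \o f) ->
  \int[mu]_(x in ray) f (a * x) = a^-1 * \int[mu]_(x in ray) f x.
Proof.
move=> a0 intf; have := integral_affine 0 a0 measurable_ray intf.
have -> : [set x | ray (a * x + 0)%R] = ray.
  by apply/seteqP; split => x /=; rewrite !rayP addr0 pmulr_rgt0.
under [X in _ = (_ * X)%E]eq_integral do rewrite addr0.
move=> h; rewrite /Rintegral h fineM//; first by rewrite /= mulKf// gt_eqF.
have : (a%:E * \int[mu]_(x in ray) (f (a * x)%R)%:E)%E \is a fin_num.
  by rewrite -h; exact: (integrable_fin_num measurable_ray intf).
by apply: contraLR; rewrite fin_numE negb_and !negbK => /orP[/eqP->|/eqP->];
  rewrite ?gt0_muleNy ?gt0_muley ?lte_fin.
Qed.

Definition Cint (g : R -> R[i]) : R[i] :=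
  (\int[mu]_(r in ray) complex.Re (g r)) +i* (\int[mu]_(r in ray) complex.Im (g r)).

Lemma is_derive_continuous_real (u : R -> R) (t d : R) :
  is_derive t 1 u d -> {for t, continuous u}.
Proof. by move=> [du _]; exact/differentiable_continuous/derivable1_diffP. Qed.

Lemma itcurve_continuous_Re (c : R -> R[i]) t d : itcurve c t d ->
  {for t, continuous (fun t => complex.Re (c t))}.
Proof. by move=> /curve_Re; exact: is_derive_continuous_real. Qed.

Lemma is_derive_linear (a : R[i]) (z : C) : is_derive z 1 (fun w : C => a * w : C) a.
Proof.
apply/is_derive_normP => e e0; exists 1 => // h _.
by rewrite (_ : _ - _ - _ = 0) ?normc0 ?mulr_ge0 ?normc_ge0 ?(ltW e0)//; ring.
Qed.

Lemma curve_mulc (a : R[i]) (c : R -> R[i]) t d : itcurve c t d ->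
  itcurve (fun u => a * c u) t (a * d).
Proof. by move=> cd; exact: (curve_comp cd (is_derive_linear a (c t))). Qed.

Section Ray.
Variables (g g' : C -> C) (alpha beta K : R).
Hypothesis gd : forall r t : R, 0 < r -> alpha < t < beta ->
  is_derive (r%:C * cis t : C) 1 g (g' (r%:C * cis t)).
Hypothesis gK : forall r t : R, 0 < r -> alpha < t < beta ->
  normc (g (r%:C * cis t)) <= K * (r * majorant r).
Hypothesis g'K : forall r t : R, 0 < r -> alpha < t < beta ->
  normc (g' (r%:C * cis t)) <= K * majorant r.

Let curve_t (t r : R) : 0 < r -> alpha < t < beta ->
  itcurve (fun t => g (r%:C * cis t)) t (g' (r%:C * cis t) * (r%:C * ('i%C * cis t))).
Proof.
move=> r0 ab; have := curve_mulc r%:C (@curve_cis R t) => ct.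
exact: (curve_comp ct (gd r0 ab)).
Qed.

Let K0 : alpha < beta -> 0 <= K.
Proof.
move=> ab; have m : alpha < (alpha + beta) / 2 < beta by apply/andP; split; lra.
have := le_trans (normc_ge0 _) (g'K ltr01 m).
by rewrite pmulr_lge0 ?maj_gt0.
Qed.

Let S (u t r:R) : R := complex.Re (r^-1%:C * g ((u * r)%:C * cis t)).

Let S_derive (u t r : R) : 0 < u -> 0 < r -> alpha < t < beta ->
  is_derive u 1 (fun u => S u t r) (complex.Re (cis t * g' ((u * r)%:C * cis t))).
Proof.
move=> u0 r0 ab.
have ur : (fun u : R => (u * r)%:C * cis t) = (fun u : R => u%:C * (r%:C * cis t)).
  by apply/funext => v; rewrite rmorphM /= mulrA.
have c1 : itcurve (fun u : R => (u * r)%:C * cis t) u (r%:C * cis t).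
  by rewrite ur; exact: curve_scale.
have c2 := curve_comp c1 (gd (mulr_gt0 u0 r0) ab).
have := curve_Re (curve_mulc r^-1%:C c2).
congr (is_derive _ _ _ (complex.Re _)).
have rr : r^-1%:C * r%:C = 1 :> R[i] by rewrite -rmorphM /= mulVf ?gt_eqF.
transitivity ((r^-1%:C * r%:C) * (cis t * g' ((u * r)%:C * cis t))); first by ring.
by rewrite rr mul1r.
Qed.

Let S_bound (u t r : R) : 0 < u -> 0 < r -> alpha < t < beta ->
  `|S u t r| <= u * K * majorant (u * r).
Proof.
move=> u0 r0 ab; rewrite (le_trans (Re_normc _))// normcM normc_real gtr0_norm ?invr_gt0//.
rewrite ler_pdivrMl// (le_trans (gK (mulr_gt0 u0 r0) ab))//.
by rewrite le_eqVlt; apply/orP; left; apply/eqP; ring.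
Qed.

Let S_continuous (u t r : R) : 0 < u -> 0 < r -> alpha < t < beta ->
  {for r, continuous (S u t)}.
Proof.
move=> u0 r0 ab.
have -> : S u t = (fun r => r^-1 * complex.Re (g ((u * r)%:C * cis t))).
  by apply/funext => s; rewrite /S ReZ.
apply: cvgM; first by apply: cvgV; [rewrite gt_eqF|exact: cvg_id].
have ur : (fun r : R => (u * r)%:C * cis t) = (fun r : R => r%:C * (u%:C * cis t)).
  by apply/funext => v; rewrite rmorphM /=; ring.
have c1 : itcurve (fun r : R => (u * r)%:C * cis t) r (u%:C * cis t).
  by rewrite ur; exact: curve_scale.
exact: itcurve_continuous_Re (curve_comp c1 (gd (mulr_gt0 u0 r0) ab)).
Qed.

Let maj_scale (u r : R) : 1/2 < u -> 0 < r -> majorant (u * r) <= 4 * majorant r.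
Proof.
move=> u2 r0; have u0 : 0 < u by lra.
rewrite /majorant ler_pdivlMr ?exprn_gt0 ?addr_gt0// mulrC ler_pdivrMr ?exprn_gt0 ?addr_gt0 ?mulr_gt0//.
have h : 1 + r <= 2 * (1 + u * r) by nra.
rewrite (_ : 4 * _ = (2 * (1 + u * r)) ^+ 2); last by ring.
have h1 : 0 <= 1 + r by rewrite addr_ge0// ltW.
by rewrite ler_pXn2r ?nnegrE// (le_trans h1).
Qed.

Let maj_ge0 (r : R) : 0 <= majorant r.
Proof. by rewrite /majorant invr_ge0 sqr_ge0. Qed.

Let S_integrable (u t : R) : 1/2 < u -> alpha < t < beta -> mu.-integrable ray (EFin \o S u t).
Proof.
move=> u2 ab; have u0 : 0 < u by lra.
have k0 : 0 <= K by apply: K0; case/andP: ab; exact: lt_trans.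
apply: (@integrable_ray _ (u * K * 4)) => r r0; first exact: S_continuous.
rewrite (le_trans (S_bound u0 r0 ab))// -[leRHS]mulrA ler_wpM2l ?mulr_ge0 ?(ltW u0)//.
exact: maj_scale.
Qed.

(** The measure dr/r is invariant under dilations, so the integral of g(u r cis t) dr/r does not
    depend on u. Its derivative at u = 1, taken under the integral sign, is the left-hand side. *)
Lemma ray_scale_derivative (t : R) : alpha < t < beta ->
  \int[mu]_(r in ray) complex.Re (cis t * g' (r%:C * cis t)) = 0.
Proof.
move=> ab; have k0 : 0 <= K by apply: K0; case/andP: ab; exact: lt_trans.
pose f (u r : R) := S u t r.
pose F (u : R) := \int[mu]_(r in ray) f u r.
have I1 : `]1/2, 2[%classic (1 : R) by rewrite /= in_itv /=; apply/andP; split; lra.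
have d1f (u r : R) : 0 < u -> 0 < r ->
    is_derive u 1 (f ^~ r) (complex.Re (cis t * g' ((u * r)%:C * cis t))).
  by move=> u0 r0; exact: S_derive.
have p1f (u r : R) : 0 < u -> 0 < r ->
    partial1of2 f u r = complex.Re (cis t * g' ((u * r)%:C * cis t)).
  by move=> u0 r0; rewrite partial1of2E; have [_ ->] := d1f _ _ u0 r0.
have G0 (r : R) : 0 <= 4 * K * majorant r by rewrite !mulr_ge0.
have intG : mu.-integrable ray (EFin \o (fun r => 4 * K * majorant r)).
  exact: integrable_Zmaj.
have := @differentiation_under_integral R _ RR mu f ray measurable_ray 1 (1/2) 2 I1 _ _ _ G0 intG _.
have -> : (fun x' : R => \int[mu]_(y in ray) f x' y) = F by [].
move=> H.
have -> : \int[mu]_(r in ray) complex.Re (cis t * g' (r%:C * cis t)) =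
    \int[mu]_(r in ray) partial1of2 f 1 r.
  by apply: eq_Rintegral => r /[1!inE] /rayP r0; rewrite p1f// mul1r.
rewrite -H.
- have F1 (u : R) : 1/2 < u -> F u = F 1.
    move=> u2; have u0 : 0 < u by lra.
    rewrite /F (_ : \int[mu]_(r in ray) f u r = \int[mu]_(r in ray) (u * f 1 (u * r))).
      rewrite RintegralZl//; last 2 first.
      - exact: measurable_ray.
      - apply: (eq_integrable measurable_ray (fun r => (u^-1)%:E * (EFin \o S u t) r)%E).
          move=> r /[1!inE] /rayP r0; rewrite /= -EFinM; congr EFin.
          by rewrite /f /S !ReZ mul1r mulrA; congr (_ * _); field; rewrite !gt_eqF.
        exact: (integrableZl measurable_ray u^-1 (S_integrable u2 ab)).
      rewrite Rintegral_scale//; first by rewrite mulrA divff ?mul1r// gt_eqF.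
      by apply: S_integrable => //; lra.
    apply: eq_Rintegral => r /[1!inE] /rayP r0; rewrite /f /S !ReZ mul1r mulrA.
    by congr (_ * _); field; rewrite !gt_eqF.
  rewrite derive1E; suff [_ ->//] : is_derive (1 : R) 1 F 0.
  apply/is_derive_real_normP => e e0; exists (1/2) => [|h]; first by lra.
  rewrite ltr_norml => /andP[h1 h2]; rewrite F1; last by lra.
  by rewrite subrr mulr0 subr0 normr0 mulr_ge0// ltW.
- move=> u; rewrite /= in_itv /= => /andP[u2 _]; exact: S_integrable.
- move=> u r; rewrite /= in_itv /= => /andP[u2 _] /rayP r0.
  by have u0 : 0 < u by [lra]; have [] := d1f _ _ u0 r0.
- move=> u r; rewrite /= in_itv /= => /andP[u2 _] /rayP r0.
  have u0 : 0 < u by lra.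
  rewrite p1f// (le_trans (Re_normc _))// normcM normc_cis mul1r.
  rewrite (le_trans (g'K (mulr_gt0 u0 r0) ab))//.
  by rewrite (le_trans (ler_wpM2l k0 (maj_scale u2 r0)))// mulrCA mulrA.
Qed.

Let real_part_integrable (t : R) : alpha < t < beta ->
  mu.-integrable ray (EFin \o (fun r => complex.Re (r^-1%:C * g (r%:C * cis t)))).
Proof.
move=> ab; have h : (1/2 : R) < 1 by lra.
apply: (eq_integrable measurable_ray (EFin \o S 1 t)); last exact: S_integrable.
by move=> r _ /=; rewrite /S mul1r.
Qed.

Lemma ray_derivable_Re (t : R) : alpha < t < beta ->
  let F t := \int[mu]_(r in ray) complex.Re (r^-1%:C * g (r%:C * cis t)) in
  derivable F t 1 /\
  'D_1 F t = \int[mu]_(r in ray) complex.Re ('i%C * cis t * g' (r%:C * cis t)).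
Proof.
move=> ab F; have ab' := ab; case/andP: ab' => at_ tb.
have k0 : 0 <= K by apply: K0; exact: lt_trans tb.
pose f (u r : R) := complex.Re (r^-1%:C * g (r%:C * cis u)).
have d1f (u r : R) : alpha < u < beta -> 0 < r ->
    is_derive u 1 (f ^~ r) (complex.Re ('i%C * cis u * g' (r%:C * cis u))).
  move=> u0 r0; have := curve_Re (curve_mulc r^-1%:C (curve_t r0 u0)).
  congr (is_derive _ _ _ (complex.Re _)).
  have rr : r^-1%:C * r%:C = 1 :> R[i] by rewrite -rmorphM /= mulVf ?gt_eqF.
  transitivity ((r^-1%:C * r%:C) * ('i%C * cis u * g' (r%:C * cis u))); first by ring.
  by rewrite rr mul1r.
have p1f (u r : R) : alpha < u < beta -> 0 < r ->
    partial1of2 f u r = complex.Re ('i%C * cis u * g' (r%:C * cis u)).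
  by move=> u0 r0; rewrite partial1of2E; have [_ ->] := d1f _ _ u0 r0.
have I1 : `]alpha, beta[%classic (t : R) by rewrite /= in_itv.
have G0 (r : R) : 0 <= K * majorant r by rewrite mulr_ge0.
have intG : mu.-integrable ray (EFin \o (fun r => K * majorant r)).
  exact: integrable_Zmaj.
have h1 u : `]alpha, beta[%classic (u : R) -> mu.-integrable ray (EFin \o f u).
  by rewrite /= in_itv /=; exact: real_part_integrable.
have h2 (u r : R) : `]alpha, beta[%classic u -> ray r -> derivable (f ^~ r) u 1.
  by rewrite /= in_itv /= => u0 /rayP r0; have [] := d1f _ _ u0 r0.
have h3 (u r : R) : `]alpha, beta[%classic u -> ray r -> `|partial1of2 f u r| <= K * majorant r.
  rewrite /= in_itv /= => u0 /rayP r0.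
  rewrite p1f// (le_trans (Re_normc _))// !normcM normc_cis mulr1.
  by rewrite (_ : normc 'i%C = 1) ?mul1r ?g'K//= expr0n expr1n add0r sqrtr1.
split; first exact: (@derivable_under_integral R _ RR mu f ray measurable_ray t alpha beta I1 h1 h2 _ G0 intG h3).
rewrite -derive1E.
rewrite (@differentiation_under_integral R _ RR mu f ray measurable_ray t alpha beta I1 h1 h2 _ G0 intG h3).
by apply: eq_Rintegral => r /[1!inE] /rayP r0; rewrite p1f.
Qed.

End Ray.

Section RayConstant.
Variables (g g' : C -> C) (alpha beta K : R).
Hypothesis gd : forall r t : R, 0 < r -> alpha < t < beta ->
  is_derive (r%:C * cis t : C) 1 g (g' (r%:C * cis t)).
Hypothesis gK : forall r t : R, 0 < r -> alpha < t < beta ->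
  normc (g (r%:C * cis t)) <= K * (r * majorant r).
Hypothesis g'K : forall r t : R, 0 < r -> alpha < t < beta ->
  normc (g' (r%:C * cis t)) <= K * majorant r.

Let mulc_derive (c : R[i]) (z d : C) : is_derive z 1 g d ->
  is_derive z 1 (fun w : C => c * g w : C) (c * d).
Proof. by move=> dg; exact: (complex_derive_comp dg (is_derive_linear c (g z))). Qed.

(** Cauchy's theorem for a sector. The derivative in t of the integral of g(r cis t) dr/r is i times
    the integral of cis t * g'(r cis t) dr, and that vanishes by [ray_scale_derivative]. The factors
    c = 1 and c = -i give the real and the imaginary part. *)
Let ray_constant_Re (c : R[i]) (t1 t2 : R) : normc c = 1 ->
  alpha < t1 < beta -> alpha < t2 < beta ->
  \int[mu]_(r in ray) complex.Re (r^-1%:C * (c * g (r%:C * cis t1))) =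
  \int[mu]_(r in ray) complex.Re (r^-1%:C * (c * g (r%:C * cis t2))).
Proof.
move=> c1 ab1 ab2.
have bd (e : R[i]) (h : C -> C) (M r t : R) : normc e = 1 -> normc (h (r%:C * cis t)) <= M ->
    normc (e * h (r%:C * cis t)) <= M by move=> e1; rewrite normcM e1 mul1r.
have ic : normc ('i%C * c) = 1.
  by rewrite normcM c1 mulr1 /= expr0n expr1n add0r sqrtr1.
pose F t := \int[mu]_(r in ray) complex.Re (r^-1%:C * (c * g (r%:C * cis t))).
have dF t : alpha < t < beta -> is_derive t 1 F 0.
  move=> ab.
  have [h1 h2] := @ray_derivable_Re (fun w => c * g w) (fun w => c * g' w) alpha beta K
    (fun r t r0 ab => mulc_derive c (gd r0 ab)) (fun r t r0 ab => bd _ _ _ _ _ c1 (gK r0 ab))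
    (fun r t r0 ab => bd _ _ _ _ _ c1 (g'K r0 ab)) t ab.
  have h3 := @ray_scale_derivative (fun w => 'i%C * c * g w) (fun w => 'i%C * c * g' w) alpha beta K
    (fun r t r0 ab => mulc_derive ('i%C * c) (gd r0 ab)) (fun r t r0 ab => bd _ _ _ _ _ ic (gK r0 ab))
    (fun r t r0 ab => bd _ _ _ _ _ ic (g'K r0 ab)) t ab.
  apply: DeriveDef => //; rewrite h2 -[RHS]h3.
  by apply: eq_Rintegral => r _; congr (complex.Re _); ring.
rewrite -/(F t1) -/(F t2).
wlog t12 : t1 t2 ab1 ab2 / t1 <= t2 => [hw|].
  by case: (leP t1 t2) => [|/ltW] h; [|symmetry]; exact: hw.
have [||x _] := @MVT_segment R F (fun=> 0) t1 t2 t12.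
- move=> x; rewrite in_itv /= => /andP[x1 x2]; apply: dF.
  by case/andP: ab1 => a1 _; case/andP: ab2 => _ b2; rewrite (lt_trans a1 x1) (lt_trans x2 b2).
- apply: derivable_within_continuous => x; rewrite in_itv /= => /andP[x1 x2].
  have xab : alpha < x < beta.
    by case/andP: ab1 => a1 _; case/andP: ab2 => _ b2; rewrite (lt_le_trans a1 x1) (le_lt_trans x2 b2).
  by have [] := dF _ xab.
by rewrite mul0r => /eqP; rewrite subr_eq0 => /eqP.
Qed.

Lemma ray_constant (t1 t2 : R) : alpha < t1 < beta -> alpha < t2 < beta ->
  Cint (fun r => r^-1%:C * g (r%:C * cis t1)) = Cint (fun r => r^-1%:C * g (r%:C * cis t2)).
Proof.
move=> ab1 ab2; congr (_ +i* _).
  have := @ray_constant_Re 1 t1 t2 (normc_nat R 1) ab1 ab2.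
  by under eq_Rintegral do rewrite mul1r; under [RHS]eq_Rintegral do rewrite mul1r.
have i1 : normc (- 'i%C : R[i]) = 1 by rewrite /= oppr0 sqrrN expr0n expr1n add0r sqrtr1.
have e (z : R[i]) (r : R) : complex.Re (r^-1%:C * (- 'i%C * z)) = complex.Im (r^-1%:C * z).
  by rewrite ReZ ImZ; congr (_ * _); case: z => x y /=; ring.
have := @ray_constant_Re (- 'i%C) t1 t2 i1 ab1 ab2.
by under eq_Rintegral do rewrite e; under [RHS]eq_Rintegral do rewrite e.
Qed.

End RayConstant.

End RayIntegrals.

Section Cauchy.
Variable R : realType.
Local Notation C := (R[i]^o).
Local Notation mu := (@lebesgue_measure R).
Local Notation ray := (@ray R).
Local Notation maj := (@majorant R).

Lemma cos_le_norm (x y : R) : `|x| <= `|y| -> `|y| <= pi -> cos y <= cos x.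
Proof.
move=> xy yp; rewrite -(cos_norm x) -(cos_norm y) le_eqVlt.
move: xy; rewrite le_eqVlt => /orP[/eqP->|xy]; first by rewrite eqxx.
rewrite ltr_cos ?xy ?orbT// in_itv /= normr_ge0//=.
by rewrite (le_trans (ltW xy)).
Qed.

Lemma normc_sq (z : R[i]) : normc z ^+ 2 = complex.Re z ^+ 2 + complex.Im z ^+ 2.
Proof. by case: z => x y /=; rewrite sqr_sqrtr// addr_ge0 ?sqr_ge0. Qed.

Lemma normc_polar_real (r t a : R) :
  normc (r%:C * cis t + a%:C) ^+ 2 = r ^+ 2 + a ^+ 2 + 2 * r * a * cos t.
Proof.
rewrite normc_sq /= !mul0r addr0 subr0 addr0.
have := cos2Dsin2 t; move: (cos t) (sin t) => x y h.
transitivity (r ^+ 2 * (x ^+ 2 + y ^+ 2) + a ^+ 2 + 2 * r * a * x); first by ring.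
by rewrite h mulr1.
Qed.

(** For s in [0, pi] this is cos (s / 2), the least value of |r cis t + a| / (r + a) over |t| <= s,
    attained at t = s and r = a. *)
Definition aperture (s : R) : R := Num.sqrt ((1 + cos s) / 2).

Lemma aperture_gt0 (s : R) : 0 <= s < pi -> 0 < aperture s.
Proof.
move=> /andP[s0 sp]; rewrite sqrtr_gt0 divr_gt0// -ltrBlDl add0r -cospi.
by rewrite ltr_cos// in_itv /= ?lexx ?pi_ge0// s0 ltW.
Qed.

Lemma aperture_polarD (r t a s : R) : 0 <= r -> 0 <= a -> `|t| <= s -> s <= pi ->
  aperture s * (r + a) <= normc (r%:C * cis t + a%:C).
Proof.
move=> r0 a0 ts sp.
have s0 : 0 <= s := le_trans (normr_ge0 _) ts.
have ra : 0 <= r + a := addr_ge0 r0 a0.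
have c1 : 0 <= (1 + cos s) / 2 by rewrite divr_ge0// -lerBlDl add0r cos_geN1.
rewrite -(@ler_pXn2r _ 2) ?nnegrE ?normc_ge0 ?mulr_ge0 ?sqrtr_ge0//.
rewrite exprMn sqr_sqrtr// normc_polar_real.
have ct : cos s <= cos t by apply: cos_le_norm; rewrite (ger0_norm s0).
have := cos_le1 s; have ra' := mulr_ge0 r0 a0.
have := ler_wpM2l ra' ct; move: (cos s) (cos t) => x y h1 h2.
have h3 : 0 <= (1 - x) * (r - a) ^+ 2 by rewrite mulr_ge0 ?sqr_ge0// subr_ge0.
by clear -h1 h3; nra.
Qed.

Lemma aperture_polarB (r t a s : R) : 0 <= r -> 0 <= a -> 0 <= s -> s <= `|t| -> `|t| <= pi ->
  aperture (pi - s) * (r + a) <= normc (r%:C * cis t - a%:C).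
Proof.
move=> r0 a0 s0 st tp.
pose t' : R := if 0 <= t then t - pi else t + pi.
have ct : cis t = - cis t'.
  rewrite /t' /cis; case: ifP => _.
    rewrite cosB sinB cospi sinpi; apply/eqP; rewrite eq_complex /=.
    by rewrite !mulr0 !mulrN1 addr0 subr0 !opprK !eqxx.
  rewrite cosD sinD cospi sinpi; apply/eqP; rewrite eq_complex /=.
  by rewrite !mulr0 !mulrN1 addr0 subr0 !opprK !eqxx.
have -> : r%:C * cis t - a%:C = - (r%:C * cis t' + a%:C) by rewrite ct; ring.
rewrite normc_opp; apply: aperture_polarD; rewrite // ?lerBlDr ?lerDl//.
rewrite /t'; case: ifP => [t0|/negbT]; last rewrite -ltNge => t0.
  move: st tp; rewrite ger0_norm// => st tp.
  by rewrite ler0_norm ?subr_le0// opprB lerD2l lerN2.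
move: st tp; rewrite ltr0_norm// => st tp.
have tp0 : 0 <= t + pi by rewrite -lerBlDr sub0r lerNl.
by rewrite ger0_norm// addrC lerD2l lerNr.
Qed.

(* The growth of [regularizer] and of its derivative; unlike [H0inf] this class
   needs no exponent and its members can be differentiated under the integral. *)
Definition adm (s : R) (f : R[i] -> R[i]) := exists (f' : R[i] -> R[i]) (K : R),
  forall r t : R, 0 < r -> `|t| < s ->
  [/\ is_derive (r%:C * cis t : C) 1 (f : C -> C) (f' (r%:C * cis t)),
      normc (f (r%:C * cis t)) <= K * (r * maj r)
    & normc (f' (r%:C * cis t)) <= K * maj r].

Lemma adm_lin (s : R) (c : R[i]) f g : adm s f -> adm s g -> adm s (fun l => c * f l + g l).
Proof.
move=> [f' [K h]] [g' [L k]]; exists (fun l => c * f' l + g' l), (normc c * K + L) => r t r0 ts.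
have [h1 h2 h3] := h _ _ r0 ts; have [k1 k2 k3] := k _ _ r0 ts; split.
- have := is_deriveD (complex_derive_comp h1 (is_derive_linear c (f (r%:C * cis t)))) k1.
  exact.
- rewrite (le_trans (normcD _ _))// normcM mulrDl lerD// -mulrA ler_wpM2l ?normc_ge0//.
- rewrite (le_trans (normcD _ _))// normcM mulrDl lerD// -mulrA ler_wpM2l ?normc_ge0//.
Qed.

Lemma adm_sum (s : R) (n : nat) (c : nat -> R[i]) (f : nat -> R[i] -> R[i]) :
  (forall k, adm s (f k)) -> adm s (fun l => \sum_(k < n) c k * f k l).
Proof.
move=> af; elim: n => [|n ih].
  exists (fun=> 0), 0 => r t r0 ts; split.
  - have -> : (fun l => \sum_(k < 0) c k * f k l) = (cst 0 : C -> C).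
      by apply/funext => l; rewrite big_ord0.
    exact: is_derive_cst.
  - by rewrite big_ord0 normc0 mul0r.
  - by rewrite normc0 mul0r.
have -> : (fun l => \sum_(k < n.+1) c k * f k l) = (fun l => c n * f n l + \sum_(k < n) c k * f k l).
  by apply/funext => l; rewrite big_ord_recr addrC.
exact: adm_lin.
Qed.

Lemma maj_dilation (b r : R) : 0 < b -> 0 < r -> maj (r / b) <= (1 + b) ^+ 2 * maj r.
Proof.
move=> b0 r0; have rb : 0 < r / b by rewrite divr_gt0.
rewrite /majorant ler_pdivlMr ?exprn_gt0 ?addr_gt0// mulrC ler_pdivrMr ?exprn_gt0 ?addr_gt0//.
rewrite -exprMn ler_pXn2r ?nnegrE ?mulr_ge0 ?addr_ge0 ?(ltW r0) ?(ltW b0) ?(ltW rb)//.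
have -> : (1 + b) * (1 + r / b) = 1 + b + r / b + r by field; rewrite gt_eqF.
by lra.
Qed.

Lemma maj_ge0 (r : R) : 0 <= maj r.
Proof. by rewrite /majorant invr_ge0 sqr_ge0. Qed.

Lemma adm_dilation (s b : R) f : 0 < b -> adm s f -> adm s (fun l => f (l / b%:C)).
Proof.
move=> b0 [f' [K h]]; pose B := (1 + b) ^+ 2.
exists (fun l => f' (l / b%:C) / b%:C), (`|K| / b * B) => r t r0 ts.
have e : r%:C * cis t / b%:C = (r / b)%:C * cis t.
  by rewrite rmorphM /= fmorphV /=; ring.
have rb : 0 < r / b by rewrite divr_gt0.
have [h1 h2 h3] := h _ _ rb ts; rewrite e; split.
- have d1 : is_derive (r%:C * cis t : C) 1 (fun w : C => w / b%:C : C) b%:C^-1.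
    have := is_derive_linear b%:C^-1 (r%:C * cis t : C).
    by congr (is_derive _ _ _ _); apply/funext => w; rewrite mulrC.
  by apply: complex_derive_comp d1 _; rewrite e.
- rewrite (le_trans h2)// (le_trans (ler_wpM2r _ (ler_norm K)))//.
    by apply: mulr_ge0; [exact: ltW|exact: maj_ge0].
  have -> : `|K| / b * B * (r * maj r) = `|K| * (r / b * (B * maj r)) by ring.
  by rewrite ler_wpM2l// ler_wpM2l ?(ltW rb)// maj_dilation.
- rewrite normcM normcV normc_real gtr0_norm// ler_pdivrMr//.
  have -> : `|K| / b * B * maj r * b = `|K| * (B * maj r) by field; rewrite gt_eqF.
  rewrite (le_trans h3)// (le_trans (ler_wpM2r _ (ler_norm K))) ?maj_ge0//.
  by rewrite ler_wpM2l// maj_dilation.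
Qed.

(* The Cauchy integrand of f at a along the ray of angle t, and [cis t] from [dl]. *)
Definition rayfun (f : R[i] -> R[i]) (a t r : R) : R[i] :=
  cis t * f (r%:C * cis t) / (r%:C * cis t - a%:C).

(** [K] depends on [f] only, so the estimate holds at all nodes simultaneously. *)
Lemma rayfun_bound s f : adm s f -> exists K, 0 <= K /\
  forall a t r, 0 < a -> 0 < r -> t != 0 -> `|t| < s -> s <= pi ->
  normc (rayfun f a t r) <= K / aperture (pi - `|t|) * maj r.
Proof.
move=> [f' [K h]]; exists `|K|; split=> // a t r a0 r0 t0 ts sp.
have [_ h2 _] := h _ _ r0 ts; have tp := ltW (lt_le_trans ts sp).
have ap : 0 < aperture (pi - `|t|).
  by apply: aperture_gt0; rewrite subr_ge0 tp /= ltrBlDr ltrDl normr_gt0.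
have lb := aperture_polarB (ltW r0) (ltW a0) (normr_ge0 t) (lexx _) tp.
rewrite /rayfun !normcM normc_cis mul1r normcV.
have n0 : 0 < normc (r%:C * cis t - a%:C).
  by apply: lt_le_trans lb; rewrite mulr_gt0// addr_gt0.
rewrite ler_pdivrMr// (le_trans h2)//.
rewrite (le_trans (ler_wpM2r _ (ler_norm K))) ?mulr_ge0 ?maj_ge0 ?(ltW r0)//.
have := ler_wpM2l (mulr_ge0 (normr_ge0 K) (maj_ge0 r)) lb.
move: (normc _) (aperture _) (maj_ge0 r) ap (normr_ge0 K) n0 => n A m0 A0 k0 n0 {}lb.
rewrite -[leRHS]mulrA.
have -> : `|K| / A * (maj r * n) = `|K| * maj r * n / A by ring.
rewrite ler_pdivlMr//; apply: le_trans lb.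
have -> : `|K| * (r * maj r) * A = `|K| * maj r * (A * r) by ring.
by rewrite ler_wpM2l ?mulr_ge0// ler_wpM2l ?(ltW A0)// lerDl ltW.
Qed.

Lemma rayfun_curve s f (a t r : R) : adm s f -> 0 < r -> `|t| < s ->
  r%:C * cis t != a%:C -> exists d, itcurve (rayfun f a t) r d.
Proof.
move=> [f' [K h]] r0 ts ra; have [h1 _ _] := h _ _ r0 ts.
have nz : r%:C * cis t - a%:C != 0 by rewrite subr_eq0.
have dB : is_derive (r%:C * cis t : C) 1 (fun w : C => w - a%:C : C) 1.
  by have := is_deriveB (is_derive_id (r%:C * cis t : C) 1) (is_derive_cst (a%:C : C) (r%:C * cis t : C) 1); rewrite subr0.
have d1 := complex_deriveM h1 (@complex_deriveV _ (fun w : C => w - a%:C) _ _ nz dB).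
have c1 := curve_mulc (cis t) (curve_comp (curve_scale (cis t) r) d1).
by eexists; move: c1; congr itcurve; apply/funext => u; rewrite /rayfun /= mulrA.
Qed.

Lemma polar_neq_real (a t r : R) : 0 < r -> 0 < a -> t != 0 -> `|t| <= pi -> r%:C * cis t != a%:C.
Proof.
move=> r0 a0 t0 tp; rewrite -subr_eq0; apply: contraTneq isT => e.
have := aperture_polarB (ltW r0) (ltW a0) (normr_ge0 t) (lexx _) tp.
rewrite e normc0 leNgt mulr_gt0 ?addr_gt0// aperture_gt0//.
by rewrite subr_ge0 tp /= ltrBlDr ltrDl normr_gt0.
Qed.

Lemma rayfun_Re_continuous s f (c : R[i]) (a t r : R) : adm s f -> s <= pi -> 0 < a -> 0 < r ->
  `|t| < s -> t != 0 -> {for r, continuous (fun r => complex.Re (c * rayfun f a t r))}.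
Proof.
move=> af sp a0 r0 ts t0.
have [d hd] := rayfun_curve af r0 ts (polar_neq_real r0 a0 t0 (ltW (lt_le_trans ts sp))).
exact: itcurve_continuous_Re (curve_mulc c hd).
Qed.

Lemma rayfun_Re_integrable s f (c : R[i]) (a t : R) : adm s f -> s <= pi -> 0 < a ->
  `|t| < s -> t != 0 -> mu.-integrable ray (EFin \o (fun r : R => complex.Re (c * rayfun f a t r))).
Proof.
move=> af sp a0 ts t0; have [K [k0 hK]] := rayfun_bound af.
apply: (@integrable_ray R (fun r : R => complex.Re (c * rayfun f a t r)) (normc c * (K / aperture (pi - `|t|)))) => r r0.
  have := @rayfun_Re_continuous s f c a t r af sp a0 r0 ts t0; exact.
by rewrite (le_trans (Re_normc _))// normcM -[leRHS]mulrA ler_wpM2l ?normc_ge0// hK.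
Qed.

Lemma normc_bound_trans (s K r m c : R) : 0 <= K -> 0 < r -> 0 < c -> 0 <= m ->
  c * r <= s -> 0 < s -> K * (r * m) / s <= K / c * m.
Proof.
move=> k0 r0 c0 m0 cs s0; rewrite ler_pdivrMr//.
have -> : K / c * m * s = K * m * s / c by ring.
rewrite ler_pdivlMr//.
have -> : K * (r * m) * c = K * m * (c * r) by ring.
by rewrite ler_wpM2l ?mulr_ge0.
Qed.

(** The two rays lie on the same side of the positive axis. The integrand is g(l) dl / l with g(l) =
    l f(l) / (l - a), and [m] keeps the angles between them away from 0, where the pole lies. *)
Lemma rayfun_constant s f (a t1 t2 : R) : adm s f -> s < pi -> 0 < a ->
  `|t1| < s -> `|t2| < s -> 0 < t1 * t2 ->
  Cint (rayfun f a t1) = Cint (rayfun f a t2).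
Proof.
move=> [f' [K h]] sp a0 ts1 ts2 t12.
have [t10 t20] : t1 != 0 /\ t2 != 0.
  by split; apply: contraTneq t12 => ->; rewrite ?mulr0 ?mul0r ltxx.
pose m := Num.min `|t1| `|t2| / 2.
have m0 : 0 < m by rewrite divr_gt0// lt_min !normr_gt0 t10.
have m1 : m < `|t1|.
  rewrite /m ltr_pdivrMr// gt_min; apply/orP; left.
  by rewrite ltr_pMr ?normr_gt0//; lra.
have m2 : m < `|t2|.
  rewrite /m ltr_pdivrMr// gt_min; apply/orP; right.
  by rewrite ltr_pMr ?normr_gt0//; lra.
have [alpha [beta [I1 I2 I]]] : exists alpha beta, [/\ alpha < t1 < beta, alpha < t2 < beta &
    forall t, alpha < t < beta -> m <= `|t| /\ `|t| < s].
  move: t12 ts1 ts2 m1 m2; case: (ltrP 0 t1) => [p1|].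
    rewrite pmulr_rgt0// => p2; rewrite !gtr0_norm// => ts1 ts2 m1 m2.
    exists m, s; split; rewrite ?m1 ?m2// => t /andP[mt ts].
    by rewrite gtr0_norm ?(lt_trans m0)// ltW.
  rewrite le_eqVlt (negbTE t10) /= => p1.
  rewrite nmulr_rgt0// => p2; rewrite !ltr0_norm// => ts1 ts2 m1 m2.
  exists (- s), (- m); split.
  - by rewrite ltrNl ts1 ltrNr.
  - by rewrite ltrNl ts2 ltrNr.
  move=> t /andP[mt ts].
  have t0 : t < 0 by rewrite (lt_trans ts)// oppr_lt0.
  by rewrite ltr0_norm//; split; [rewrite lerNr ltW|rewrite ltrNl].
pose c := aperture (pi - m).
have mp : m <= pi by rewrite (le_trans (ltW m1))// ltW// (lt_trans ts1).
have c0 : 0 < c by apply: aperture_gt0; rewrite subr_ge0 mp /= ltrBlDr ltrDl.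
pose g (l : C) : C := l * (f l / (l - a%:C)).
pose g' (l : C) : C := l * (f l * (- (l - a%:C) ^- 2 * 1) + (l - a%:C)^-1 * f' l) + f l / (l - a%:C) * 1.
pose L := `|K| / c * 2 + `|K| / c ^+ 2.
have low r t : 0 < r -> alpha < t < beta -> c * r <= normc (r%:C * cis t - a%:C).
  move=> r0 /I[mt ts]; apply: le_trans (aperture_polarB (ltW r0) (ltW a0) (ltW m0) mt (ltW (lt_trans ts sp))).
  by rewrite ler_wpM2l ?(ltW c0)// lerDl ltW.
have pos r t : 0 < r -> alpha < t < beta -> 0 < normc (r%:C * cis t - a%:C).
  by move=> r0 ab; apply: lt_le_trans (low r t r0 ab); rewrite mulr_gt0.
have nz r t : 0 < r -> alpha < t < beta -> r%:C * cis t - a%:C != 0.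
  by move=> r0 ab; apply: contraTneq (pos r t r0 ab) => ->; rewrite normc0 ltxx.
have K0 := normr_ge0 K.
have b1 r t : 0 < r -> alpha < t < beta -> normc (f (r%:C * cis t)) <= `|K| * (r * maj r).
  move=> r0 ab; have [_ h2 _] := h _ _ r0 (I _ ab).2.
  by rewrite (le_trans h2)// ler_wpM2r ?ler_norm// mulr_ge0 ?maj_ge0// ltW.
have b2 r t : 0 < r -> alpha < t < beta -> normc (f (r%:C * cis t) / (r%:C * cis t - a%:C)) <= `|K| / c * maj r.
  move=> r0 ab; rewrite normcM normcV.
  apply: le_trans (normc_bound_trans K0 r0 c0 (maj_ge0 r) (low _ _ r0 ab) (pos _ _ r0 ab)).
  by rewrite ler_wpM2r ?invr_ge0 ?normc_ge0// b1.
have b3 r t : 0 < r -> alpha < t < beta -> normc (r%:C * cis t / (r%:C * cis t - a%:C)) <= c^-1.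
  move=> r0 ab; rewrite normcM normcV normc_polar ?(ltW r0)// ler_pdivrMr ?pos//.
  by rewrite mulrC ler_pdivlMr// mulrC low.
have E t : alpha < t < beta -> Cint (fun r : R => (r^-1)%:C * g (r%:C * cis t)) = Cint (rayfun f a t).
  move=> ab; have e r : 0 < r -> (r^-1)%:C * g (r%:C * cis t) = rayfun f a t r.
    move=> r0; rewrite /g /rayfun.
    have rr : r^-1%:C * r%:C = 1 :> R[i] by rewrite -rmorphM /= mulVf ?gt_eqF.
    transitivity ((r^-1%:C * r%:C) * (cis t * f (r%:C * cis t) / (r%:C * cis t - a%:C))); first by ring.
    by rewrite rr mul1r.
  by congr (_ +i* _); apply: eq_Rintegral => r /[1!inE] /rayP r0; rewrite e.
rewrite -(E _ I1) -(E _ I2); apply: (@ray_constant R g g' alpha beta L _ _ _ t1 t2 I1 I2).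
- move=> r t r0 ab; have [h1 _ _] := h _ _ r0 (I _ ab).2.
  have dB : is_derive (r%:C * cis t : C) 1 (fun w : C => w - a%:C : C) 1.
    by have := is_deriveB (is_derive_id (r%:C * cis t : C) 1) (is_derive_cst (a%:C : C) (r%:C * cis t : C) 1); rewrite subr0.
  have d1 := complex_deriveM h1 (@complex_deriveV _ (fun w : C => w - a%:C) _ _ (nz _ _ r0 ab) dB).
  exact: complex_deriveM (is_derive_id (r%:C * cis t : C) 1) d1.
- move=> r t r0 ab; rewrite /g normcM normc_polar ?(ltW r0)//.
  rewrite (le_trans (ler_wpM2l (ltW r0) (b2 _ _ r0 ab)))//.
  rewrite mulrCA ler_wpM2r ?mulr_ge0 ?maj_ge0 ?(ltW r0)//.
  have p1 : 0 <= `|K| / c by rewrite divr_ge0// ltW.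
  have p2 : 0 <= `|K| / c ^+ 2 by rewrite divr_ge0// ltW// exprn_gt0.
  by rewrite /L; lra.
- move=> r t r0 ab; have [_ _ h3] := h _ _ r0 (I _ ab).2.
  rewrite /g' mulr1 mulr1; set l := r%:C * cis t.
  have -> : l * (f l * - (l - a%:C) ^- 2 + (l - a%:C)^-1 * f' l) + f l / (l - a%:C) =
     - (l / (l - a%:C) * (f l / (l - a%:C))) + (l / (l - a%:C) * f' l + f l / (l - a%:C)).
    by rewrite -exprVn; ring.
  rewrite (le_trans (normcD _ _))//.
  have -> : L * maj r = c^-1 * (`|K| / c * maj r) + (c^-1 * (`|K| * maj r) + `|K| / c * maj r).
    by rewrite /L; field; rewrite gt_eqF.
  have h3' : normc (f' l) <= `|K| * maj r.
    by rewrite (le_trans h3)// ler_wpM2r ?maj_ge0 ?ler_norm.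
  apply: lerD; first by rewrite normc_opp normcM ler_pM ?normc_ge0 ?b2 ?b3.
  rewrite (le_trans (normcD _ _))// lerD ?b2// normcM ler_pM ?normc_ge0// b3//.
Qed.

End Cauchy.

(** * Cauchy's formula at a point of the positive axis *)

Section CauchyFormula.
Variable R : realType.
Local Notation C := (R[i]^o).
Local Notation mu := (@lebesgue_measure R).
Local Notation RR := (measurableTypeR R).
Local Notation ray := (@ray R).
Local Notation maj := (@majorant R).

(** Dominated convergence for functions sharing one integral q. The point [a], where convergence may
    fail, will be the pole; it is a null set. *)
Lemma ray_limit_zero (D : nat -> R -> R) (K q a : R) :
  (forall n r, 0 < r -> {for r, continuous (D n)}) ->
  (forall n r, 0 < r -> `|D n r| <= K * maj r) ->
  (forall r, 0 < r -> r != a -> D^~ r @ \oo --> (0 : R)) ->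
  (forall n, \int[mu]_(r in ray) D n r = q) -> q = 0.
Proof.
move=> cD bD lD iD.
have mD n : measurable_fun ray (fun r : RR => (D n r)%:E).
  by apply/measurable_EFinP; apply: measurable_ray_continuous => r r0; exact: cD.
have iG : mu.-integrable ray (EFin \o (fun r => K * maj r)).
  exact: integrable_Zmaj.
have [|||_ _ ] := @dominated_convergence _ RR R mu ray (@measurable_ray R)
   (fun n r => (D n r)%:E) (cst 0%E) (EFin \o (fun r : R => K * maj r)) mD _ _ iG _.
- exact: measurable_cst.
- exists [set a]; split; [exact: measurable_set1|exact: lebesgue_measure_set1|].
  move=> r /= nr; apply: contrapT => ra; apply: nr => /rayP r0.
  by apply: cvg_EFin; [exact: nearW|apply: lD => //; apply/eqP].
- by apply: aeW => r n /rayP r0; rewrite abse_EFin lee_fin bD.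
rewrite integral0.
have E n : (\int[mu]_(x in ray) (D n x)%:E)%E = q%:E.
  have iDn : mu.-integrable ray (EFin \o D n).
    by apply: (@integrable_ray _ _ K) => r r0; [exact: cD|exact: bD].
  by rewrite -(iD n) /Rintegral fineK// (integrable_fin_num (@measurable_ray R) iDn).
rewrite (_ : [sequence _]_n = cst q%:E); last by apply/funext => n; rewrite /= E.
move=> h; have h2 := cvg_lim (@ereal_hausdorff R) h.
by move: (h2 eventually_filter); rewrite (lim_cst (@ereal_hausdorff R)) => -[].
Qed.

Lemma rayfunE (f : R[i] -> R[i]) (a t r : R) : 0 < r -> let l := r%:C * cis t in
  rayfun f a t r = r^-1%:C * (l * (f l / (l - a%:C))).
Proof.
move=> r0 l; rewrite /rayfun -/l {2}/l.
have rr : r^-1%:C * r%:C = 1 :> R[i] by rewrite -rmorphM /= mulVf ?gt_eqF.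
transitivity ((r^-1%:C * r%:C) * (cis t * f l / (l - a%:C))); first by rewrite rr mul1r.
by rewrite /l; ring.
Qed.

(** The zero of f cancels the pole, so the estimate persists down to angle 0. The three summands of
    the constant account for r >= 2a, for points at distance at least d from a, and for points near
    a, where f(l) is controlled by the derivative at a. *)
Lemma rayfun_bound_zero s f (a : R) : adm s f -> 0 < s -> 0 < a -> f a%:C = 0 ->
  exists K, forall t r, 0 < r -> `|t| < s -> normc (rayfun f a t r) <= K * maj r.
Proof.
move=> [f' [K h]] s0 a0 fa0.
have [h1 _ _] := h a 0 a0 (eq_ind_r (fun x => x < s) s0 (normr0 _)).
rewrite cis0 mulr1 in h1.
have [d0 d00 hd] := (is_derive_normP _ _ _).1 h1 1 ltr01.
pose d := Num.min d0 a.
have dd : d <= d0 by rewrite ge_min lexx.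
have dp : 0 < d by rewrite lt_min d00.
pose B := normc (f' a%:C) + 1.
have B0 : 0 <= B by rewrite addr_ge0 ?normc_ge0.
pose A := `|K|.
have A0 : 0 <= A by exact: normr_ge0.
have p1 : 0 <= 2 * A * a / d by rewrite divr_ge0 ?mulr_ge0// ltW.
have p2 : 0 <= B * (1 + 2 * a) ^+ 2 by rewrite mulr_ge0// sqr_ge0.
exists (2 * A + 2 * A * a / d + B * (1 + 2 * a) ^+ 2) => t r r0 ts.
have [_ h2 _] := h r t r0 ts; rewrite /rayfun -mulrA normcM normc_cis mul1r normcM normcV.
have {}h2 : normc (f (r%:C * cis t)) <= A * (r * maj r).
  by rewrite (le_trans h2)// ler_wpM2r ?ler_norm// mulr_ge0 ?maj_ge0// ltW.
have nl := normc_polar t (ltW r0).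
move: (r%:C * cis t) nl h2 => l nl h2.
have m0 := maj_ge0 r.
have tri : r <= normc (l - a%:C) + a.
  have := normcD (l - a%:C) a%:C; rewrite subrK nl normc_real gtr0_norm//.
case: (leP (2 * a) r) => ra.
  have la : 1 / 2 * r <= normc (l - a%:C) by move: tri ra; clear; lra.
  have la0 : 0 < normc (l - a%:C) by rewrite (lt_le_trans _ la)// mulr_gt0//; lra.
  have c2 : 0 < 1 / 2 :> R by lra.
  have h3 := normc_bound_trans A0 r0 c2 m0 la la0.
  rewrite (le_trans (ler_wpM2r _ h2)) ?invr_ge0 ?normc_ge0//.
  apply: (le_trans h3); apply: ler_wpM2r => //.
  have -> : A / (1 / 2) = 2 * A by field.
  by move: p1 p2; move: (2 * A * a / d) (B * _) => x y; clear; lra.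
case: (leP d (normc (l - a%:C))) => la.
  have la0 : 0 < normc (l - a%:C) by rewrite (lt_le_trans dp).
  rewrite ler_pdivrMr// (le_trans h2)//.
  have -> : A * (r * maj r) = maj r * (A * r) by ring.
  have -> : (2 * A + 2 * A * a / d + B * (1 + 2 * a) ^+ 2) * maj r * normc (l - a%:C) =
    maj r * ((2 * A + 2 * A * a / d + B * (1 + 2 * a) ^+ 2) * normc (l - a%:C)) by ring.
  apply: ler_wpM2l => //.
  have q1 : A * r <= 2 * A * a.
    by have -> : 2 * A * a = A * (2 * a) by [ring]; rewrite ler_wpM2l// ltW.
  apply: le_trans q1 _.
  have q2 : 2 * A * a <= 2 * A * a / d * normc (l - a%:C).
    rewrite -[leRHS]mulrA; apply: ler_peMr; first by rewrite !mulr_ge0// ltW.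
    by rewrite ler_pdivlMl// mulr1.
  apply: le_trans q2 _; apply: ler_wpM2r; first exact: normc_ge0.
  have p3 : 0 <= 2 * A by rewrite mulr_ge0.
  by move: p2 p3; move: (2 * A * a / d) (B * _) => x y; clear; lra.
have fl : normc (f l) <= B * normc (l - a%:C).
  have := hd (l - a%:C) (lt_le_trans la dd).
  rewrite [a%:C + _]addrC subrK fa0 subr0 mul1r => h3.
  have := normcD (f l - f' a%:C * (l - a%:C)) (f' a%:C * (l - a%:C)).
  rewrite subrK normcM => h4; rewrite (le_trans h4)// /B mulrDl mul1r addrC lerD2l//.
have h5 : B <= B * (1 + 2 * a) ^+ 2 * maj r.
  rewrite -mulrA ler_peMr// /majorant ler_pdivlMr ?exprn_gt0 ?addr_gt0// mul1r.
  by rewrite ler_pXn2r ?nnegrE ?addr_ge0 ?mulr_ge0 ?(ltW a0) ?(ltW r0)// lerD2l ltW.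
have h6 : normc (f l) / normc (l - a%:C) <= B.
  have [->|n0] := eqVneq (normc (l - a%:C)) 0; first by rewrite invr0 mulr0.
  by rewrite ler_pdivrMr// lt_neqAle eq_sym n0 normc_ge0.
rewrite (le_trans h6)// (le_trans h5)// ler_wpM2r//.
have p3 : 0 <= 2 * A by rewrite mulr_ge0.
by move: p1 p3; move: (2 * A * a / d) (B * _) => x y; clear; lra.
Qed.

Lemma rayfun_curve_angle s f (a r : R) : adm s f -> 0 < s -> 0 < r -> r != a ->
  exists d, itcurve (fun t => rayfun f a t r) 0 d.
Proof.
move=> [f' [K h]] s0 r0 ra; have [h1 _ _] := h r 0 r0 (eq_ind_r (fun x => x < s) s0 (normr0 _)).
have nz : r%:C * cis 0 - a%:C != 0.
  by rewrite cis0 mulr1 subr_eq0; apply: contra ra => /eqP[->].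
have dB : is_derive (r%:C * cis 0 : C) 1 (fun w : C => w - a%:C : C) 1.
  by have := is_deriveB (is_derive_id (r%:C * cis 0 : C) 1) (is_derive_cst (a%:C : C) (r%:C * cis 0 : C) 1); rewrite subr0.
have d1 := complex_deriveM h1 (@complex_deriveV _ (fun w : C => w - a%:C) _ _ nz dB).
have d2 := complex_deriveM (is_derive_id (r%:C * cis 0 : C) 1) d1.
have c1 := curve_mulc r^-1%:C (curve_comp (curve_mulc r%:C (@curve_cis R 0)) d2).
by eexists; move: c1; congr itcurve; apply/funext => u; rewrite rayfunE.
Qed.

(** By [rayfun_constant] the angles may be replaced by t / (n+1) and its opposite. As n grows, both
    integrands tend to the one on the axis except at the pole, and the uniform bound allows passing
    to the limit. *)
Lemma cauchy_zero s f (a t : R) : adm s f -> s < pi -> 0 < a -> f a%:C = 0 -> 0 < t < s ->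
  Cint (rayfun f a (- t)) = Cint (rayfun f a t).
Proof.
move=> af sp a0 fa0 /andP[t0 ts]; have s0 := lt_trans t0 ts.
have [K hK] := rayfun_bound_zero af s0 a0 fa0.
pose u n := t / n.+1%:R.
have u0 n : 0 < u n by rewrite divr_gt0.
have un n : u n <= t by rewrite ler_pdivrMr// ler_peMr ?(ltW t0)// ler1n.
have us n : `|u n| < s by rewrite gtr0_norm// (le_lt_trans (un n)).
have us' n : `|- u n| < s by rewrite normrN.
have ts1 : `|t| < s by rewrite gtr0_norm.
have ts2 : `|- t| < s by rewrite normrN.
have E1 n : Cint (rayfun f a t) = Cint (rayfun f a (u n)).
  by apply: (rayfun_constant af) => //; rewrite mulr_gt0.
have E2 n : Cint (rayfun f a (- t)) = Cint (rayfun f a (- u n)).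
  by apply: (rayfun_constant af) => //; rewrite mulrNN mulr_gt0.
have un0 : u @ \oo --> (0 : R).
  have := @cvg_harmonic R; move=> /(cvgM (@cvg_cst _ t _ \oo _)).
  by rewrite mulr0; exact.
have nz n : u n != 0 by rewrite gt_eqF.
have nz' n : - u n != 0 by rewrite oppr_eq0.
have H (c : R[i]) : normc c = 1 -> (forall n, \int[mu]_(r in ray) complex.Re (c * rayfun f a (- u n) r) -
     \int[mu]_(r in ray) complex.Re (c * rayfun f a (u n) r) =
     \int[mu]_(r in ray) complex.Re (c * rayfun f a (- t) r) - \int[mu]_(r in ray) complex.Re (c * rayfun f a t r)) ->
  \int[mu]_(r in ray) complex.Re (c * rayfun f a (- t) r) = \int[mu]_(r in ray) complex.Re (c * rayfun f a t r).
  move=> c1 E; apply/eqP; rewrite -subr_eq0; apply/eqP.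
  apply: (@ray_limit_zero (fun n r => complex.Re (c * rayfun f a (- u n) r) - complex.Re (c * rayfun f a (u n) r)) (K + K) _ a).
  - move=> n r r0; have h1 := @rayfun_Re_continuous R s f c a _ r af (ltW sp) a0 r0 (us' n) (nz' n).
    have h2 := @rayfun_Re_continuous R s f c a _ r af (ltW sp) a0 r0 (us n) (nz n).
    exact: (cvgB h1 h2).
  - move=> n r r0; rewrite (le_trans (ler_normB _ _))// mulrDl lerD// (le_trans (Re_normc _))// normcM c1 mul1r hK//.
  - move=> r r0 ra; have [d hd] := rayfun_curve_angle af s0 r0 ra.
    have cc := itcurve_continuous_Re (curve_mulc c hd).
    rewrite -(subrr (complex.Re (c * rayfun f a 0 r))); apply: cvgB.
      apply: (@cvg_comp _ _ _ (fun n => - u n) (fun t : R => complex.Re (c * rayfun f a t r)) _ _ _ _ cc).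
      by have := cvgN un0; rewrite oppr0; exact.
    exact: (@cvg_comp _ _ _ u (fun t : R => complex.Re (c * rayfun f a t r)) _ _ _ un0 cc).
  - move=> n; rewrite RintegralB; first exact: E.
    + exact: measurable_ray.
    + exact: (rayfun_Re_integrable c af (ltW sp) a0 (us' n) (nz' n)).
    + exact: (rayfun_Re_integrable c af (ltW sp) a0 (us n) (nz n)).
have R1 (v : R) : \int[mu]_(r in ray) complex.Re (1 * rayfun f a v r) = complex.Re (Cint (rayfun f a v)).
  by apply: eq_Rintegral => r _; rewrite mul1r.
have R2 (v : R) : \int[mu]_(r in ray) complex.Re (- 'i%C * rayfun f a v r) = complex.Im (Cint (rayfun f a v)).
  by apply: eq_Rintegral => r _; case: (rayfun f a v r) => x y /=; ring.
have i1 : normc (- 'i%C : R[i]) = 1 by rewrite /= oppr0 sqrrN expr0n expr1n add0r sqrtr1.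
apply/eqP; rewrite eq_complex; apply/andP; split; apply/eqP.
  by have := H 1 (normc_nat R 1); rewrite !R1; apply => n; rewrite !R1 -E1 -E2.
by have := H _ i1; rewrite !R2; apply => n; rewrite !R2 -E1 -E2.
Qed.

Lemma integrable_peak (c : R) : 0 < c ->
  mu.-integrable ray (EFin \o (fun r : R => 8 * (c * r) ^+ 2 / (1 + (c * r) ^+ 2) ^+ 2)).
Proof.
move=> c0; have q0 (r : R) : 0 < 1 + (c * r) ^+ 2 by rewrite ltr_wpDr ?sqr_ge0.
have cr (r : R) : {for r, continuous (fun r : R => (c * r) ^+ 2)}.
  apply: (@cvg_comp _ _ _ (fun x : R => c * x) (fun x : R => x ^+ 2)); last exact: exprn_continuous.
  by apply: cvgM; [exact: cvg_cst|exact: cvg_id].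
apply: (@integrable_ray _ _ (16 * (1 + c^-1) ^+ 2)) => r r0.
  apply: cvgM; first by apply: cvgM; [exact: cvg_cst|exact: cr].
  apply: cvgV; first by rewrite expf_neq0// gt_eqF.
  apply: (@cvg_comp _ _ _ (fun x : R => 1 + (c * x) ^+ 2) (fun x : R => x ^+ 2)); last exact: exprn_continuous.
  by apply: cvgD; [exact: cvg_cst|exact: cr].
have ic : 0 < c^-1 by rewrite invr_gt0.
have := maj_dilation ic r0; rewrite invrK mulrC => h; rewrite -[leRHS]mulrA.
apply: le_trans (ler_wpM2l _ h) => //; have x0 : 0 < c * r by rewrite mulr_gt0.
move: (c * r) (q0 r) x0 {h} => x q x0.
rewrite ger0_norm; last first.
  by apply: divr_ge0; [apply: mulr_ge0 => //|]; exact: sqr_ge0.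
rewrite /majorant ler_pdivlMr ?exprn_gt0 ?addr_gt0// mulrAC ler_pdivrMr ?exprn_gt0//.
have : (1 + x) ^+ 2 <= 2 * (1 + x ^+ 2) by have := sqr_ge0 (1 - x); clear; nra.
have := sqr_ge0 x; have := sqr_ge0 (1 + x); move: (x ^+ 2) ((1 + x) ^+ 2) => y z; clear; nra.
Qed.

(** The source of the constant 2 pi in Cauchy's formula: up to scaling and a factor i, the integrand
    is the jump of the Cauchy integrand of [peak a] between the angles -pi/2 and pi/2. *)
Lemma Rintegral_peak : \int[mu]_(r in ray) (8 * r ^+ 2 / (1 + r ^+ 2) ^+ 2) = 2 * pi.
Proof.
pose F (r : R) : R := 4 * atan r - 4 * (r * (1 + r ^+ 2)^-1).
have q0 (r : R) : 0 < 1 + r ^+ 2 by rewrite ltr_wpDr ?sqr_ge0.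
have nz (r : R) : 1 + r ^+ 2 != 0 by rewrite gt_eqF.
have dF (r : R) : is_derive r 1 F (8 * r ^+ 2 / (1 + r ^+ 2) ^+ 2).
  have d0 : is_derive r 1 (fun r : R => 1 + r ^+ 2) (r *+ 2).
    apply: is_derive_eq; rewrite add0r; rewrite /GRing.scale /=; ring.
  have d1 := @is_deriveV _ (fun r : R => 1 + r ^+ 2) _ _ _ (nz r) d0.
  apply: is_derive_eq; rewrite /GRing.scale /=; field; exact: nz.
have cF (r : R) : {for r, continuous F} by exact: is_derive_continuous_real (dF r).
pose w (r : R) : R := 8 * r ^+ 2 / (1 + r ^+ 2) ^+ 2.
have cw (r : R) : {for r, continuous w}.
  apply: cvgM; first by apply: cvgM; [exact: cvg_cst|exact: exprn_continuous].
  apply: cvgV; first by rewrite expf_neq0.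
  apply: (@cvg_comp _ _ _ (fun x : R => 1 + x ^+ 2) (fun x : R => x ^+ 2)); last exact: exprn_continuous.
  by apply: cvgD; [exact: cvg_cst|exact: exprn_continuous].
have w0 (r : R) : 0 <= w r by apply: divr_ge0; [apply: mulr_ge0 => //|]; exact: sqr_ge0.
rewrite -/w Rintegral_itv_obnd_cbnd; last first.
  by have := integrable_peak ltr01; under eq_fun do rewrite mul1r.
rewrite (@Rintegral_ge0_continuous_FTC2y _ w F 0 (2 * pi)).
- by rewrite /F atan0 mul0r !mulr0 !subr0.
- by move=> r _; exact: w0.
- apply/continuous_within_itvcyP; split; first by move=> r _; exact: cw.
  by apply: cvg_at_right_filter; exact: cw.
- have -> : 2 * pi = 4 * (pi / 2) - 4 * 0 :> R by lra.
  apply: cvgB; apply: cvgM; [exact: cvg_cst|exact: cvgy_atan|exact: cvg_cst|].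
  have i0 : (fun r : R => r^-1) @ +oo%R --> (0 : R).
    apply/gtr0_cvgV0; last exact: cvg_id.
    by exists 0; split; [exact: num_real|].
  apply: (@squeeze_cvgr _ _ _ _ (fun=> 0) (fun r => r^-1)) => //; last exact: cvg_cst.
  exists 0; split; first exact: num_real.
  move=> r r0; rewrite divr_ge0 ?(ltW r0) ?(ltW (q0 r))//= ler_pdivrMr//.
  by rewrite mulrC ler_pdivlMr//; nra.
- by move=> r _; have [] := dF r.
- by apply: cvg_at_right_filter; exact: cF.
- by move=> r _; rewrite derive1E; have [_ ->] := dF r.
Qed.

Lemma ray_ReM s f (c : R[i]) (a t : R) : adm s f -> s <= pi -> 0 < a -> `|t| < s -> t != 0 ->
  \int[mu]_(r in ray) complex.Re (c * rayfun f a t r) = complex.Re (c * Cint (rayfun f a t)).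
Proof.
move=> af sp a0 ts t0.
have i1 : mu.-integrable ray (EFin \o (fun r => complex.Re (rayfun f a t r))).
  by have := rayfun_Re_integrable 1 af sp a0 ts t0; under eq_fun do rewrite mul1r.
have i2 : mu.-integrable ray (EFin \o (fun r => complex.Im (rayfun f a t r))).
  have := rayfun_Re_integrable (- 'i%C) af sp a0 ts t0; congr (mu.-integrable ray (EFin \o _)).
  by apply/funext => r; case: (rayfun f a t r) => x y /=; ring.
have j1 (x : R) u : mu.-integrable ray (EFin \o u) -> mu.-integrable ray (EFin \o (fun r => x * u r)).
  by move=> iu; exact: (integrableZl (@measurable_ray R) x iu).
case: c => x y.
rewrite (_ : complex.Re _ = x * \int[mu]_(r in ray) complex.Re (rayfun f a t r) -
   y * \int[mu]_(r in ray) complex.Im (rayfun f a t r)) //.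
rewrite -(RintegralZl x (@measurable_ray R) i1) -(RintegralZl y (@measurable_ray R) i2).
rewrite -(RintegralB (@measurable_ray R) (j1 x _ i1) (j1 y _ i2)).
by apply: eq_Rintegral => r _; case: (rayfun f a t r).
Qed.

Lemma ReD (x y : R[i]) : complex.Re (x + y) = complex.Re x + complex.Re y.
Proof. by case: x y => ? ? [? ?]. Qed.

Lemma Cint_rayfun_lin s (c : R[i]) f g (a t : R) : adm s f -> adm s g -> s <= pi -> 0 < a ->
  `|t| < s -> t != 0 ->
  Cint (rayfun (fun l => c * f l + g l) a t) = c * Cint (rayfun f a t) + Cint (rayfun g a t).
Proof.
move=> af ag sp a0 ts t0; have ah := adm_lin c af ag.
have H (d : R[i]) : complex.Re (d * Cint (rayfun (fun l => c * f l + g l) a t)) =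
    complex.Re (d * (c * Cint (rayfun f a t) + Cint (rayfun g a t))).
  rewrite -(ray_ReM d ah sp a0 ts t0) mulrDr mulrA.
  rewrite [RHS](_ : _ = complex.Re (d * c * Cint (rayfun f a t)) + complex.Re (d * Cint (rayfun g a t))); last first.
    exact: ReD.
  rewrite -(ray_ReM (d * c) af sp a0 ts t0) -(ray_ReM d ag sp a0 ts t0).
  rewrite -(RintegralD (@measurable_ray R) (rayfun_Re_integrable (d * c) af sp a0 ts t0) (rayfun_Re_integrable d ag sp a0 ts t0)).
  apply: eq_Rintegral => r _; rewrite (_ : d * _ = d * c * rayfun f a t r + d * rayfun g a t r).
    exact: ReD.
  by rewrite /rayfun; ring.
apply/eqP; rewrite eq_complex; apply/andP; split; apply/eqP.
  by have := H 1; rewrite !mul1r.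
have e (z : R[i]) : complex.Re (- 'i%C * z) = complex.Im z by case: z => x y /=; ring.
by have := H (- 'i%C); rewrite !e.
Qed.

(** Meant for the imaginary powers, which do not decay at 0 and at infinity. A derivative of order
    1/r is what keeps products with admissible functions admissible. *)
Definition multiplier (s : R) (h : R[i] -> R[i]) := exists (h' : R[i] -> R[i]) (B : R),
  forall r t : R, 0 < r -> `|t| < s ->
  [/\ is_derive (r%:C * cis t : C) 1 (h : C -> C) (h' (r%:C * cis t)),
      normc (h (r%:C * cis t)) <= B & normc (h' (r%:C * cis t)) <= B / r].

Lemma adm_mul s h f : multiplier s h -> adm s f -> adm s (fun l => h l * f l).
Proof.
move=> [h' [B hh]] [f' [K hf]]; exists (fun l => h l * f' l + f l * h' l), (2 * `|B| * `|K|) => r t r0 ts.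
have [a1 a2 a3] := hh _ _ r0 ts; have [b1 b2 b3] := hf _ _ r0 ts.
have m0 := maj_ge0 r; have rm : 0 <= r * maj r by rewrite mulr_ge0// ltW.
have {}a2 := le_trans a2 (ler_norm B).
have {}a3 := le_trans a3 (ler_wpM2r (ltac:(by rewrite invr_ge0 ltW) : 0 <= r^-1) (ler_norm B)).
have {}b2 := le_trans b2 (ler_wpM2r rm (ler_norm K)).
have {}b3 := le_trans b3 (ler_wpM2r m0 (ler_norm K)).
split; first exact: complex_deriveM.
- rewrite normcM; apply: (le_trans (ler_pM (normc_ge0 _) (normc_ge0 _) a2 b2)).
  have -> : 2 * `|B| * `|K| * (r * maj r) = 2 * (`|B| * (`|K| * (r * maj r))) by ring.
  have : 0 <= `|B| * (`|K| * (r * maj r)) by apply: mulr_ge0 => //; exact: mulr_ge0.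
  by move: (`|B| * _) => x; clear; lra.
- rewrite (le_trans (normcD _ _))// !normcM.
  have -> : 2 * `|B| * `|K| * maj r = `|B| * (`|K| * maj r) + `|K| * (r * maj r) * (`|B| / r).
    by field; rewrite gt_eqF.
  by apply: lerD; apply: ler_pM => //; exact: normc_ge0.
Qed.

Lemma adm_multiplier s f : adm s f -> multiplier s f.
Proof.
move=> [f' [K h]]; exists f', `|K| => r t r0 ts; have [h1 h2 h3] := h _ _ r0 ts.
have m0 := maj_ge0 r.
have r1 : r * maj r <= 1.
  rewrite /majorant ler_pdivrMr ?exprn_gt0 ?addr_gt0// mul1r.
  by have := sqr_ge0 r; clear -r0; nra.
have r2 : maj r <= r^-1 by rewrite -[leRHS]mul1r ler_pdivlMr// mulrC.
split=> //.
  rewrite (le_trans h2)// (le_trans (ler_wpM2r _ (ler_norm K))) ?mulr_ge0 ?(ltW r0)//.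
  by rewrite ler_piMr.
rewrite (le_trans h3)// (le_trans (ler_wpM2r m0 (ler_norm K)))//.
by rewrite ler_wpM2l.
Qed.

Lemma adm0 (s : R) : @adm R s (fun=> 0).
Proof.
exists (fun=> 0), 0 => r t r0 ts; split; rewrite ?normc0 ?mul0r//.
exact: is_derive_cst.
Qed.

Lemma adm_scale s (c : R[i]) f : adm s f -> adm s (fun l => c * f l).
Proof.
by move=> af; have := adm_lin c af (adm0 s); under eq_fun do rewrite addr0.
Qed.

Lemma adm_regularizer (s : R) : 0 < s < pi -> adm s (@regularizer R).
Proof.
move=> /andP[s0 sp].
pose k := aperture s; have k0 : 0 < k by rewrite aperture_gt0// (ltW s0).
exists (fun l => (1 - l) * ((1 + l) ^+ 3)^-1), (k ^- 2 + k ^- 3) => r t r0 ts.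
have lb : k * (r + 1) <= normc (1 + r%:C * cis t).
  by rewrite [1 + _]addrC; exact: (aperture_polarD (ltW r0) ler01 (ltW ts) (ltW sp)).
have nl := normc_polar t (ltW r0); move: (r%:C * cis t) lb nl => l lb nl.
have r1 : 0 < r + 1 by rewrite addr_gt0.
have kr : 0 < k * (r + 1) by rewrite mulr_gt0.
have n0 : 0 < normc (1 + l) := lt_le_trans kr lb.
have nz : 1 + l != 0 by apply: contraTneq n0 => ->; rewrite normc0 ltxx.
have k2 : 0 < k ^- 2 by rewrite invr_gt0 exprn_gt0.
have k3 : 0 < k ^- 3 by rewrite invr_gt0 exprn_gt0.
have e3 : normc (1 + l) ^- 3 <= k ^- 3 * (r + 1) ^- 3.
  rewrite -invfM -exprMn lef_pV2 ?posrE ?exprn_gt0//.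
  by rewrite ler_pXn2r ?nnegrE ?normc_ge0// ltW.
have e2 : normc (1 + l) ^- 2 <= k ^- 2 * (r + 1) ^- 2.
  rewrite -invfM -exprMn lef_pV2 ?posrE ?exprn_gt0//.
  by rewrite ler_pXn2r ?nnegrE ?normc_ge0// ltW.
split.
- have d1 : is_derive (l : C) 1 (fun w : C => 1 + w : C) 1.
    by have := is_deriveD (is_derive_cst (1 : C) (l : C) 1) (is_derive_id (l : C) 1); rewrite add0r.
  have d2 := complex_deriveM d1 d1.
  have nz2 : (1 + l) * (1 + l) != 0 by rewrite mulf_neq0.
  have := complex_deriveM (is_derive_id (l : C) 1) (@complex_deriveV _ (fun w : C => (1 + w) * (1 + w)) _ _ nz2 d2).
  by congr (is_derive _ _ _ _); field; exact: nz.
- rewrite /regularizer normcM normcV normcX nl /majorant (addrC 1 r).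
  rewrite (le_trans (ler_wpM2l (ltW r0) e2))// mulrCA ler_wpM2r ?lerDl ?(ltW k3)//.
  by rewrite mulr_ge0 ?(ltW r0)// invr_ge0 sqr_ge0.
- rewrite normcM normcV normcX.
  have h1 : normc (1 - l) <= r + 1.
    have n1 : normc (1 : R[i]) = 1 := normc_nat R 1.
    by have := normcD 1 (- l); rewrite normc_opp nl n1 (addrC r).
  rewrite (le_trans (ler_pM (normc_ge0 _) _ h1 e3)) ?invr_ge0 ?exprn_ge0 ?normc_ge0//.
  have -> : (r + 1) * (k ^- 3 * (r + 1) ^- 3) = k ^- 3 * maj r.
    by rewrite /majorant; field; rewrite !gt_eqF// addrC.
  by rewrite ler_wpM2r ?maj_ge0// lerDr ltW.
Qed.

Definition cpow (u : R) (l : R[i]) : R[i] := cexp (u%:C * 'i%C * clog l).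

Lemma multiplier_cpow (s u : R) : s <= pi -> multiplier s (cpow u).
Proof.
move=> sp; pose E := expR (`|u| * pi).
have E0 : 0 <= E := expR_ge0 _.
exists (fun l => cpow u l * (u%:C * 'i%C * l^-1)), (E + E * `|u|) => r t r0 ts.
have tp : `|t| < pi := lt_le_trans ts sp.
have ct : carg (r%:C * cis t) = t.
  by apply: carg_polar => //; move: tp; rewrite ltr_norml => /andP[-> /ltW ->].
have sl : 0 < normc (r%:C * cis t) + complex.Re (r%:C * cis t).
  by have [] := slit_carg (polar_neq0 t r0) (ltac:(by rewrite ct)).
have nE : normc (cpow u (r%:C * cis t)) <= E.
  rewrite /cpow normc_cexp ler_expR /clog ct /=.
  rewrite (_ : _ - _ = - (u * t)); last by ring.
  rewrite (le_trans (ler_norm _))// normrN normrM ler_wpM2l// ltW//.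
split.
- have := complex_derive_comp (complex_derive_comp (clog_derive sl) (is_derive_linear (u%:C * 'i%C) _)) (cexp_derive _).
  exact.
- by rewrite (le_trans nE)// lerDl mulr_ge0.
- rewrite normcM [X in _ * X]normcM [X in _ * (X * _)]normcM normcV normc_polar ?(ltW r0)// normc_real.
  rewrite (_ : normc 'i%C = 1) ?mulr1; last by rewrite /= expr0n expr1n add0r sqrtr1.
  rewrite mulrA ler_wpM2r ?invr_ge0 ?(ltW r0)//.
  by rewrite (le_trans (ler_wpM2r _ nE))// lerDr.
Qed.

Lemma adm_regularizer_cpow (s u : R) (n : nat) : 0 < s < pi -> (0 < n)%N ->
  adm s (fun l => regularizer l ^+ n * cpow u l).
Proof.
move=> sp n0; have ar := adm_regularizer sp.
have H : adm s (fun l => cpow u l * regularizer l).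
  by apply: adm_mul ar; apply: multiplier_cpow; case/andP: sp => _ /ltW.
elim: n n0 => // -[|n] ih _.
  by move: H; congr adm; apply/funext => l; rewrite expr1 mulrC.
move: (adm_mul (adm_multiplier ar) (ih isT)); congr adm; apply/funext => l.
by rewrite [in RHS]exprS mulrA.
Qed.

Lemma cpow0 (l : R[i]) : cpow 0 l = 1.
Proof.
rewrite /cpow !mul0r /cexp /= expR0 mul1r /cis cos0 sin0.
by apply/eqP; rewrite eq_complex /= !eqxx.
Qed.

Lemma adm_regularizerX (s : R) (n : nat) : 0 < s < pi -> (0 < n)%N ->
  adm s (fun l => regularizer l ^+ n).
Proof.
move=> sp n0; have := adm_regularizer_cpow 0 sp n0.
by under eq_fun do rewrite cpow0 mulr1.
Qed.

Lemma adm_H0inf (s : R) f : s <= pi -> adm s f -> H0inf s f.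
Proof.
move=> sp [f' [K h]]; split.
  by move=> z /sectorP[r [t [r0 ts ->]]]; have [[]] := h _ _ r0 ts.
exists (`|K| + 1), 1; split=> //.
move=> z /sectorP[r [t [r0 ts ->]]]; have [_ h2 _] := h _ _ r0 ts.
rewrite (normc_polar t (ltW r0)) powRr1 ?(ltW r0)// mulr1 powR_mulrn ?addr_ge0 ?(ltW r0)//.
rewrite (le_trans h2)// -mulrA ler_wpM2r//; first by rewrite mulr_ge0 ?(ltW r0)// maj_ge0.
by rewrite (le_trans (ler_norm K))// lerDl.
Qed.

(** On the positive axis the regularizer has maximum 1/4, attained at 1; the factor 4 normalizes the
    value at [a] to 1. *)
Definition peak (a : R) (l : R[i]) : R[i] := 4%:R * regularizer (l / a%:C).

Lemma adm_peak (s a : R) : 0 < s < pi -> 0 < a -> adm s (peak a).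
Proof.
by move=> sp a0; apply: adm_scale; apply: (adm_dilation a0); exact: adm_regularizer.
Qed.

Lemma peak1 (a : R) : 0 < a -> peak a a%:C = 1.
Proof.
move=> a0; have an : a%:C != 0 :> R[i] by apply: contra (lt0r_neq0 a0) => /eqP[->].
by rewrite /peak /regularizer divff//; field.
Qed.

Lemma rayfun_peak (a r : R) : 0 < a -> 0 < r ->
  rayfun (peak a) a (- (pi / 2)) r - rayfun (peak a) a (pi / 2) r =
  0 +i* (8 * (a^-1 * r) ^+ 2 / (1 + (a^-1 * r) ^+ 2) ^+ 2 / a).
Proof.
move=> a0 r0.
have c1 : cis (pi / 2) = 'i%C :> R[i] by rewrite /cis cos_pihalf sin_pihalf.
have c2 : cis (- (pi / 2)) = - 'i%C :> R[i].
  by rewrite /cis cosN sinN cos_pihalf sin_pihalf; apply/eqP; rewrite eq_complex /= oppr0 !eqxx.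
rewrite /rayfun /peak /regularizer c1 c2.
have ii : 'i%C * 'i%C = -1 :> R[i] by rewrite -expr2 sqr_i.
have an : a%:C != 0 :> R[i] by apply: contra (lt0r_neq0 a0) => /eqP[->].
have -> : 0 +i* (8 * (a^-1 * r) ^+ 2 / (1 + (a^-1 * r) ^+ 2) ^+ 2 / a) =
   'i%C * (8%:R * (a%:C^-1 * r%:C) ^+ 2 / (1 + (a%:C^-1 * r%:C) ^+ 2) ^+ 2 / a%:C).
  rewrite -(rmorph1 (real_complex R)) -(rmorph_nat (real_complex R) 8) -!(rmorphM, fmorphV, rmorphXn, rmorphD) /=.
  by apply/eqP; rewrite eq_complex /=; apply/andP; split; apply/eqP; ring.
have u0 : a%:C + 'i%C * r%:C != 0.
  by apply: contra (lt0r_neq0 a0) => /eqP[/= + _]; rewrite !mul0r mul1r subr0 addr0 => ->.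
have v0 : a%:C - 'i%C * r%:C != 0.
  by apply: contra (lt0r_neq0 a0) => /eqP[/= + _]; rewrite !mul0r mul1r !subr0 => ->.
have uv : (a%:C + 'i%C * r%:C) * (a%:C - 'i%C * r%:C) = a%:C ^+ 2 + r%:C ^+ 2.
  by transitivity (a%:C ^+ 2 - ('i%C * 'i%C) * r%:C ^+ 2); [ring|rewrite ii; ring].
move: (a%:C) (r%:C) an u0 v0 uv => {a0 r0}a {}r an u0 v0 uv.
have d0 : a ^+ 2 + r ^+ 2 != 0 by rewrite -uv mulf_neq0.
have e1 : r * 'i%C - a = - (a - 'i%C * r) by ring.
have e2 : r * - 'i%C - a = - (a + 'i%C * r) by ring.
have e3 : 1 + r * 'i%C / a = (a + 'i%C * r) / a by field.
have e4 : 1 + r * - 'i%C / a = (a - 'i%C * r) / a by field.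
rewrite e1 e2 e3 e4.
have -> : 1 + (a^-1 * r) ^+ 2 = (a + 'i%C * r) * (a - 'i%C * r) / a ^+ 2.
  by rewrite uv; field.
have w : a + 'i%C * r - (a - 'i%C * r) = 2%:R * 'i%C * r by ring.
move: (a + 'i%C * r) (a - 'i%C * r) u0 v0 w {uv e1 e2 e3 e4} => u v u0 v0 w.
transitivity (- ('i%C * 'i%C) * (4%:R * a * r) * (u - v) / (u * v) ^+ 2).
  by field; rewrite ?u0 ?v0 ?an.
rewrite w ii; field; by rewrite ?u0 ?v0 ?an.
Qed.

Lemma cauchy_peak (s a t : R) : s < pi -> 0 < a -> 0 < t < s ->
  Cint (rayfun (peak a) a (- t)) - Cint (rayfun (peak a) a t) = 2 * pi%:C * 'i%C.
Proof.
move=> sp a0 /andP[t0 ts].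
(* The sector is enlarged beyond pi/2, [peak a] being admissible on every sector smaller than the
   slit plane. The rays can then be turned to the imaginary axis, where the integrand is
   explicit. *)
pose s2 := Num.max s (3 * pi / 4).
have p0 := pi_gt0 R.
have s2p : s2 < pi by rewrite gt_max sp /=; lra.
have h2 : pi / 2 < s2 by rewrite lt_max; apply/orP; right; lra.
have ts2 : t < s2 by rewrite lt_max ts.
have s20 : 0 < s2 < pi by rewrite s2p andbT (lt_trans t0 ts2).
have p2 : 0 < pi / 2 :> R by rewrite divr_gt0.
have ab := adm_peak s20 a0.
have n1 : `|t| < s2 by rewrite gtr0_norm.
have n2 : `|pi / 2 : R| < s2 by rewrite gtr0_norm.
have n1' : `|- t| < s2 by rewrite normrN.
have n2' : `|- (pi / 2) : R| < s2 by rewrite normrN.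
rewrite (rayfun_constant ab s2p a0 n1 n2 (mulr_gt0 t0 p2)).
rewrite (rayfun_constant ab s2p a0 n1' n2' (ltac:(by rewrite mulrNN mulr_gt0))).
have pz : pi / 2 != 0 :> R by rewrite gt_eqF.
have pz' : - (pi / 2) != 0 :> R by rewrite oppr_eq0.
have M (c : R[i]) : complex.Re (c * (Cint (rayfun (peak a) a (- (pi / 2))) - Cint (rayfun (peak a) a (pi / 2)))) =
   \int[mu]_(r in ray) complex.Re (c * (0 +i* (8 * (a^-1 * r) ^+ 2 / (1 + (a^-1 * r) ^+ 2) ^+ 2 / a))).
  rewrite mulrBr ReB -(ray_ReM c ab (ltW s2p) a0 n2 pz) -(ray_ReM c ab (ltW s2p) a0 n2' pz').
  rewrite -(RintegralB (@measurable_ray R) (rayfun_Re_integrable c ab (ltW s2p) a0 n2' pz') (rayfun_Re_integrable c ab (ltW s2p) a0 n2 pz)).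
  apply: eq_Rintegral => r /[1!inE] /rayP r0.
  by rewrite -rayfun_peak// mulrBr ReB.
apply/eqP; rewrite eq_complex; apply/andP; split; apply/eqP.
  have := M 1; rewrite mul1r => ->.
  transitivity (\int[mu]_(r in ray) (0 : R)); first by apply: eq_Rintegral => r _; rewrite mul1r.
  rewrite Rintegral_cst ?mul0r//; last exact: measurable_ray.
  by rewrite /= ; ring.
have e (z : R[i]) : complex.Re (- 'i%C * z) = complex.Im z by case: z => x y /=; ring.
rewrite -e M.
have iw : mu.-integrable ray (EFin \o (fun r : R => 8 * r ^+ 2 / (1 + r ^+ 2) ^+ 2)).
  by have := integrable_peak ltr01; under eq_fun do rewrite mul1r.
have ia : 0 < a^-1 by rewrite invr_gt0.
transitivity (\int[mu]_(r in ray) (a^-1 * (8 * (a^-1 * r) ^+ 2 / (1 + (a^-1 * r) ^+ 2) ^+ 2))).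
  by apply: eq_Rintegral => r _; rewrite e /= mulrC.
rewrite -[RHS]/(complex.Im (2 * pi%:C * 'i%C)).
have iw2 : mu.-integrable ray (EFin \o (fun r : R => 8 * (a^-1 * r) ^+ 2 / (1 + (a^-1 * r) ^+ 2) ^+ 2)).
  exact: integrable_peak.
rewrite (RintegralZl a^-1 (@measurable_ray R) iw2).
rewrite (Rintegral_scale ia iw) invrK mulrA mulVf ?gt_eqF// mul1r Rintegral_peak.
by rewrite /=; ring.
Qed.

(** The function f - f(a) * peak a vanishes at a, so its two ray integrals agree; the multiple of
    [peak a] supplies the right-hand side. *)
Theorem cauchy_formula s f (a t : R) : adm s f -> s < pi -> 0 < a -> 0 < t < s ->
  Cint (rayfun f a (- t)) - Cint (rayfun f a t) = 2 * pi%:C * 'i%C * f a%:C.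
Proof.
move=> af sp a0 ts; case/andP: (ts) => t0 ts'.
have s0 : 0 < s < pi by rewrite sp (lt_trans t0).
have ab := adm_peak s0 a0.
have n1 : `|t| < s by rewrite gtr0_norm.
have n2 : `|- t| < s by rewrite normrN.
have tz : t != 0 by rewrite gt_eqF.
have tz' : - t != 0 by rewrite oppr_eq0.
have := cauchy_zero (adm_lin (- f a%:C) ab af) sp a0 _ ts.
rewrite (Cint_rayfun_lin (- f a%:C) ab af (ltW sp) a0 n1 tz).
rewrite (Cint_rayfun_lin (- f a%:C) ab af (ltW sp) a0 n2 tz').
rewrite peak1// mulr1 addNr => /(_ erefl).
rewrite -(cauchy_peak sp a0 ts).
move: (Cint _) (Cint _) (Cint _) (Cint _) => w x y z h.
by apply/eqP; rewrite -subr_eq0; apply/eqP; transitivity (- f a%:C * z + y - (- f a%:C * x + w)); [ring|by rewrite h subrr].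
Qed.

End CauchyFormula.

(** * Bochner integrals of symbols *)

Section BochnerUniqueness.
Context d (T : measurableType d) (R : realType) (X : normedModType R[i]).
Variable mu : {measure set T -> \bar R}.
Implicit Types (s : seq (set T * X)) (D : set T).

Lemma cvg_rnormP (u : nat -> X) (y : X) : u @ \oo --> y <->
  forall e : R, 0 < e -> exists N, forall n, (N <= n)%N -> rnorm (y - u n) < e.
Proof.
split.
  move=> /cvgrPdist_lt h e e0.
  have /h[N _ hN] : (0 : R[i]) < e%:C by rewrite ltcR.
  exists N => n Nn; have := hN n Nn.
  by rewrite /= -rnormE ltcR.
move=> h; apply/cvgrPdist_lt => e /gt0_complex[e' e0 ->].
have [N hN] := h _ e0; exists N => // n /= Nn.
by rewrite -rnormE ltcR hN.
Qed.

Lemma simple_fun_cons (a : set T * X) s t :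
  simple_fun (a :: s) t = (\1_(a.1) t : R)%:C *: a.2 + simple_fun s t.
Proof. by rewrite /simple_fun big_cons. Qed.

Lemma simple_fun_in (a : set T * X) s t : a.1 t ->
  simple_fun (a :: s) t = a.2 + simple_fun s t.
Proof. by move=> at_; rewrite simple_fun_cons indicE mem_set// scale1r. Qed.

Lemma simple_fun_out (a : set T * X) s t : ~ a.1 t ->
  simple_fun (a :: s) t = simple_fun s t.
Proof. by move=> at_; rewrite simple_fun_cons indicE memNset// scale0r add0r. Qed.

Lemma measurable_rnorm_simple D (g : T -> X) s : measurable D ->
  (forall c, measurable_fun D (fun t => rnorm (g t - c))) ->
  (forall a, a \in s -> measurable a.1) ->
  measurable_fun D (fun t => rnorm (g t - simple_fun s t)).
Proof.
move=> mD mg ms.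
suff H c : measurable_fun D (fun t => rnorm (g t - (c + simple_fun s t))).
  by have := H 0; under eq_fun do rewrite add0r.
elim: s ms c => [|[A v] s ih] ms c.
  have := mg c; congr measurable_fun; apply/funext => t.
  by rewrite /simple_fun big_nil addr0.
have mA : measurable A by have := ms (A, v) (mem_head _ _).
have ms' a : a \in s -> measurable a.1 by move=> as_; apply: ms; rewrite inE as_ orbT.
rewrite (_ : (fun t => _) = (fun t => \1_A t * rnorm (g t - (c + v + simple_fun s t)) +
    \1_(~` A) t * rnorm (g t - (c + simple_fun s t)))).
  apply: measurable_funD; apply: measurable_funM;
    by [apply: measurable_funTS; apply: measurable_indic => //; exact: measurableC | exact: ih].
apply/funext => t; have [tA|tA] := pselect (A t).
  rewrite simple_fun_in// indicE mem_set// mul1r indicE memNset; last by apply.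
  by rewrite mul0r addr0 addrA.
by rewrite simple_fun_out// indicE memNset// mul0r add0r indicE mem_set// mul1r.
Qed.

(** The sets of the list may overlap. Induction on the list, with [E] and [v] general, lets the
    first set cut E in two; on one part its vector is added to v. *)
Lemma simple_int_local s (E : set T) (v : X) : measurable E -> (mu E < +oo)%E ->
  (forall a, a \in s -> measurable a.1) ->
  ((rnorm ((fine (mu E))%:C *: v + \sum_(a <- s) (fine (mu (E `&` a.1)))%:C *: a.2))%:E <=
   \int[mu]_(t in E) (rnorm (v + simple_fun s t))%:E)%E.
Proof.
elim: s E v => [|[A w] s ih] E v mE fE ms.
  rewrite big_nil addr0 rnormZ normc_real ger0_norm ?fine_ge0//.
  under eq_integral do rewrite /simple_fun big_nil addr0.
  rewrite integral_cst//= EFinM fineK ?ge0_fin_numE//.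
  by rewrite muleC.
have mA : measurable A by have := ms (A, w) (mem_head _ _).
have ms' a : a \in s -> measurable a.1 by move=> as_; apply: ms; rewrite inE as_ orbT.
have mEA : measurable (E `&` A) by exact: measurableI.
have mED : measurable (E `&` ~` A) by apply: measurableI => //; exact: measurableC.
have fEA : (mu (E `&` A) < +oo)%E by apply: le_lt_trans fE; apply: le_measure; rewrite ?inE// => t [].
have fED : (mu (E `&` ~` A) < +oo)%E by apply: le_lt_trans fE; apply: le_measure; rewrite ?inE// => t [].
have h1 := ih _ (v + w) mEA fEA ms'; have h2 := ih _ v mED fED ms'.
have split_mu (F : set T) : measurable F -> (mu F < +oo)%E ->
    fine (mu F) = fine (mu (F `&` A)) + fine (mu (F `&` ~` A)).
  move=> mF fF; rewrite -fineD.
  - rewrite -measureU//; first by rewrite -setIUr setUv setIT.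
    + exact: measurableI.
    + by apply: measurableI => //; exact: measurableC.
    + by rewrite setIACA setICr setI0.
  - rewrite ge0_fin_numE//; apply: le_lt_trans fF; apply: le_measure; rewrite ?inE//; exact: measurableI.
  - rewrite ge0_fin_numE//; apply: le_lt_trans fF; apply: le_measure; rewrite ?inE//.
    by apply: measurableI => //; exact: measurableC.
rewrite big_cons /=.
have -> : (fine (mu E))%:C *: v + ((fine (mu (E `&` A)))%:C *: w + \sum_(a <- s) (fine (mu (E `&` a.1)))%:C *: a.2) =
   ((fine (mu (E `&` A)))%:C *: (v + w) + \sum_(a <- s) (fine (mu (E `&` A `&` a.1)))%:C *: a.2) +
   ((fine (mu (E `&` ~` A)))%:C *: v + \sum_(a <- s) (fine (mu (E `&` ~` A `&` a.1)))%:C *: a.2).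
  rewrite (split_mu E mE fE) rmorphD scalerDl scalerDr -!addrA; congr (_ + _).
  have aux (x y S1 S2 S3 : X) : S1 = S2 + S3 -> x + (y + S1) = y + (S2 + (x + S3)).
    by move=> ->; rewrite addrCA; congr (_ + _); rewrite addrCA.
  apply: aux; rewrite -big_split /=; apply: eq_big_seq => a as_; rewrite -scalerDl -rmorphD; congr (_%:C *: _).
  have mEa : measurable (E `&` a.1) by apply: measurableI => //; exact: ms'.
  rewrite (split_mu (E `&` a.1))//; first by rewrite !(setIAC E a.1).
  by apply: le_lt_trans fE; apply: le_measure; rewrite ?inE// => t [].
have ms0 : forall a, a \in (A, w) :: s -> measurable a.1 by [].
have mint : measurable_fun E (fun t => rnorm (v + simple_fun ((A, w) :: s) t)).
  have := @measurable_rnorm_simple E (fun=> - v) ((A, w) :: s) mE (fun c => measurable_cst _) ms.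
  by congr measurable_fun; apply/funext => t; rewrite -opprD rnormN.
have EU : E = (E `&` A) `|` (E `&` ~` A) by rewrite -setIUr setUv setIT.
have -> : (\int[mu]_(t in E) (rnorm (v + simple_fun ((A, w) :: s) t))%:E =
  \int[mu]_(t in E `&` A) (rnorm (v + w + simple_fun s t))%:E +
  \int[mu]_(t in E `&` ~` A) (rnorm (v + simple_fun s t))%:E)%E.
  rewrite [in LHS]EU ge0_integral_setU//.
  - congr (_ + _)%E; apply: eq_integral => t /[1!inE] -[_ tA].
      by rewrite simple_fun_in// addrA.
    by rewrite simple_fun_out.
  - by rewrite -EU; exact/measurable_EFinP.
  - by move=> t _; rewrite lee_fin rnorm_ge0.
  - by apply/disj_setPS => t [[_ ?] [_ ?]].
apply: le_trans (leeD h1 h2); rewrite -EFinD lee_fin; exact: rnormD.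
Qed.

Lemma simple_int_bound D s : measurable D ->
  (forall a, a \in s -> [/\ measurable a.1, a.1 `<=` D & (mu a.1 < +oo)%E]) ->
  ((rnorm (simple_int mu s))%:E <= \int[mu]_(t in D) (rnorm (simple_fun s t))%:E)%E.
Proof.
move=> mD hs; pose U : set T := \big[setU/set0]_(a <- s) a.1.
have ms a : a \in s -> measurable a.1 by move=> /hs[].
have aU a : a \in s -> a.1 `<=` U.
  by move=> as_ t at_; rewrite /U -bigcup_seq; exists a.
have [mU fU UD] : [/\ measurable U, (mu U < +oo)%E & U `<=` D].
  rewrite /U; elim: s hs {ms aU U} => [|a s ih] hs.
    by rewrite big_nil; split; rewrite ?measure0 ?ltry//; exact: sub0set.
  have [ma aD fa] := hs a (mem_head _ _).
  have [|h1 h2 h3] := ih; first by move=> b bs; apply: hs; rewrite inE bs orbT.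
  rewrite big_cons; split; [exact: measurableU| |by move=> t [/aD|/h3]].
  by apply: le_lt_trans (measureU2 _ _ _) _ => //; exact: lte_add_pinfty.
have := @simple_int_local s U 0 mU fU ms; rewrite scaler0 add0r.
have -> : \sum_(a <- s) (fine (mu (U `&` a.1)))%:C *: a.2 = simple_int mu s.
  by apply: eq_big_seq => a as_; rewrite (setIidr (aU _ as_)).
move=> h; apply: le_trans h _.
under eq_integral do rewrite add0r.
apply: ge0_subset_integral => //.
have := @measurable_rnorm_simple D (fun=> 0) s mD (fun c => measurable_cst _) ms.
move=> h; apply/measurable_EFinP; move: h.
  by congr measurable_fun; apply/funext => t; rewrite sub0r rnormN.
by move=> t _; rewrite lee_fin rnorm_ge0.
Qed.

(** The difference of two approximating simple functions is again given by a list, and the norm of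
    its integral is at most the sum of the two L_1 errors. *)
Lemma bochner_int_unique D (g : T -> X) (y z : X) : measurable D ->
  is_bochner_int mu D g y -> is_bochner_int mu D g z -> y = z.
Proof.
move=> mD [s [hs ms is_ cs]] [s' [hs' ms' is' cs']].
apply/eqP; rewrite -subr_eq0; apply/eqP; apply: rnorm0_eq0.
apply/eqP; rewrite eq_le rnorm_ge0 andbT; apply/ler_addgt0Pr => e e0; rewrite add0r.
have e4 : 0 < e / 4 by rewrite divr_gt0.
have [N1 h1] := (cvg_rnormP _ _).1 cs _ e4.
have [N2 h2] := (cvg_rnormP _ _).1 cs' _ e4.
have near_int (u : nat -> \bar R) : u @ \oo --> 0%E -> exists N, forall n, (N <= n)%N -> (u n < (e / 4)%:E)%E.
  have he : nbhs (0 : \bar R)%E [set x | (x < (e / 4)%:E)%E].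
    by apply: open_nbhs_nbhs; split; [exact: open_ereal_lt_ereal|rewrite /= lte_fin].
  by move=> /(_ _ he)[N _ hN]; exists N.
have [N3 h3] := near_int _ is_.
have [N4 h4] := near_int _ is'.
pose n := (N1 + N2 + N3 + N4)%N.
have {}h1 := h1 n ltac:(by rewrite /n -!addnA leq_addr).
have {}h2 := h2 n ltac:(by rewrite /n -!addnA addnCA leq_addr).
have {}h3 := h3 n ltac:(by rewrite /n addnAC leq_addl).
have {}h4 := h4 n ltac:(by rewrite /n leq_addl).
pose t := s n ++ [seq (a.1, - a.2) | a <- s' n].
have E1 : simple_int mu t = simple_int mu (s n) - simple_int mu (s' n).
  rewrite /simple_int big_cat big_map /=; congr (_ + _).
  by rewrite -sumrN; apply: eq_bigr => a _; rewrite scalerN.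
have E2 x : simple_fun t x = simple_fun (s n) x - simple_fun (s' n) x.
  rewrite /simple_fun big_cat big_map /=; congr (_ + _).
  by rewrite -sumrN; apply: eq_bigr => a _; rewrite scalerN.
have ht a : a \in t -> [/\ measurable a.1, a.1 `<=` D & (mu a.1 < +oo)%E].
  rewrite mem_cat => /orP[/hs//|/mapP[b /hs' [? ? ?] ->]]; by split.
have := simple_int_bound mD ht; rewrite E1.
have mt : measurable_fun D (fun x => (rnorm (simple_fun t x))%:E).
  apply/measurable_EFinP; have := @measurable_rnorm_simple D (fun=> 0) t mD (fun c => measurable_cst _) (fun a ha => ltac:(by have [] := ht a ha)).
  by congr measurable_fun; apply/funext => x; rewrite sub0r rnormN.
move=> hb.
have hle : (\int[mu]_(x in D) (rnorm (simple_fun t x))%:E <=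
  \int[mu]_(x in D) (rnorm (g x - simple_fun (s n) x))%:E + \int[mu]_(x in D) (rnorm (g x - simple_fun (s' n) x))%:E)%E.
  rewrite -ge0_integralD//.
  - apply: ge0_le_integral => //.
    + by move=> x _; rewrite lee_fin rnorm_ge0.
    + by apply/measurable_EFinP; exact: measurable_funD.
    + move=> x _; rewrite -EFinD lee_fin E2.
      have -> : simple_fun (s n) x - simple_fun (s' n) x = (g x - simple_fun (s' n) x) - (g x - simple_fun (s n) x).
        by rewrite opprB [RHS]addrC addrA subrK.
      by rewrite [leRHS]addrC; exact: rnormB.
  - by move=> x _; rewrite lee_fin rnorm_ge0.
  - exact/measurable_EFinP.
  - by move=> x _; rewrite lee_fin rnorm_ge0.
  - exact/measurable_EFinP.
have : ((rnorm (simple_int mu (s n) - simple_int mu (s' n)))%:E < (e / 4 + e / 4)%:E)%E.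
  by apply: le_lt_trans hb _; apply: le_lt_trans hle _; rewrite EFinD; exact: lteD.
rewrite lte_fin => h5.
have -> : y - z = (y - simple_int mu (s n)) + (simple_int mu (s n) - simple_int mu (s' n)) - (z - simple_int mu (s' n)).
  by rewrite addrA subrK opprB addrA subrK.
have h6 := rnormB (y - simple_int mu (s n) + (simple_int mu (s n) - simple_int mu (s' n))) (z - simple_int mu (s' n)).
have h7 := rnormD (y - simple_int mu (s n)) (simple_int mu (s n) - simple_int mu (s' n)).
apply: (le_trans h6); move: h1 h2 h5 h7 e0; clear.
move: (rnorm _) (rnorm _) (rnorm _) (rnorm _) => a b c f; lra.
Qed.

Lemma bochner_intE D (g : T -> X) (y : X) : measurable D ->
  is_bochner_int mu D g y -> bochner_int mu D g = y.
Proof.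
move=> mD hy; apply: (bochner_int_unique mD _ hy).
by rewrite /bochner_int; apply: xgetPex; exists y.
Qed.

End BochnerUniqueness.

(** * Riemann sums as Bochner approximations *)

Section RiemannSums.
Variables (R : realType) (X : normedModType R[i]).
Local Notation C := (R[i]^o).
Local Notation mu := (@lebesgue_measure R).
Local Notation RR := (measurableTypeR R).
Local Notation ray := (@ray R).
Local Notation maj := (@majorant R).

Definition grid (k i : nat) : R := i.+1%:R / k.+1%:R.

Definition grid_itv (k i : nat) : set RR := `]i%:R / k.+1%:R, grid k i]%classic.

(** Mesh 1 / (k+1) on ]0, k+1], hence (k+1)^2 intervals. The nodes are right endpoints: they avoid
    0, and since the majorant decreases, its value at r also bounds the step function. *)
Definition riemann (g : R -> X) (k : nat) : seq (set RR * X) :=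
  [seq (grid_itv k i, g (grid k i)) | i <- index_iota 0 (k.+1 ^ 2)].

Lemma grid_itvP k i r : grid_itv k i r <-> i%:R < r * k.+1%:R <= i.+1%:R.
Proof.
rewrite /grid_itv /grid /= in_itv /= ltr_pdivrMr ?ltr0Sn//.
by rewrite ler_pdivlMr ?ltr0Sn.
Qed.

Lemma grid_gt0 k i : 0 < grid k i.
Proof. by rewrite divr_gt0// ltr0Sn. Qed.

Lemma nat_between (n : nat) (x : R) : 0 < x -> x <= n%:R ->
  exists2 i, (i < n)%N & i%:R < x <= i.+1%:R.
Proof.
elim: n => [|n ih] x0 xn; first by move: x0; rewrite ltNge xn.
case: (leP x n%:R) => h; last by exists n => //; rewrite h.
by have [i in_ hi] := ih x0 h; exists i => //; rewrite ltnW.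
Qed.

Lemma riemann_fun (g : R -> X) (k : nat) (r : R) : 0 < r ->
  (exists i, [/\ (i < k.+1 ^ 2)%N, grid_itv k i r & simple_fun (riemann g k) r = g (grid k i)]) \/
  (k.+1%:R < r /\ simple_fun (riemann g k) r = 0).
Proof.
move=> r0; have k0 : 0 < k.+1%:R :> R by rewrite ltr0Sn.
have E : simple_fun (riemann g k) r = \sum_(i < k.+1 ^ 2) (\1_(grid_itv k i) r : R)%:C *: g (grid k i).
  by rewrite /simple_fun /riemann big_map big_mkord.
case: (leP r k.+1%:R) => rk; [left|right].
  have [||i ik hi] := @nat_between (k.+1 ^ 2) (r * k.+1%:R).
  - by rewrite mulr_gt0.
  - by rewrite natrX expr2 ler_wpM2r// ltW.
  exists i; split => //; first exact/grid_itvP.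
  rewrite E (bigD1 (Ordinal ik))//= indicE mem_set ?scale1r; last exact/grid_itvP.
  rewrite big1 ?addr0// => j ji; rewrite indicE memNset ?scale0r// => /grid_itvP hj.
  case/andP: hi => i1 i2; case/andP: hj => j1 j2.
  have := lt_le_trans i1 j2; have := lt_le_trans j1 i2.
  rewrite !ltr_nat !ltnS => h1 h2; move: ji; rewrite -val_eqE /= => /eqP; apply.
  by apply/eqP; rewrite eqn_leq h1.
split=> //; rewrite E big1// => i _; rewrite indicE memNset ?scale0r// => /grid_itvP/andP[_].
rewrite leNgt (le_lt_trans (y := k.+1%:R * k.+1%:R)) ?ltr_pM2r//.
by move: (ltn_ord i) => hi; rewrite -natrM ler_nat mulnn.
Qed.

Lemma riemann_sets (g : R -> X) (k : nat) a : a \in riemann g k ->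
  [/\ measurable a.1, a.1 `<=` ray & (mu a.1 < +oo)%E].
Proof.
move=> /mapP[i _ ->] /=; split; first exact: measurable_itv.
  move=> r; rewrite /grid_itv /= in_itv /= => /andP[h _]; apply/rayP.
  by apply: le_lt_trans h; rewrite divr_ge0.
by rewrite lebesgue_measure_itv /=; case: ifP => // _; rewrite -EFinB ltry.
Qed.

Lemma riemann_int (g : R -> X) (k : nat) :
  simple_int mu (riemann g k) = \sum_(i < k.+1 ^ 2) (k.+1%:R^-1 : R)%:C *: g (grid k i).
Proof.
rewrite /simple_int /riemann big_map big_mkord.
apply: eq_bigr => i _; congr (_%:C *: _).
rewrite /= /grid_itv lebesgue_measure_itv /= lte_fin /grid.
rewrite ltr_pM2r ?invr_gt0 ?ltr0Sn// ltr_nat ltnSn -EFinB /=.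
by rewrite -mulrBl -natrB// subSnn mul1r.
Qed.

Variables (g : R -> X) (K : R).
Hypothesis gc : forall r e : R, 0 < r -> 0 < e ->
  exists2 h : R, 0 < h & forall u : R, 0 < u -> `|u - r| < h -> rnorm (g u - g r) < e.
Hypothesis gK : forall r : R, 0 < r -> rnorm (g r) <= K * maj r.

Let K0 : 0 <= K.
Proof. by have := le_trans (rnorm_ge0 _) (gK ltr01); rewrite pmulr_lge0 ?maj_gt0. Qed.

Lemma rnorm_dist (x y : X) : `|rnorm x - rnorm y| <= rnorm (x - y).
Proof.
have h1 := rnormD (x - y) y; have h2 := rnormD (y - x) x.
rewrite !subrK in h1 h2; rewrite (rdistC y x) in h2.
by rewrite ler_norml; lra.
Qed.

Lemma measurable_g (c : X) : measurable_fun ray (fun t : RR => rnorm (g t - c)).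
Proof.
apply: measurable_ray_continuous => r r0; apply/cvgrPdist_lt => e e0.
have [h h0 hh] := gc r0 e0.
have m0 : 0 < Num.min h r by rewrite lt_min h0.
exists (Num.min h r) => // u; rewrite /= lt_min => /andP[u1 u2].
have up : 0 < u by move: u2; rewrite ltr_norml => /andP[_]; lra.
apply: (le_lt_trans (rnorm_dist _ _)); rewrite opprB addrA subrK rdistC.
by apply: hh => //; rewrite distrC.
Qed.

Lemma maj_decr (r u : R) : 0 < r -> r <= u -> maj u <= maj r.
Proof.
move=> r0 ru; have u0 := lt_le_trans r0 ru.
rewrite /majorant lef_pV2 ?posrE ?exprn_gt0 ?addr_gt0//.
by rewrite ler_pXn2r ?nnegrE ?addr_ge0 ?(ltW r0) ?(ltW u0)// lerD2l.
Qed.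

Lemma riemann_L1 :
  (fun k => \int[mu]_(t in ray) (rnorm (g t - simple_fun (riemann g k) t))%:E)%E @ \oo --> 0%E.
Proof.
have mS k : measurable_fun ray (fun t : RR => (rnorm (g t - simple_fun (riemann g k) t))%:E).
  apply/measurable_EFinP; apply: measurable_rnorm_simple; first exact: measurable_ray.
  - by move=> c; exact: measurable_g.
  - by move=> a /riemann_sets[].
have [|||_ _] := @dominated_convergence _ RR R mu ray (@measurable_ray R)
   (fun k t => (rnorm (g t - simple_fun (riemann g k) t))%:E) (cst 0%E) (EFin \o (fun r : R => (2 * K) * maj r)) mS _ _ (integrable_Zmaj (2 * K)) _.
- exact: measurable_cst.
- apply: aeW => r /rayP r0; apply: cvg_EFin; first exact: nearW.
  apply/cvgrPdist_lt => e e0; have [h h0 hh] := gc r0 e0.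
  have [n hn] : exists n : nat, forall k, (n <= k)%N -> r <= k.+1%:R /\ k.+1%:R^-1 < h.
    exists (Num.truncn (r + h^-1)) => k nk.
    have lt : r + h^-1 < k.+1%:R.
      by apply: lt_le_trans (truncnS_gt _) _; rewrite ler_nat ltnS.
    have h1 : 0 < h^-1 by rewrite invr_gt0.
    split; first by rewrite (le_trans _ (ltW lt))// lerDl ltW.
    by rewrite -[h]invrK ltf_pV2 ?posrE ?ltr0Sn// (le_lt_trans _ lt)// lerDr ltW.
  exists n => // k /= /hn[rk kh]; rewrite sub0r normrN ger0_norm ?rnorm_ge0//.
  have [[i [_ /grid_itvP /andP[i1 i2] ->]]|[+ _]] := riemann_fun g k r0; last by rewrite ltNge rk.
  rewrite rdistC; apply: hh; first exact: grid_gt0.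
  have k0 : 0 < k.+1%:R :> R by rewrite ltr0Sn.
  have g1 : r <= grid k i by rewrite /grid ler_pdivlMr.
  have g2 : grid k i < r + k.+1%:R^-1.
    rewrite /grid ltr_pdivrMr// mulrDl mulVf ?gt_eqF//.
    by rewrite -natr1 ltrD2r.
  by rewrite ger0_norm ?subr_ge0// ltrBlDl (lt_trans g2)// ltrD2l.
- apply: aeW => r k /rayP r0; rewrite abse_EFin lee_fin ger0_norm ?rnorm_ge0//.
  rewrite (le_trans (rnormB _ _))// -mulrA mulr_natl mulr2n lerD ?gK//.
  have [[i [_ /grid_itvP /andP[i1 i2] ->]]|[_ ->]] := riemann_fun g k r0; last first.
    by rewrite rnorm0 mulr_ge0// ltW// maj_gt0.
  rewrite (le_trans (gK (grid_gt0 _ _)))// ler_wpM2l// maj_decr//.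
  by rewrite /grid ler_pdivlMr ?ltr0Sn.
by rewrite integral0; exact.
Qed.

(** Convergence of the sums is a hypothesis because the limit is known beforehand: for symbols it is
    found eigenvalue by eigenvalue. *)
Lemma riemann_bochner (y : X) :
  (fun k => \sum_(i < k.+1 ^ 2) (k.+1%:R^-1 : R)%:C *: g (grid k i)) @ \oo --> y ->
  is_bochner_int mu ray g y.
Proof.
move=> hy; exists (riemann g); split.
- by move=> k a; exact: riemann_sets.
- move=> k; apply: measurable_rnorm_simple; first exact: measurable_ray.
  + by move=> c; exact: measurable_g.
  + by move=> a /riemann_sets[].
- exact: riemann_L1.
- by under eq_fun do rewrite riemann_int.
Qed.

End RiemannSums.

Section ScalarIntegral.
Variable R : realType.
Local Notation C := (R[i]^o).

Lemma rnorm_scalar (z : C) : rnorm z = normc (z : R[i]).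
Proof. by rewrite /rnorm normr_normc. Qed.

Lemma simple_int_Re d (T : measurableType d) (mu : {measure set T -> \bar R}) (D : set T)
    (s : seq (set T * C)) : measurable D ->
  (forall a, a \in s -> [/\ measurable a.1, a.1 `<=` D & (mu a.1 < +oo)%E]) ->
  mu.-integrable D (EFin \o (fun t => complex.Re (simple_fun s t))) /\
  \int[mu]_(t in D) complex.Re (simple_fun s t) = complex.Re (simple_int mu s).
Proof.
move=> mD; elim: s => [|[E v] s ih] hs.
  split.
    apply: (eq_integrable mD (cst 0%E)); last exact: integrable0.
    by move=> t _; rewrite /= /simple_fun big_nil.
  rewrite /simple_int big_nil; transitivity (\int[mu]_(t in D) (0 : R)).
    by apply: eq_Rintegral => t _; rewrite /simple_fun big_nil.
  by rewrite /Rintegral integral0.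
have [mE ED fE] := hs (E, v) (mem_head _ _).
have [|i1 i2] := ih; first by move=> a as_; apply: hs; rewrite inE as_ orbT.
have iE : mu.-integrable D (EFin \o \1_E).
  apply/integrableP; split.
    by apply/measurable_EFinP; apply: measurable_funTS; exact: measurable_indic.
  rewrite (_ : (\int[mu]_(x in D) _)%E = (\int[mu]_(x in D) (\1_E x)%:E)%E).
    by rewrite integral_indic// (setIidl ED).
  by apply: eq_integral => t _; rewrite /= ger0_norm.
have iEv : mu.-integrable D (EFin \o (fun t => complex.Re (v : R[i]) * \1_E t)).
  exact: (integrableZl mD (complex.Re (v : R[i])) iE).
have E1 t : complex.Re (simple_fun ((E, v) :: s) t) = complex.Re (v : R[i]) * \1_E t + complex.Re (simple_fun s t).
  by rewrite simple_fun_cons ReD -[(_ *: _)%R]/((\1_E t)%:C * v) ReZ mulrC.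
split.
  apply: (eq_integrable mD (fun t => ((complex.Re (v : R[i]) * \1_E t)%:E + (complex.Re (simple_fun s t))%:E)%E)).
    by move=> t _; rewrite /= E1.
  exact: (integrableD mD iEv i1).
transitivity (\int[mu]_(t in D) (complex.Re (v : R[i]) * \1_E t + complex.Re (simple_fun s t))).
  by apply: eq_Rintegral => t _; exact: E1.
rewrite (RintegralD mD iEv i1) i2 (RintegralZl _ mD iE) /simple_int big_cons ReD.
congr (_ + _); rewrite -[((_, _).2 in RHS)]/v -[(_ *: _)%R]/((fine (mu E))%:C * v) ReZ mulrC; congr (_ * _).
by rewrite /Rintegral integral_indic// (setIidl ED).
Qed.

Local Notation mu := (@lebesgue_measure R).
Local Notation ray := (@ray R).
Local Notation maj := (@majorant R).

Variables (g : R -> C) (K : R).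
Hypothesis gc : forall r e : R, 0 < r -> 0 < e ->
  exists2 h : R, 0 < h & forall u : R, 0 < u -> `|u - r| < h -> normc (g u - g r) < e.
Hypothesis gK : forall r : R, 0 < r -> normc (g r) <= K * maj r.

Let scaled (c : R[i]) : normc c = 1 -> forall e : R, 0 < e -> exists N, forall k, (N <= k)%N ->
  `|\int[mu]_(r in ray) complex.Re (c * g r) -
    complex.Re (c * \sum_(i < k.+1 ^ 2) (k.+1%:R^-1 : R)%:C * g (grid R k i))| < e.
Proof.
move=> c1 e e0; pose h (r : R) : C := c * g r.
have hc (r eps : R) : 0 < r -> 0 < eps ->
    exists2 d : R, 0 < d & forall u : R, 0 < u -> `|u - r| < d -> rnorm (h u - h r) < eps.
  move=> r0 e0'; have [d d0 hd] := gc r0 e0'; exists d => // u u0 ur.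
  by rewrite rnorm_scalar /h -mulrBr normcM c1 mul1r; exact: hd.
have hK r : 0 < r -> rnorm (h r) <= K * maj r.
  by move=> r0; rewrite rnorm_scalar /h normcM c1 mul1r; exact: gK.
have L1 := riemann_L1 hc hK.
have he : nbhs (0 : \bar R)%E [set x | (x < e%:E)%E].
  by apply: open_nbhs_nbhs; split; [exact: open_ereal_lt_ereal|rewrite /= lte_fin].
have [N _ hN] := L1 _ he; exists N => k /hN /=.
have [i1 i2] := simple_int_Re (@measurable_ray R) (@riemann_sets R C h k).
have E : complex.Re (simple_int mu (riemann h k)) =
   complex.Re (c * \sum_(i < k.+1 ^ 2) (k.+1%:R^-1 : R)%:C * g (grid R k i)).
  rewrite riemann_int mulr_sumr; congr (complex.Re _); apply: eq_bigr => i _.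
  by rewrite /h -[(_ *: _)%R]/(_ * (c * g _)) mulrCA.
have ih : mu.-integrable ray (EFin \o (fun r : R => complex.Re (h r))).
  apply: (@integrable_ray R (fun r => complex.Re (h r)) K) => r r0.
    apply/cvgrPdist_lt => d d0; have [m m0 hm] := hc r d r0 d0.
    have mr0 : 0 < Num.min m r by rewrite lt_min m0.
    exists (Num.min m r) => // u; rewrite /= lt_min => /andP[u1 u2].
    have up : 0 < u by move: u2; rewrite ltr_norml => /andP[_]; lra.
    rewrite -ReB (le_lt_trans (Re_normc _))// -rnorm_scalar rdistC; apply: hm => //.
    by rewrite distrC.
  by rewrite (le_trans (Re_normc _))// -rnorm_scalar; exact: hK.
rewrite -E -i2 -(RintegralB (@measurable_ray R) ih i1) => hlt.
have id : mu.-integrable ray (EFin \o (fun r : R => complex.Re (h r) - complex.Re (simple_fun (riemann h k) r))).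
  exact: (integrableB (@measurable_ray R) ih i1).
apply: (le_lt_trans (le_normr_Rintegral (@measurable_ray R) id)).
rewrite -lte_fin; apply: le_lt_trans hlt.
have iabs := integrable_norm id.
rewrite /Rintegral fineK; last exact: (integrable_fin_num (@measurable_ray R) iabs).
apply: ge0_le_integral => //; first exact: measurable_ray.
- by case/integrableP: iabs.
- apply/measurable_EFinP; apply: measurable_rnorm_simple; first exact: measurable_ray.
  + move=> z; exact: (measurable_g hc).
  + by move=> a /riemann_sets[].
- by move=> r _; rewrite lee_fin -ReB (le_trans (Re_normc _))// -rnorm_scalar.
Qed.

(** The scalar case of the same sums. It identifies the limit of each eigenvalue in the operator
    case. *)
Lemma riemann_Cint (e : R) : 0 < e -> exists N, forall k, (N <= k)%N ->
  normc (Cint g - \sum_(i < k.+1 ^ 2) (k.+1%:R^-1 : R)%:C * g (grid R k i)) < e.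
Proof.
move=> e0; have e2 : 0 < e / 2 by rewrite divr_gt0.
have [N1 h1] := scaled (normc_nat R 1) e2.
have i1 : normc (- 'i%C : R[i]) = 1 by rewrite /= oppr0 sqrrN expr0n expr1n add0r sqrtr1.
have [N2 h2] := scaled i1 e2.
have ei (z : R[i]) : complex.Re (- 'i%C * z) = complex.Im z by case: z => x y /=; ring.
exists (N1 + N2)%N => k Nk.
have {}h1 := h1 k (leq_trans (leq_addr _ _) Nk); have {}h2 := h2 k (leq_trans (leq_addl _ _) Nk).
rewrite (le_lt_trans (normc_ReIm _))// ReB ImB.
move: h1 h2; rewrite ei mul1r.
have -> : \int[mu]_(r in ray) complex.Re (1 * g r) = complex.Re (Cint g).
  by apply: eq_Rintegral => r _; rewrite mul1r.
have -> : \int[mu]_(r in ray) complex.Re (- 'i%C * g r) = complex.Im (Cint g).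
  by apply: eq_Rintegral => r _; rewrite ei.
by move=> h1 h2; rewrite [e]splitr ltrD.
Qed.

End ScalarIntegral.

(** * Integrals of families of symbols *)

Section SymbolIntegral.
Variables (R : realType) (p : R) (p1 : 1 < p).
Local Notation mu := (@lebesgue_measure R).
Local Notation ray := (@ray R).
Local Notation maj := (@majorant R).
Local Notation X := (Lp_R p1).
Local Notation sym_bounded := (@sym_bounded R p).
Local Notation Phi := (@Phi R p p1).

Lemma bvar_le_sum n (c : nat -> R[i]) : bvar n c <= 2 * \sum_(m < n.+1) normc (c m).
Proof.
rewrite /bvar; have h : \sum_(m < n) normc (c m - c m.+1) <=
    \sum_(m < n) normc (c m) + \sum_(m < n) normc (c m.+1).
  rewrite -big_split /=; apply: ler_sum => m _.
  by rewrite (le_trans (normcD _ _))// normc_opp.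
have e1 : \sum_(m < n.+1) normc (c m) = \sum_(m < n) normc (c m) + normc (c n) by rewrite big_ord_recr.
have e2 : \sum_(m < n.+1) normc (c m) = normc (c 0%N) + \sum_(m < n) normc (c m.+1) by rewrite big_ord_recl.
rewrite mulr_natl mulr2n {1}e1 e2; move: h (normc_ge0 (c 0%N)).
move: (normc (c n)) (normc (c 0%N)) (\sum_(m < n) normc (c m)) (\sum_(m < n) normc (c m.+1)) (\sum_(m < n) _) => a b x y z.
by clear; lra.
Qed.

Lemma bvarZ n (a : R[i]) (c : nat -> R[i]) : bvar n (fun m => a * c m) = normc a * bvar n c.
Proof.
rewrite /bvar mulrDr normcM mulr_sumr; congr (_ + _); apply: eq_bigr => m _.
by rewrite -mulrBr normcM.
Qed.

Lemma bvarD n (c d : nat -> R[i]) : bvar n (fun m => c m + d m) <= bvar n c + bvar n d.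
Proof.
rewrite /bvar addrACA -big_split lerD ?normcD//; apply: ler_sum => m _ /=.
by rewrite opprD addrACA normcD.
Qed.

Lemma bvar_sum n (N : nat) (F : nat -> nat -> R[i]) :
  bvar n (fun m => \sum_(i < N) F i m) <= \sum_(i < N) bvar n (F i).
Proof.
elim: N => [|N ih].
  rewrite big_ord0 (_ : (fun m => _) = (fun m => 0 * 0 : R[i])); last by apply/funext => m; rewrite big_ord0 mul0r.
  by rewrite bvarZ normc0 mul0r.
rewrite big_ord_recr (_ : (fun m => _) = (fun m => \sum_(i < N) F i m + F N m)).
  by rewrite (le_trans (bvarD _ _ _))// lerD2r.
by apply/funext => m; rewrite big_ord_recr.
Qed.

(** A lower sum for an integral of value 1, compared term by term with increments of the primitive
    -1 / (1 + r). *)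
Lemma sum_grid_maj (k : nat) : \sum_(i < k.+1 ^ 2) k.+1%:R^-1 * maj (grid R k i) <= 1.
Proof.
pose d : R := k.+1%:R^-1; have d0 : 0 < d by rewrite invr_gt0 ltr0Sn.
have step i : d * maj (grid R k i) <= (1 + i%:R * d)^-1 - (1 + i.+1%:R * d)^-1.
  rewrite /majorant /grid -/d -natr1; have i0 : 0 <= i%:R * d by rewrite mulr_ge0// ltW.
  have -> : 1 + (i%:R + 1) * d = 1 + i%:R * d + d by ring.
  move: (1 + i%:R * d) (ltr_wpDr i0 ltr01) => x x0.
  have xd : 0 < x + d by rewrite addr_gt0.
  have -> : x^-1 - (x + d)^-1 = d / (x * (x + d)) by field; rewrite !gt_eqF.
  rewrite ler_pM2l// lef_pV2 ?posrE ?exprn_gt0 ?mulr_gt0// expr2 ler_wpM2r ?(ltW xd)//.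
  by rewrite lerDl ltW.
have tel n : \sum_(i < n) ((1 + i%:R * d)^-1 - (1 + i.+1%:R * d)^-1) = 1 - (1 + n%:R * d)^-1.
  elim: n => [|n ih]; first by rewrite big_ord0 mul0r addr0 invr1 subrr.
  by rewrite big_ord_recr ih /= addrA subrK.
have h : \sum_(i < k.+1 ^ 2) d * maj (grid R k i) <= \sum_(i < k.+1 ^ 2) ((1 + i%:R * d)^-1 - (1 + i.+1%:R * d)^-1).
  by apply: ler_sum => i _; exact: step.
apply: (le_trans h); rewrite tel gerBl invr_ge0.
by rewrite addr_ge0// mulr_ge0// ltW.
Qed.

Lemma Phi_sum (N : nat) (a : nat -> R[i]) (c : nat -> symbol R) (x : X) :
  (forall i, exists K, sym_bounded (c i) K) ->
  (exists K, sym_bounded (fun n m => \sum_(i < N) a i * c i n m) K) /\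
  Phi (fun n m => \sum_(i < N) a i * c i n m) x = \sum_(i < N) a i *: Phi (c i) x.
Proof.
move=> hc; elim: N => [|N [[K hK] ih]].
  (* The zero symbol is written as -1 * 1 + 1, so that the lemmas on linear combinations apply to
     the empty sum. *)
  have e n m : -1 * 1 + 1 = \sum_(i < 0) a i * c i n m by rewrite big_ord0 mulr1 addNr.
  have [L hL] := sym_bounded_lin p1 (-1) (sym_bounded1 p) (sym_bounded1 p).
  split; first by exists L; apply: eq_sym_bounded hL => n m _; exact: e.
  rewrite -(eq_Phi (c := fun _ _ => -1 * 1 + 1) (fun n m _ => e n m)).
  by rewrite (Phi_sym_lin (-1) x (sym_bounded1 p) (sym_bounded1 p)) !Phi1 scaleN1r addNr big_ord0.
have [L hL] := hc N.
have e n m : (m <= n.*2)%N -> a N * c N n m + \sum_(i < N) a i * c i n m = \sum_(i < N.+1) a i * c i n m.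
  by move=> _; rewrite big_ord_recr addrC.
have [L' hL'] := sym_bounded_lin p1 (a N) hL hK.
split; first by exists L'; apply: eq_sym_bounded hL'.
rewrite -(eq_Phi e) (Phi_sym_lin (a N) x hL hK) ih.
by rewrite big_ord_recr addrC.
Qed.

Variables (gam : R -> symbol R) (K : R).
Hypothesis gamK : forall r n, 0 < r -> bvar n.*2 (gam r n) <= K * maj r.
Hypothesis gamS : forall r n m, 0 < r -> normc (gam r n m) <= K * maj r.
Hypothesis gamc : forall n m (r e : R), 0 < r -> 0 < e ->
  exists2 h : R, 0 < h & forall u : R, 0 < u -> `|u - r| < h -> normc (gam u n m - gam r n m) < e.

Let K0 : 0 <= K.
Proof. by have := le_trans (normc_ge0 _) (gamS 0 0 ltr01); rewrite pmulr_lge0 ?maj_gt0. Qed.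

Definition sym_int : symbol R := fun n m => Cint (fun r => gam r n m).

Let J (k : nat) : symbol R := fun n m =>
  \sum_(i < k.+1 ^ 2) (k.+1%:R^-1 : R)%:C * gam (grid R k i) n m.

Let D (k : nat) : symbol R := fun n m => -1 * J k n m + sym_int n m.

Let bJ k n : bvar n.*2 (J k n) <= K.
Proof.
apply: le_trans (bvar_sum _ _ (fun i m => (k.+1%:R^-1 : R)%:C * gam (grid R k i) n m)) _.
have h : \sum_(i < k.+1 ^ 2) bvar n.*2 (fun m => (k.+1%:R^-1 : R)%:C * gam (grid R k i) n m) <=
    \sum_(i < k.+1 ^ 2) K * (k.+1%:R^-1 * maj (grid R k i)).
  apply: ler_sum => i _; rewrite bvarZ normc_real ger0_norm ?invr_ge0// mulrCA.
  by rewrite ler_wpM2l ?invr_ge0// gamK// grid_gt0.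
by apply: (le_trans h); rewrite -mulr_sumr ler_piMr// sum_grid_maj.
Qed.

Let limD n m (e : R) : 0 < e -> exists N, forall k, (N <= k)%N -> normc (D k n m) < e.
Proof.
move=> e0; have [N hN] := @riemann_Cint R (fun r => gam r n m) K (gamc n m) (fun r => @gamS r n m) e e0.
by exists N => k /hN; rewrite /D mulN1r addrC.
Qed.

Let limDsum n M (e : R) : 0 < e -> exists N, forall k, (N <= k)%N -> \sum_(m < M) normc (D k n m) < e.
Proof.
elim: M e => [|M ih] e e0; first by exists 0%N => k _; rewrite big_ord0.
have e2 : 0 < e / 2 by rewrite divr_gt0.
have [N1 h1] := ih _ e2; have [N2 h2] := limD n M e2.
exists (N1 + N2)%N => k Nk; rewrite big_ord_recr /= [e]splitr ltrD//.
  by rewrite h1// (leq_trans _ Nk)// leq_addr.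
by rewrite h2// (leq_trans _ Nk)// leq_addl.
Qed.

Let limDb n (e : R) : 0 < e -> exists N, forall k, (N <= k)%N -> bvar n.*2 (D k n) < e.
Proof.
move=> e0; have e2 : 0 < e / 2 by rewrite divr_gt0.
have [N hN] := limDsum n n.*2.+1 e2; exists N => k /hN h.
by rewrite (le_lt_trans (bvar_le_sum _ _))// mulrC -ltr_pdivlMr.
Qed.

Let limDbs N0 (e : R) : 0 < e -> exists N, forall k n, (N <= k)%N -> (n <= N0)%N -> bvar n.*2 (D k n) < e.
Proof.
move=> e0; elim: N0 => [|N0 [N1 h1]].
  by have [N hN] := limDb 0 e0; exists N => k n /hN + /[!leqn0] /eqP ->.
have [N2 h2] := limDb N0.+1 e0; exists (N1 + N2)%N => k n Nk.
rewrite leq_eqVlt => /orP[/eqP->|nN]; first by rewrite h2// (leq_trans _ Nk)// leq_addl.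
by rewrite h1// (leq_trans _ Nk)// leq_addr.
Qed.

Let bvarN1 n (c d : nat -> R[i]) : bvar n (fun m => -1 * c m + d m) <= bvar n c + bvar n d.
Proof.
rewrite (le_trans (bvarD _ _ _))// bvarZ normc_opp.
by rewrite (_ : normc 1 = 1) ?mul1r//; exact: (normc_nat R 1).
Qed.

Let bj n : bvar n.*2 (sym_int n) <= K.
Proof.
apply/ler_addgt0Pr => e e0; have [N hN] := limDb n e0.
have := hN N (leqnn _) => h.
rewrite (_ : sym_int n = (fun m => J N n m + D N n m)).
  by rewrite (le_trans (bvarD _ _ _))// lerD// ltW.
by apply/funext => m; rewrite /D mulN1r addrA subrr add0r.
Qed.

Lemma sym_bounded_int : exists L, sym_bounded sym_int L.
Proof.
have [B B0 hB] := sym_bounded_bvar p1 (R := R); exists ((K + 1) * B); apply: hB => [|n].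
  by rewrite ltr_wpDl.
by rewrite (le_trans (bj n))// lerDl.
Qed.

(** The Riemann sums [J k] have variation at most K on every block, and their errors [D k] tend to 0
    in variation on each block, though not uniformly over the blocks. So x is truncated to N0
    blocks: the remainder is small by the uniform bound on [D k], the truncated part by convergence
    on finitely many blocks. *)
Lemma symbol_bochner (x : X) :
  (forall r e : R, 0 < r -> 0 < e -> exists2 h : R, 0 < h & forall u : R, 0 < u -> `|u - r| < h ->
     rnorm (Phi (gam u) x - Phi (gam r) x) < e) ->
  is_bochner_int mu ray (fun r => Phi (gam r) x) (Phi sym_int x).
Proof.
move=> gamX; have [B B0 hB] := sym_bounded_bvar p1 (R := R).
have bg r : 0 < r -> sym_bounded (gam r) ((K + 1) * maj r * B).
  move=> r0; apply: hB => [|n]; first by rewrite mulr_gt0 ?maj_gt0// ltr_wpDl.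
  by rewrite (le_trans (gamK n r0))// ler_wpM2r ?maj_ge0// lerDl.
apply: (@riemann_bochner R X (fun r => Phi (gam r) x) ((K + 1) * B * rnorm x) gamX).
  move=> r r0; rewrite (le_trans (Phi_bound x (bg r r0)))//.
  by rewrite le_eqVlt; apply/orP; left; apply/eqP; ring.
apply/cvg_rnormP => e e0.
have bJ' k : sym_bounded (J k) ((K + 1) * B).
  by apply: hB => [|n]; rewrite ?ltr_wpDl// (le_trans (bJ k n))// lerDl.
have bjj : sym_bounded sym_int ((K + 1) * B).
  by apply: hB => [|n]; rewrite ?ltr_wpDl// (le_trans (bj n))// lerDl.
pose L := (2 * K + 1) * B.
have L1 : 0 < 2 * K + 1 by rewrite ltr_wpDl// mulr_ge0.
have L0 : 0 < L by rewrite mulr_gt0.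
have bD k : sym_bounded (D k) L.
  apply: hB => [//|n]; rewrite (le_trans (bvarN1 _ _ _))//.
  by rewrite (le_trans (lerD (bJ k n) (bj n)))// mulr_natl mulr2n lerDl.
have EJ k : \sum_(i < k.+1 ^ 2) (k.+1%:R^-1 : R)%:C *: Phi (gam (grid R k i)) x = Phi (J k) x.
  have [|_ ->//] := @Phi_sum (k.+1 ^ 2) (fun=> (k.+1%:R^-1 : R)%:C) (fun i => gam (grid R k i)) x.
  by move=> i; eexists; exact: bg (grid_gt0 R k i).
have ED k : Phi sym_int x - Phi (J k) x = Phi (D k) x.
  by rewrite (Phi_sym_lin (-1) x (bJ' k) bjj) scaleN1r addrC.
have e2 : 0 < e / (2 * L) by rewrite divr_gt0// mulr_gt0.
have [N0 hN0] : exists N0, rnorm (Phi (cutoff R N0) x - x) < e / (2 * L).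
  have := Phi_cut_cvg x (p1 := p1) => /cvgrPdist_lt /(_ _ e2)[N _ hN].
  by exists N; have := hN N (leqnn _); rewrite /= sub0r normrN ger0_norm ?rnorm_ge0.
have nx : 0 < rnorm x + 1 by rewrite ltr_wpDl ?rnorm_ge0.
pose eta := e / (2 * B * (rnorm x + 1)).
have eta0 : 0 < eta by rewrite divr_gt0// !mulr_gt0.
have [N hN] := limDbs N0 eta0; exists N => k Nk.
rewrite EJ ED.
have bc := sym_bounded_cut1 p1 (R := R) N0.
have -> : Phi (D k) x = Phi (D k) (x - Phi (cutoff R N0) x) + Phi (fun n m => D k n m * cutoff R N0 n m) x.
  by rewrite -(PhiM x (bD k) bc) -(PhiD _ _ (bD k)) subrK.
have bDc : sym_bounded (fun n m => D k n m * cutoff R N0 n m) (eta * B).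
  apply: hB => // n; rewrite (_ : (fun m => _) = (fun m => cutoff R N0 n m * D k n m)); last first.
    by apply/funext => m; rewrite mulrC.
  rewrite /cutoff bvarZ; case: leqP => nN; first by rewrite (normc_nat R 1) mul1r ltW// hN.
  by rewrite normc0 mul0r ltW.
rewrite (le_lt_trans (rnormD _ _))// [e]splitr ltr_leD//.
  rewrite (le_lt_trans (Phi_bound _ (bD k)))// rdistC mulrC -ltr_pdivlMr//.
  by move: hN0; rewrite invfM mulrA.
rewrite (le_trans (Phi_bound x bDc))//.
have -> : eta * B * rnorm x = e / 2 * (rnorm x / (rnorm x + 1)).
  by rewrite /eta; field; rewrite !gt_eqF.
by rewrite ler_piMr ?divr_ge0 ?(ltW e0)// ler_pdivrMr// mul1r lerDl.
Qed.

End SymbolIntegral.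

(** * The sectorial operator *)

Section Operator.
Variables (R : realType) (p : R) (p1 : 1 < p).
Local Notation X := (Lp_R p1).
Local Notation sym_bounded := (@sym_bounded R p).
Local Notation Phi := (@Phi R p p1).

(* The base 17 makes the sum over m <> k of 4 * 17^(-|m - k|) at most 1/2. *)
Definition node (m : nat) : R := 17%:R ^+ m.

Lemma node_gt0 m : 0 < node m.
Proof. by rewrite exprn_gt0. Qed.

Lemma node_neq0 m : (node m)%:C != 0 :> R[i].
Proof. by apply: contra (lt0r_neq0 (node_gt0 m)) => /eqP[->]. Qed.

Lemma nodeS m : node m.+1 = 17%:R * node m.
Proof. exact: exprS. Qed.

Definition ressym (l : R[i]) : symbol R := fun _ m => (l - (node m)%:C)^-1.

(** With k = aperture (pi - s), that is sin (s / 2), the summand 1/k bounds the last eigenvalue of l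
    R(l, A) on a block and 1/k^2 the variation. *)
Definition resconst (s : R) : R := (aperture (pi - s))^-1 + (aperture (pi - s)) ^- 2.

Lemma resconst_gt0 (s : R) : 0 < s <= pi -> 0 < resconst s.
Proof.
move=> /andP[s0 sp]; have k0 : 0 < aperture (pi - s).
  by apply: aperture_gt0; rewrite subr_ge0 sp /= ltrBlDr ltrDl.
by rewrite addr_gt0 ?invr_gt0// exprn_gt0.
Qed.

Section FixedPoint.
Variables (r t s : R).
Hypotheses (r0 : 0 < r) (s0 : 0 < s) (st : s <= `|t|) (tp : `|t| <= pi).
Let l := r%:C * cis t.
Let k := aperture (pi - s).

Let k0 : 0 < k.
Proof. by apply: aperture_gt0; rewrite subr_ge0 (le_trans st tp) /= ltrBlDr ltrDl. Qed.

Let low m : k * (r + node m) <= normc (l - (node m)%:C).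
Proof. exact: aperture_polarB (ltW r0) (ltW (node_gt0 m)) (ltW s0) st tp. Qed.

Let rm m : 0 < r + node m.
Proof. by rewrite addr_gt0 ?node_gt0. Qed.

Let pos m : 0 < normc (l - (node m)%:C).
Proof. by apply: lt_le_trans (low m); rewrite mulr_gt0. Qed.

Lemma polar_node_neq m : l - (node m)%:C != 0.
Proof. by apply: contraTneq (pos m) => ->; rewrite normc0 ltxx. Qed.

(** An increasing sequence in [0, 1]. Up to the factor k^-2 its increments dominate those of l / (l
    - node m), so the variation telescopes. *)
Let phi m : R := node m / (r + node m).

Let step m : normc (l / (l - (node m)%:C) - l / (l - (node m.+1)%:C)) <= k ^- 2 * (phi m.+1 - phi m).
Proof.
have n1 := polar_node_neq m; have n2 := polar_node_neq m.+1.
have am : 0 < node m.+1 - node m by rewrite nodeS; have := node_gt0 m; lra.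
have -> : l / (l - (node m)%:C) - l / (l - (node m.+1)%:C) =
   - (l * (node m.+1 - node m)%:C / ((l - (node m)%:C) * (l - (node m.+1)%:C))).
  by rewrite rmorphB /=; field; rewrite n1 n2.
have nl : normc l = r := normc_polar t (ltW r0).
rewrite normc_opp (normcM (l * _)) (normcM l) nl normcV (normcM (l - _)) normc_real (gtr0_norm am).
have -> : phi m.+1 - phi m = r * (node m.+1 - node m) / ((r + node m) * (r + node m.+1)).
  by rewrite /phi; field; rewrite !gt_eqF.
rewrite mulrCA ler_pM2l ?mulr_gt0//.
rewrite -invfM lef_pV2 ?posrE ?mulr_gt0 ?exprn_gt0//.
have -> : k ^+ 2 * ((r + node m) * (r + node m.+1)) = (k * (r + node m)) * (k * (r + node m.+1)) by ring.
by rewrite ler_pM ?low// mulr_ge0// ltW.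
Qed.

Lemma bvar_res n : bvar n (fun m => l * ressym l n m) <= resconst s.
Proof.
rewrite /bvar /ressym; apply: lerD.
  rewrite normcM normcV /l normc_polar ?(ltW r0)// ler_pdivrMr ?pos// -/k.
  rewrite mulrC ler_pdivlMr// mulrC (le_trans _ (low n))// ler_wpM2l ?(ltW k0)//.
  by rewrite lerDl ltW ?node_gt0.
have h : \sum_(m < n) normc (l / (l - (node m)%:C) - l / (l - (node m.+1)%:C)) <=
    \sum_(m < n) k ^- 2 * (phi m.+1 - phi m) by apply: ler_sum => m _; exact: step.
apply: (le_trans h); rewrite -mulr_sumr -[leRHS]mulr1.
have tel : \sum_(m < n) (phi m.+1 - phi m) = phi n - phi 0%N.
  by elim: n {h} => [|n ih]; rewrite ?big_ord0 ?subrr// big_ord_recr ih /=; ring.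
rewrite tel ler_wpM2l ?invr_ge0 ?sqr_ge0//.
have p0 : 0 <= phi 0%N by rewrite divr_ge0 ?ltW ?node_gt0.
have pn : phi n <= 1 by rewrite /phi ler_pdivrMr// mul1r lerDr ltW.
by rewrite (le_trans _ pn)// gerBl.
Qed.

Lemma bvar_ressym n : bvar n (ressym l n) <= resconst s / r.
Proof.
have l0 : l != 0 := polar_neq0 t r0.
have := bvar_res n; rewrite bvarZ /l normc_polar ?(ltW r0)// -/l.
by rewrite mulrC -ler_pdivlMr.
Qed.

End FixedPoint.

Lemma cis_pi : cis (pi : R) = -1.
Proof. by rewrite /cis cospi sinpi; apply/eqP; rewrite eq_complex /= oppr0 !eqxx. Qed.

Lemma res_bounds : exists2 B, 0 < B & forall r t s : R, 0 < r -> 0 < s -> s <= `|t| -> `|t| <= pi ->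
  sym_bounded (fun n m => r%:C * cis t * ressym (r%:C * cis t) n m) (resconst s * B) /\
  sym_bounded (ressym (r%:C * cis t)) (resconst s / r * B).
Proof.
have [B B0 hB] := sym_bounded_bvar p1 (R := R); exists B => // r t s r0 s0 st tp.
have c0 : 0 < resconst s by rewrite resconst_gt0// s0 (le_trans st).
split.
  by apply: hB => // n; exact: bvar_res.
by apply: hB => [|n]; [rewrite divr_gt0|exact: bvar_ressym].
Qed.

Lemma sym_bounded0 K : 0 <= K -> sym_bounded (fun _ _ => 0) K.
Proof.
move=> K0; split=> // n x; rewrite (_ : kmat _ _ = 0); last first.
  by apply/matrixP => j l; rewrite kmatE mxE big1 ?mulr0// => m _; rewrite mul0r.
rewrite /psum big1 => [|j _].
  by rewrite mulr_ge0 ?powR_ge0// sumr_ge0// => j _; exact: powR_ge0.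
by rewrite /mv big1 ?normc0 ?powR0 ?gt_eqF ?(lt_trans ltr01)// => l _; rewrite mxE mul0r.
Qed.

Lemma Phi_sym0 x : Phi (fun _ _ => 0) x = 0.
Proof.
have := Phi_bound x (sym_bounded0 (lexx 0)) (p1 := p1); rewrite mul0r => h.
by apply: rnorm0_eq0; apply/eqP; rewrite eq_le rnorm_ge0 andbT.
Qed.

Lemma Phi_scale a c K x : sym_bounded c K -> Phi (fun n m => a * c n m) x = a *: Phi c x.
Proof.
move=> cK; rewrite -[RHS]addr0 -(Phi_sym0 x) -(Phi_sym_lin a x cK (sym_bounded0 ler01)).
by apply: eq_Phi => n m _; rewrite addr0.
Qed.

Lemma sym_bounded_scale a c K : sym_bounded c K -> exists L, sym_bounded (fun n m => a * c n m) L.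
Proof.
move=> cK; have [L hL] := sym_bounded_lin p1 a cK (sym_bounded0 ler01).
by exists L; apply: eq_sym_bounded hL => n m _; rewrite addr0.
Qed.

Lemma sym_bounded_opp1 : exists K, sym_bounded (fun _ _ => -1) K.
Proof.
have [L hL] := sym_bounded_scale (-1) (sym_bounded1 p).
by exists L; apply: eq_sym_bounded hL => n m _; rewrite mulr1.
Qed.

Lemma Phi_opp1 x : Phi (fun _ _ => -1) x = - x.
Proof.
rewrite -[RHS]scaleN1r; apply: etrans (congr1 _ (Phi1 x)).
apply: etrans (Phi_scale (-1) x (sym_bounded1 p)).
by apply: eq_Phi => n m _; rewrite mulr1.
Qed.

Definition unit_sym : symbol R := fun _ m => (1 + (node m)%:C)^-1.

Lemma one_node_neq0 m : 1 + (node m)%:C != 0 :> R[i].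
Proof.
have h : 0 < 1 + node m by rewrite addr_gt0 ?node_gt0.
by apply: contra (lt0r_neq0 h) => /eqP[/= -> _].
Qed.

Lemma unit_sym_bounded : exists K, sym_bounded unit_sym K.
Proof.
have [B B0 hB] := res_bounds.
have pp : `|pi : R| = pi := ger0_norm (pi_ge0 R).
have [_ +] := hB 1 pi pi ltr01 (pi_gt0 R) (eq_ind_r (fun x => pi <= x) (lexx _) pp) (eq_ind_r (fun x => x <= pi) (lexx _) pp).
move=> /(sym_bounded_scale (-1))[K]; rewrite cis_pi mul1r => h; exists K; apply: eq_sym_bounded h => n m _.
by rewrite /ressym /unit_sym -opprD invrN mulrNN mul1r.
Qed.

(* The graph of the operator acting as multiplication by node m; it is
   described through the bounded operator (1 + A)^-1. *)
Definition opA : operator X := [set u | u.1 = Phi unit_sym (u.1 + u.2)].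

(** The inverse eigenvalues may be unbounded, but after a cutoff they form a bounded symbol. Hence
    all truncations of u vanish, and u is their limit. *)
Lemma Phi_inj c K u : sym_bounded c K -> (forall n m, c n m != 0) -> Phi c u = 0 -> u = 0.
Proof.
move=> cK cn cu; apply: rnorm0_eq0.
have H N : Phi (cutoff R N) u = 0.
  have [L hL] := sym_bounded_cut p1 N (fun n m => (c n m)^-1).
  have := PhiM u hL cK; rewrite cu (Phi0 _ hL) => ->.
  by apply: eq_Phi => n m _; rewrite -mulrA mulVf// mulr1.
have := Phi_cut_cvg u (p1 := p1).
under eq_fun do rewrite H sub0r rnormN.
move=> h; have := cvg_lim (@Rhausdorff R) h.
by move=> /(_ eventually_filter); rewrite (lim_cst (@Rhausdorff R)).
Qed.

Lemma unit_sym_neq0 n m : unit_sym n m != 0.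
Proof. by rewrite invr_eq0 one_node_neq0. Qed.

Lemma opA_Phi c K L u : sym_bounded c K -> sym_bounded (fun n m => (node m)%:C * c n m) L ->
  opA (Phi c u, Phi (fun n m => (node m)%:C * c n m) u).
Proof.
move=> cK aL; have [K' uK] := unit_sym_bounded.
rewrite /opA /= -{2}[Phi c u]scale1r -(Phi_sym_lin 1 u cK aL).
have [L' hL'] := sym_bounded_lin p1 1 cK aL.
rewrite (PhiM u uK hL'); apply: eq_Phi => n m _.
by rewrite /unit_sym; field; exact: one_node_neq0.
Qed.

Lemma opA_linear : linear_operator opA.
Proof.
have [K uK] := unit_sym_bounded; split.
- by rewrite /opA /= addr0 (Phi0 _ uK).
- move=> a [x y] [x' y']; rewrite /opA /= => h h'.
  rewrite {1}h {1}h' -(Phi_lin _ _ _ uK); congr (Phi _ _).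
  by rewrite scalerDr addrACA.
- move=> y; rewrite /opA /= add0r => /esym; exact: Phi_inj uK unit_sym_neq0.
Qed.

Lemma opA_resolvent (r t : R) x y : 0 < r -> t != 0 -> `|t| <= pi -> let l := r%:C * cis t in
  opA (x, l *: x - y) <-> x = Phi (ressym l) y.
Proof.
move=> r0 t0 tp l; have [K uK] := unit_sym_bounded; have [Ko oK] := sym_bounded_opp1.
have [B B0 hB] := res_bounds; have tn : 0 < `|t| by rewrite normr_gt0.
have [_ rK] := hB r t `|t| r0 tn (lexx _) tp; rewrite -/l in rK.
have nz m : l - (node m)%:C != 0 by exact: (polar_node_neq r0 tn (lexx _) tp).
rewrite /opA /=; split.
  (* The symbol [T] has eigenvalues (1 + a) / (l - a) with a the node, so composing it with (1 +
     A)^-1 gives the resolvent. *)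
  have [L TL] := sym_bounded_lin p1 (1 + l) rK oK.
  set T := fun n m => _ in TL; move=> hx.
  have h1 : Phi T x = Phi (ressym l) ((1 + l) *: x - y).
    rewrite {1}hx (PhiM _ TL uK) (_ : x + (l *: x - y) = (1 + l) *: x - y).
      apply: eq_Phi => n m _; rewrite /T /ressym /unit_sym; field.
      by rewrite nz one_node_neq0.
    by rewrite scalerDl scale1r addrA.
  rewrite (PhiB _ _ rK) (PhiZ _ _ rK) in h1.
  move: h1; rewrite /T (Phi_sym_lin (1 + l) x rK oK) => /addrI.
  have -> : Phi (fun _ _ => -1) x = - x.
    exact: Phi_opp1.
  by move=> /oppr_inj.
move=> ->; set z := Phi _ y.
have -> : z + (l *: z - y) = Phi (fun n m => (1 + l) * ressym l n m + -1) y.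
  rewrite (Phi_sym_lin (1 + l) y rK oK) Phi_opp1.
  by rewrite scalerDl scale1r addrA.
have [L TL] := sym_bounded_lin p1 (1 + l) rK oK.
rewrite (PhiM y uK TL); apply: eq_Phi => n m _.
rewrite /ressym /unit_sym; field; by rewrite nz one_node_neq0.
Qed.

Lemma opA_resolventE (r t : R) y : 0 < r -> t != 0 -> `|t| <= pi ->
  resolvent opA (r%:C * cis t) y = Phi (ressym (r%:C * cis t)) y.
Proof.
move=> r0 t0 tp; apply: xget_unique => [|x]; first exact/(opA_resolvent _ _ r0 t0 tp).
by move=> /(opA_resolvent _ _ r0 t0 tp).
Qed.

Lemma outside_sector (w : R) (l : R[i]) : 0 < w -> ~ closure (@sector R w) l ->
  exists r t, [/\ 0 < r, w <= `|t|, `|t| <= pi & l = r%:C * cis t].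
Proof.
move=> w0 nl; have p0 := pi_gt0 R.
(* The origin lies in the closure of every sector, so a point outside has polar coordinates. *)
have l0 : l != 0.
  apply/negP => /eqP l0; apply: nl => B; rewrite l0 => /near_complex[e e0 hB].
  exists (e / 2)%:C; have e2 : 0 < e / 2 by rewrite divr_gt0.
  split; last by apply: hB; rewrite subr0 normc_real gtr0_norm//; lra.
  rewrite -[(e / 2)%:C]mulr1 -cis0; split; first exact: polar_neq0.
  by rewrite carg_polar ?normr0// pi_ge0 andbT oppr_lt0.
have [/andP[c1 c2] lE] := cargP l0.
exists (normc l), (carg l); split=> //; first exact: normc_gt0.
- rewrite leNgt; apply/negP => h; apply: nl; apply: subset_closure; split=> //.
- by rewrite ler_norml c2 andbT ltW.
Qed.

Lemma opA_sectorial_of (w : R) : 0 < w < pi -> sectorial_of opA w.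
Proof.
move=> /andP[w0 wp]; have [B B0 hB] := res_bounds.
have nz (t : R) : w <= `|t| -> t != 0 by move=> h; rewrite -normr_gt0 (lt_le_trans w0).
split.
  move=> l; apply: contraPP => nl; apply: contrapT; apply.
  have [r [t [r0 wt tp ->]]] := outside_sector w0 nl.
  have [_ rK] := hB r t w r0 w0 wt tp.
  rewrite /spectrum /= => nres; apply: nres; split.
    move=> y; exists (Phi (ressym (r%:C * cis t)) y); split.
      by apply/(opA_resolvent _ _ r0 (nz _ wt) tp).
    by move=> x /(opA_resolvent _ _ r0 (nz _ wt) tp).
  eexists => x; rewrite (opA_resolventE _ r0 (nz _ wt) tp); exact: Phi_bound rK.
move=> e e0; exists (resconst w * B) => l nl x.
have we : 0 < w + e by rewrite addr_gt0.
have [r [t [r0 wet tp ->]]] := outside_sector we nl.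
have wt : w <= `|t| by rewrite (le_trans _ wet)// lerDl ltW.
have [lK rK] := hB r t w r0 w0 wt tp.
rewrite (opA_resolventE _ r0 (nz _ wt) tp).
by rewrite -(Phi_scale _ x rK); exact: Phi_bound lK.
Qed.

Lemma opA_sectorial_angle : sectorial_angle opA = 0.
Proof.
rewrite /sectorial_angle (_ : [set w | _] = `]0, pi[%classic).
  by rewrite inf_itv// bnd_simp pi_gt0.
apply/seteqP; split => w /=; rewrite in_itv /=; first by case.
by move=> h; split=> //; exact: opA_sectorial_of.
Qed.

Lemma rnorm_nbhs (x : X) (e : R) : 0 < e -> nbhs x [set y | rnorm (x - y) < e].
Proof.
move=> e0; apply/nbhs_ballP; exists (e%:C) => /=; first by rewrite ltcR.
by move=> y; rewrite -ball_normE /= -rnormE ltcR.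
Qed.

Lemma opA_closed : closed opA.
Proof.
have [K uK] := unit_sym_bounded; have [K0 _] := uK.
move=> [x y] cl; rewrite /opA /=; apply/eqP; rewrite -subr_eq0; apply/eqP; apply: rnorm0_eq0.
apply/eqP; rewrite eq_le rnorm_ge0 andbT; apply/ler_addgt0Pr => e e0; rewrite add0r.
pose d := e / (1 + 2 * K).
have k1 : 0 < 1 + 2 * K by rewrite ltr_wpDr// mulr_ge0.
have d0 : 0 < d by rewrite divr_gt0.
have [|[x' y'] [/= h [/= hx hy]]] := cl [set q | rnorm (x - q.1) < d /\ rnorm (y - q.2) < d].
  by exists ([set q | rnorm (x - q) < d], [set q | rnorm (y - q) < d]);
    [split; exact: rnorm_nbhs | move=> [? ?] []].
have -> : x - Phi unit_sym (x + y) = (x - x') - Phi unit_sym ((x - x') + (y - y')).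
  rewrite addrACA -opprD (PhiB _ _ uK) -[in RHS]h opprB [RHS]addrCA addrA.
  by rewrite [_ - x']addrC !addrA addrN add0r addrC.
apply: (le_trans (rnormB _ _)); apply: (@le_trans _ _ (d + K * (d + d))).
  apply: lerD; first exact: ltW.
  apply: (le_trans (Phi_bound _ uK)); apply: ler_wpM2l => //.
  by apply: (le_trans (rnormD _ _)); apply: lerD; exact: ltW.
by rewrite le_eqVlt; apply/orP; left; apply/eqP; rewrite /d; field; rewrite gt_eqF.
Qed.

(** Truncated vectors belong to the domain and to the range of A, since both the nodes and their
    inverses are bounded symbols after a cutoff. *)
Lemma cut_dense (S : set X) : (forall N u, S (Phi (cutoff R N) u)) -> dense S.
Proof.
move=> hS O [u Ou] oO; have : nbhs u O by exact: open_nbhs_nbhs.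
move=> /nbhs_ballP[e' /gt0_complex[e e0 ->]] hO.
have := Phi_cut_cvg u (p1 := p1) => /cvgrPdist_lt /(_ _ e0)[N _ hN].
have := hN N (leqnn _); rewrite /= sub0r normrN ger0_norm ?rnorm_ge0// => h.
exists (Phi (cutoff R N) u); split; last exact: hS.
by apply: hO; rewrite -ball_normE /= -rnormE ltcR rdistC.
Qed.

Lemma opA_sectorial : sectorial opA.
Proof.
split.
- exact: opA_linear.
- exact: opA_closed.
- apply: cut_dense => N u; have [L hL] := sym_bounded_cut p1 N (fun _ m => (node m)%:C).
  exists (Phi (cutoff R N) u, Phi (fun n m => (node m)%:C * cutoff R N n m) u) => //.
  apply: (@opA_Phi _ 1 L); first exact: sym_bounded_cut1.
  by apply: eq_sym_bounded hL => n m _; rewrite mulrC.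
- apply: cut_dense => N u; have [L hL] := sym_bounded_cut p1 N (fun _ m => (node m)%:C^-1).
  have e n m : (node m)%:C * (cutoff R N n m * (node m)%:C^-1) = cutoff R N n m.
    by rewrite mulrCA mulfV ?mulr1// node_neq0.
  exists (Phi (fun n m => cutoff R N n m * (node m)%:C^-1) u, Phi (cutoff R N) u) => //.
  have := @opA_Phi (fun n m => cutoff R N n m * (node m)%:C^-1) L 1 u hL.
  rewrite (@eq_Phi R p p1 (fun n m => (node m)%:C * (cutoff R N n m * (node m)%:C^-1)) (cutoff R N)); last by move=> n m _; exact: e.
  by apply; apply: (eq_sym_bounded _ (sym_bounded_cut1 p1 N)) => n m _; rewrite e.
- have p0 := pi_gt0 R; exists (pi / 2); have h : 0 < (pi / 2 : R) < pi by apply/andP; split; lra.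
  by split=> //; exact: opA_sectorial_of.
Qed.

End Operator.

(** * Functional calculus and imaginary powers *)

Section Calculus.
Variables (R : realType) (p : R) (p1 : 1 < p).
Local Notation mu := (@lebesgue_measure R).
Local Notation ray := (@ray R).
Local Notation maj := (@majorant R).
Local Notation X := (Lp_R p1).
Local Notation sym_bounded := (@sym_bounded R p).
Local Notation Phi := (@Phi R p p1).
Local Notation node := (@node R).
Local Notation opA := (@opA R p p1).

Lemma itcurve_continuous (c : R -> R[i]) (t : R) d : itcurve c t d ->
  forall e : R, 0 < e -> exists2 h : R, 0 < h & forall u : R, `|u - t| < h -> normc (c u - c t) < e.
Proof.
move=> hc e e0; have [r r0 hr] := hc 1 ltr01.
pose m := Num.min r (e / (2 + normc d)).
have d0 : 0 < 2 + normc d by rewrite ltr_wpDr ?normc_ge0.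
exists m => [|u um]; first by rewrite lt_min r0 divr_gt0.
have [u1 u2] : `|u - t| < r /\ `|u - t| < e / (2 + normc d).
  by split; apply: lt_le_trans um _; rewrite /m ge_min lexx ?orbT.
have := hr (u - t) u1; rewrite [t + _]addrC subrK mul1r => h.
have := normcD (c u - c t - (u - t)%:C * d) ((u - t)%:C * d); rewrite subrK normcM normc_real => h2.
apply: (le_lt_trans h2).
rewrite ltr_pdivlMr// in u2; move: h u2 (normr_ge0 (u - t)) (normc_ge0 d).
move: (normc _) (`|u - t|) (normc d) => x y z h u2 y0 z0; clear -h u2 y0 z0 e0; nra.
Qed.

Definition raysym (f : R[i] -> R[i]) (t r : R) : symbol R := fun _ m => rayfun f (node m) t r.

Section Ray.
Variables (s : R) (f : R[i] -> R[i]) (t : R).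
Hypotheses (af : adm s f) (sp : s <= pi) (t0 : t != 0) (ts : `|t| < s).

Let tp : `|t| <= pi := ltW (lt_le_trans ts sp).
Let tn : 0 < `|t|. Proof. by rewrite normr_gt0. Qed.

Let phi (r : R) : R[i] := cis t * f (r%:C * cis t).

Let raysymE r : raysym f t r = fun n m => phi r * ressym (r%:C * cis t) n m.
Proof. by []. Qed.

Let phi_bound : exists K, 0 <= K /\ forall r, 0 < r -> normc (phi r) <= K * (r * maj r).
Proof.
have [f' [K h]] := af; exists `|K|; split=> // r r0; have [_ h2 _] := h _ _ r0 ts.
rewrite normcM normc_cis mul1r (le_trans h2)// ler_wpM2r ?ler_norm//.
by rewrite mulr_ge0 ?maj_ge0// ltW.
Qed.

Let phi_cont (r e : R) : 0 < r -> 0 < e ->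
  exists2 h : R, 0 < h & forall u : R, `|u - r| < h -> normc (phi u - phi r) < e.
Proof.
have [f' [K h]] := af; move=> r0 e0; have [h1 _ _] := h _ _ r0 ts.
exact: (itcurve_continuous (curve_mulc (cis t) (curve_comp (curve_scale (cis t) r) h1)) e0).
Qed.

Let raysym_bound : exists K, (forall r n, 0 < r -> bvar n.*2 (raysym f t r n) <= K * maj r) /\
  (forall r n m, 0 < r -> normc (raysym f t r n m) <= K * maj r).
Proof.
have [K [K0 hK]] := phi_bound; have [K' [K0' hK']] := rayfun_bound af.
have c0 : 0 < resconst `|t| by rewrite resconst_gt0// tn tp.
have ap : 0 <= aperture (pi - `|t|) by exact: sqrtr_ge0.
exists (K * resconst `|t| + K' / aperture (pi - `|t|)); split=> [r n r0|r n m r0].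
  rewrite raysymE bvarZ (le_trans (ler_pM (normc_ge0 _) _ (hK _ r0) (bvar_ressym r0 tn (lexx _) tp _)))//.
    by rewrite addr_ge0 ?normc_ge0 ?sumr_ge0// => i _; exact: normc_ge0.
  have -> : K * (r * maj r) * (resconst `|t| / r) = K * resconst `|t| * maj r.
    by field; rewrite gt_eqF.
  by rewrite ler_wpM2r ?maj_ge0// lerDl divr_ge0.
rewrite (le_trans (hK' _ _ _ (node_gt0 R m) r0 t0 ts sp))// ler_wpM2r ?maj_ge0// lerDr.
by rewrite mulr_ge0// ltW.
Qed.

Let raysym_cont n m (r e : R) : 0 < r -> 0 < e -> exists2 h : R, 0 < h &
  forall u : R, 0 < u -> `|u - r| < h -> normc (raysym f t u n m - raysym f t r n m) < e.
Proof.
move=> r0 e0.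
have [d hd] := rayfun_curve af r0 ts (polar_neq_real r0 (node_gt0 R m) t0 tp).
have [h h0 hh] := itcurve_continuous hd e0; exists h => // u _; exact: hh.
Qed.

Let Phi_raysym r x : 0 < r -> Phi (raysym f t r) x = phi r *: Phi (ressym (r%:C * cis t)) x.
Proof.
move=> r0; have [B B0 hB] := res_bounds p1.
have [_ rK] := hB r t `|t| r0 tn (lexx _) tp.
rewrite raysymE; exact: (Phi_scale (phi r) x rK).
Qed.

(** Continuity of the resolvent comes from the resolvent identity, since continuity of the single
    eigenvalues would not be uniform over the blocks. [C1] serves the variation of the scalar factor
    [phi], [C2] that of the resolvent. *)
Let raysym_Phi_cont x (r e : R) : 0 < r -> 0 < e -> exists2 h : R, 0 < h &
  forall u : R, 0 < u -> `|u - r| < h -> rnorm (Phi (raysym f t u) x - Phi (raysym f t r) x) < e.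
Proof.
move=> r0 e0; have [B B0 hB] := res_bounds p1; have [K [K0 hK]] := phi_bound.
have rK (u : R) : 0 < u -> sym_bounded (ressym (u%:C * cis t)) (resconst `|t| / u * B).
  by move=> u0; have [] := hB u t `|t| u0 tn (lexx _) tp.
pose W := resconst `|t| * B.
have W0 : 0 < W by rewrite mulr_gt0// resconst_gt0// tn tp.
pose N := rnorm x + 1; have N0 : 0 < N by rewrite ltr_wpDl ?rnorm_ge0.
pose C1 := W / r * N; have C10 : 0 < C1 by rewrite mulr_gt0// divr_gt0.
pose C2 := (K + 1) * W ^+ 2 / r * N.
have C20 : 0 < C2 by rewrite mulr_gt0// divr_gt0// mulr_gt0 ?exprn_gt0// ltr_wpDl.
have e1 : 0 < e / (2 * C1) by rewrite divr_gt0// mulr_gt0.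
have [h h0 hh] := phi_cont r0 e1.
pose d := Num.min h (e / (2 * C2)).
exists d => [|u u0 ud]; first by rewrite lt_min h0 divr_gt0// mulr_gt0.
have [u1 u2] : `|u - r| < h /\ `|u - r| < e / (2 * C2).
  by split; apply: lt_le_trans ud _; rewrite /d ge_min lexx ?orbT.
rewrite !Phi_raysym//; set Pu := Phi _ x; set Pr := Phi _ x.
have -> : phi u *: Pu - phi r *: Pr = (phi u - phi r) *: Pr + phi u *: (Pu - Pr).
  by rewrite scalerBl scalerBr [RHS]addrC addrA subrK.
have nu m : u%:C * cis t - (node m)%:C != 0 by exact: (polar_node_neq u0 tn (lexx _) tp).
have nr m : r%:C * cis t - (node m)%:C != 0 by exact: (polar_node_neq r0 tn (lexx _) tp).
have ED : Pu - Pr = ((r - u)%:C * cis t) *: Phi (ressym (u%:C * cis t)) Pr.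
  rewrite /Pr (PhiM x (rK u u0) (rK r r0)) -(Phi_scale _ x (sym_boundedM (rK u u0) (rK r r0))).
  have := Phi_sym_lin (-1) x (rK r r0) (rK u u0); rewrite scaleN1r addrC => <-.
  apply: eq_Phi => n m _; rewrite /ressym rmorphB /=; field; by rewrite nu nr.
have bPr : rnorm Pr <= W / r * rnorm x.
  by have := Phi_bound x (rK r r0) (p1 := p1); rewrite (_ : resconst `|t| / r * B = W / r)// /W mulrAC.
have bD : rnorm (Pu - Pr) <= `|u - r| * (W / u * (W / r * rnorm x)).
  rewrite ED rnormZ normcM normc_cis mulr1 normc_real distrC ler_wpM2l//.
  apply: (le_trans (Phi_bound _ (rK u u0))).
  rewrite (_ : resconst `|t| / u * B = W / u); last by rewrite /W mulrAC.
  by rewrite ler_wpM2l// divr_ge0// ltW.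
apply: (le_lt_trans (rnormD _ _)); rewrite !rnormZ [e]splitr; apply: ltrD.
  apply: (@le_lt_trans _ _ (normc (phi u - phi r) * C1)).
    apply: ler_wpM2l; first exact: normc_ge0.
    by apply: (le_trans bPr); rewrite ler_wpM2l ?divr_ge0 ?ltW// ltrDl.
  rewrite -ltr_pdivlMr// (lt_le_trans (hh _ u1))// invfM mulrA lexx//.
apply: (@le_lt_trans _ _ (`|u - r| * C2)).
  have m1 : maj u <= 1.
    by rewrite /majorant invf_le1 ?exprn_gt0 ?addr_gt0// exprn_ege1// lerDl ltW.
  have pu : normc (phi u) <= K * u.
    rewrite (le_trans (hK u u0))// ler_wpM2l// ler_piMr// ltW//.
  have x0 := rnorm_ge0 x.
  apply: (le_trans (ler_pM (normc_ge0 _) (rnorm_ge0 _) pu bD)).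
  have -> : K * u * (`|u - r| * (W / u * (W / r * rnorm x))) = `|u - r| * (K * W ^+ 2 / r * rnorm x).
    by field; rewrite !gt_eqF.
  apply: ler_wpM2l => //; rewrite /C2; apply: ler_pM => //.
  - by apply: divr_ge0; [apply: mulr_ge0 => //; exact: sqr_ge0|exact: ltW].
  - by rewrite ler_wpM2r ?invr_ge0 ?(ltW r0)// ler_wpM2r ?sqr_ge0// lerDl.
  - by rewrite lerDl.
rewrite -ltr_pdivlMr// (lt_le_trans u2)// invfM mulrA lexx//.
Qed.

Lemma raysym_bochner x :
  (exists L, sym_bounded (sym_int (raysym f t)) L) /\
  bochner_int mu ray (fun r => cis t *: (f (r%:C * cis t) *: resolvent opA (r%:C * cis t) x)) =
  Phi (sym_int (raysym f t)) x.
Proof.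
have [K [hK hS]] := raysym_bound; split.
  exact: sym_bounded_int hK hS raysym_cont.
apply: bochner_intE; first exact: measurable_ray.
have [S [h1 h2 h3 h4]] := symbol_bochner hK hS raysym_cont (@raysym_Phi_cont x).
have E r : r \in ray -> cis t *: (f (r%:C * cis t) *: resolvent opA (r%:C * cis t) x) = Phi (raysym f t r) x.
  by move=> /[1!inE] /rayP r0; rewrite opA_resolventE// Phi_raysym// scalerA.
exists S; split=> //.
  move=> k; apply: eq_measurable_fun (h2 k) => r rr; by rewrite E.
rewrite [X in X @ \oo](_ : _ = (fun k =>
    \int[mu]_(r in ray) (rnorm (Phi (raysym f t r) x - simple_fun (S k) r))%:E)%E)//.
by apply/funext => k; apply: eq_integral => r rr; rewrite E.
Qed.

End Ray.

Definition nodesym (f : R[i] -> R[i]) : symbol R := fun _ m => f (node m)%:C.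

Lemma twopi_neq0 : 2 * pi%:C * 'i%C != 0 :> R[i].
Proof.
rewrite !mulf_neq0 ?pnatr_eq0//; last by rewrite eq_complex /= oner_eq0 andbF.
by apply: contra (lt0r_neq0 (pi_gt0 R)) => /eqP[->].
Qed.

(** Each ray yields the operator whose symbol is integrated eigenvalue by eigenvalue, and Cauchy's
    formula at the nodes evaluates the difference of the two. Boundedness of the symbol of values of
    f is a by-product of this representation. *)
Lemma calc0_contour (s t : R) f x : adm s f -> s < pi -> 0 < t < s ->
  (exists L, sym_bounded (nodesym f) L) /\
  Phi (nodesym f) x = (2 * pi%:C * 'i%C)^-1 *:
    sector_contour_int t (fun l => f l *: resolvent opA l x).
Proof.
move=> af sp /andP[t0 ts].
have n1 : `|t| < s by rewrite gtr0_norm.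
have n2 : `|- t| < s by rewrite normrN.
have tz : t != 0 by rewrite gt_eqF.
have tz' : - t != 0 by rewrite oppr_eq0.
have [[L1 b1] e1] := raysym_bochner af (ltW sp) tz n1 x.
have [[L2 b2] e2] := raysym_bochner af (ltW sp) tz' n2 x.
have -> : sector_contour_int t (fun l => f l *: resolvent opA l x) =
    Phi (sym_int (raysym f (- t))) x - Phi (sym_int (raysym f t)) x.
  exact: (congr2 (fun u v => u - v) e2 e1).
have E n m : (2 * pi%:C * 'i%C)^-1 * (-1 * sym_int (raysym f t) n m + sym_int (raysym f (- t)) n m) = nodesym f n m.
  rewrite mulN1r addrC /sym_int /raysym (cauchy_formula af sp (node_gt0 R m)) ?t0//.
  by rewrite mulrA mulVf ?mul1r// twopi_neq0.
have [L hL] := sym_bounded_lin p1 (-1) b1 b2.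
have [L' hL'] := sym_bounded_scale p1 (2 * pi%:C * 'i%C)^-1 hL.
split; first by exists L'; apply: eq_sym_bounded hL' => n m _; exact: E.
rewrite -(eq_Phi (fun n m _ => E n m)) (Phi_scale _ x hL) (Phi_sym_lin (-1) x b1 b2).
by rewrite scaleN1r addrC.
Qed.

Lemma nodesym_bounded (s : R) f : adm s f -> 0 < s < pi -> exists L, sym_bounded (nodesym f) L.
Proof.
move=> af /andP[s0 sp]; have h : 0 < s / 2 < s by apply/andP; split; lra.
by have [] := calc0_contour 0 af sp h.
Qed.

(** The contour integrals agree for all admissible angles, so the vector selected by [calc0] exists;
    the single angle s / 2 already determines it. *)
Theorem calc0_Phi (s : R) f x : adm s f -> 0 < s < pi -> calc0 opA s f x = Phi (nodesym f) x.
Proof.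
move=> af /andP[s0 sp]; rewrite /calc0 opA_sectorial_angle; apply: xget_unique.
  by move=> t ts; have [_ ->] := calc0_contour x af sp ts.
have h : 0 < s / 2 < s by apply/andP; split; lra.
by move=> y /(_ _ h) ->; have [_ ->] := calc0_contour x af sp h.
Qed.

End Calculus.

Section ImaginaryPowers.
Variables (R : realType) (p : R) (p1 : 1 < p).
Local Notation X := (Lp_R p1).
Local Notation sym_bounded := (@sym_bounded R p).
Local Notation Phi := (@Phi R p p1).
Local Notation node := (@node R).
Local Notation opA := (@opA R p p1).

Lemma carg_real (a : R) : 0 < a -> carg a%:C = 0.
Proof.
by move=> a0; rewrite -[a%:C]mulr1 -cis0 carg_polar// pi_ge0 andbT oppr_lt0 pi_gt0.
Qed.

Lemma cpow_node (u : R) m : cpow u (node m)%:C = cis (u * ln 17) ^+ m.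
Proof.
rewrite cisX /cpow /clog carg_real ?node_gt0// normc_real (gtr0_norm (node_gt0 R m)).
have -> : u%:C * 'i%C * (ln (node m) +i* 0) = 0 +i* (u * ln (node m)).
  by apply/eqP; rewrite eq_complex /=; apply/andP; split; apply/eqP; ring.
by rewrite /cexp /= expR0 mul1r /node lnXn// mulrnAr.
Qed.

(** These are the eigenvalues of the cyclic shift by l, which permutes the coordinates. *)
Lemma lpb_shift q N l : lpb q 1 (kmat N (fun m => omega R N ^+ l ^+ m)).
Proof.
move=> x; rewrite mul1r; pose f (j : 'I_N.+1) : 'I_N.+1 := inord ((l + j) %% N.+1).
have fE (j : 'I_N.+1) : f j = ((l + j) %% N.+1)%N :> nat by rewrite inordK// ltn_mod.
have injf : injective f.
  move=> i j /(congr1 val) /=; rewrite !fE => /eqP; rewrite eqn_modDl !modn_small// => /eqP h.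
  exact: val_inj.
have ratE j k : kmat N (fun m => omega R N ^+ l ^+ m) j k =
    N.+1%:R^-1 * \sum_(m < N.+1) (omega R N ^+ f j / omega R N ^+ k) ^+ m.
  rewrite kmatE; congr (_ * _); apply: eq_bigr => m _ /=.
  by rewrite -exprMn mulrA -exprD fE (prim_expr_mod (prim_omega R N)).
have mvE j : mv (kmat N (fun m => omega R N ^+ l ^+ m)) x j = x (f j).
  rewrite /mv (bigD1 (f j))//= [X in _ + X]big1 ?addr0.
    by rewrite ratE sum_ratio eqxx muln1 mulVf ?mul1r// pnatr_eq0.
  by move=> k kj; rewrite ratE sum_ratio eq_sym (negbTE kj) muln0 mulr0 mul0r.
rewrite /psum le_eqVlt; apply/orP; left; apply/eqP.
rewrite (eq_bigr (fun j => normc (x (f j)) `^ q)) => [|j _]; last by rewrite mvE.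
by rewrite [RHS](reindex_inj injf).
Qed.

Lemma sin_le_norm (x : R) : `|sin x| <= `|x|.
Proof.
wlog x0 : x / 0 < x => [hw|].
  have [x0|x0|x0] := ltrgtP 0 x; [exact: hw| |by rewrite -x0 sin0].
  by rewrite -[leLHS]normrN -sinN -(normrN x); apply: hw; rewrite oppr_gt0.
have [|c _] := @MVT_segment R sin cos 0 x (ltW x0).
  by apply: derivable_within_continuous => y _; exact: derivable_sin.
by rewrite sin0 !subr0 => ->; rewrite normrM ler_piMl// cos_max.
Qed.

Lemma cos_dist_le (x : R) : `|1 - cos x| <= `|x|.
Proof.
wlog x0 : x / 0 < x => [hw|].
  have [x0|x0|x0] := ltrgtP 0 x; [exact: hw| |by rewrite -x0 cos0 subrr].
  by rewrite -(normrN x) -cosN; apply: hw; rewrite oppr_gt0.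
have [|c _] := @MVT_segment R cos (fun x => - sin x) 0 x (ltW x0).
  by apply: derivable_within_continuous => y _; exact: derivable_cos.
rewrite cos0 subr0 => h; rewrite distrC h normrM normrN ler_piMl//.
by have := sin_max c.
Qed.

Lemma cis_dist (x : R) : normc (1 - cis x) <= 2 * `|x|.
Proof.
rewrite (le_trans (normc_ReIm _))// mulr_natl mulr2n lerD//=.
  exact: cos_dist_le.
by rewrite sub0r normrN sin_le_norm.
Qed.

Lemma cis_2piX k : cis (2 * pi *+ k : R) = 1.
Proof.
rewrite -cisX (_ : cis (2 * pi) = 1) ?expr1n//.
rewrite mulr_natl mulr2n cisD /cis cospi sinpi.
by apply/eqP; rewrite eq_complex /=; apply/andP; split; apply/eqP; ring.
Qed.

Lemma cis_nonneg (t : R) : exists2 t', 0 <= t' & cis t' = cis t :> R[i].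
Proof.
have p0 : 0 < 2 * pi :> R by rewrite mulr_gt0// pi_gt0.
pose k := (Num.truncn (`|t| / (2 * pi))).+1.
exists (t + 2 * pi *+ k); last by rewrite cisD cis_2piX mulr1.
have h : `|t| / (2 * pi) < k%:R by rewrite truncnS_gt.
have : `|t| < 2 * pi *+ k by rewrite -mulr_natr mulrC -ltr_pdivrMr.
by have := ler_norm (- t); rewrite normrN; move: (2 * pi *+ k) => x; lra.
Qed.

(* A rotation by a multiple of the angle of omega is a permutation of the
   pieces; it leaves an angle so small that the variation stays bounded. *)
Lemma powers_bounded : exists K, 0 <= K /\ forall t : R, sym_bounded (fun _ m => cis t ^+ m) K.
Proof.
have [B B0 hB] := kmat_lp p1 (R := R).
have p0 : 0 < p := lt_trans ltr01 p1.
(* The last value contributes 1 and each of the N steps at most 2a, where (N+1) a = 2 pi. *)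
pose W : R := 1 + 4 * pi; have W0 : 0 < W by rewrite ltr_pwDl// mulr_ge0// pi_ge0.
exists (W * B `^ p^-1); split; first by rewrite mulr_ge0 ?powR_ge0// ltW.
move=> t; split; first by rewrite mulr_ge0 ?powR_ge0// ltW.
move=> n; set N := n.*2; rewrite powRM ?powR_ge0 ?(ltW W0)//.
rewrite -powRrM mulVf ?gt_eqF// powRr1 ?(ltW B0)//.
have [t' t0 <-] := cis_nonneg t.
have M0 : 0 < N.+1%:R :> R by rewrite ltr0Sn.
have pp := pi_gt0 R; have p2 : 0 < 2 * pi :> R by rewrite mulr_gt0.
pose x := t' * N.+1%:R / (2 * pi).
have x0 : 0 <= x by rewrite divr_ge0 ?mulr_ge0// ltW.
pose l := Num.truncn x.
have /andP[l1 l2] : l%:R <= x < l.+1%:R by apply: truncn_itv.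
pose a : R := 2 * pi / N.+1%:R.
have a0 : 0 < a by rewrite divr_gt0.
have xa : t' = x * a by rewrite /x /a mulrA (divfK (lt0r_neq0 p2)) (mulfK (lt0r_neq0 M0)).
pose d := (x - l%:R) * a.
have E : cis t' = omega R N ^+ l * cis d.
  rewrite /omega cisX -cisD xa /d -/a; congr cis; rewrite -mulr_natr; ring.
have d0 : `|d| <= a.
  rewrite ger0_norm; last by rewrite mulr_ge0 ?subr_ge0// ltW.
  by rewrite ler_piMl ?(ltW a0)//; move: l2; rewrite -natr1; lra.
rewrite (@eq_kmat _ _ _ (fun m => omega R N ^+ l ^+ m * cis d ^+ m)); last first.
  by move=> m _; rewrite E exprMn.
rewrite -kmatM => y; rewrite (eq_psum _ (mvM _ _ _)).
have h1 := lpb_shift p l (mv (kmat N (fun m => cis d ^+ m)) y); rewrite mul1r in h1.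
apply: (le_trans h1); apply: hB => //.
rewrite /bvar normcX normc_cis expr1n /W lerD2l.
have h : \sum_(m < N) normc (cis d ^+ m - cis d ^+ m.+1) <= \sum_(m < N) 2 * a.
  apply: ler_sum => m _; rewrite exprSr -{1}[cis d ^+ m]mulr1 -mulrBr normcM normcX normc_cis expr1n mul1r.
  by rewrite (le_trans (cis_dist d))// ler_wpM2l.
apply: (le_trans h); rewrite sumr_const card_ord -[_ *+ N]mulr_natr.
rewrite /a; have -> : 2 * (2 * pi / N.+1%:R) * N%:R = 4 * pi * (N%:R / N.+1%:R) :> R.
  by field; rewrite gt_eqF.
by rewrite ler_piMr ?mulr_ge0 ?pi_ge0// ler_pdivrMr// mul1r ler_nat.
Qed.

(** The regularizer vanishes at no node, so e^n(A) is injective and the defining relation determines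
    y, whichever s and n occur in it. *)
Lemma imaginary_power_sub (t : R) x y :
  imaginary_power opA t (x, y) -> y = Phi (fun _ m => cis (t * ln 17) ^+ m) x.
Proof.
have [K [K0 hK]] := powers_bounded.
move=> [s [hs [n [n0 _ /= E]]]]; rewrite opA_sectorial_angle in hs.
have ae := adm_regularizerX hs n0; have ap := adm_regularizer_cpow t hs n0.
have [L hL] := nodesym_bounded p1 ae hs.
rewrite -/(cpow t) in E.
rewrite (calc0_Phi _ ae hs) (calc0_Phi _ ap hs) in E.
have E2 : Phi (nodesym (fun l => regularizer l ^+ n * cpow t l)) x =
    Phi (nodesym (fun l => regularizer l ^+ n)) (Phi (fun _ m => cis (t * ln 17) ^+ m) x).
  rewrite (PhiM x hL (hK _)); apply: eq_Phi => k m _.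
  by rewrite /nodesym cpow_node.
rewrite E2 in E; apply/eqP; rewrite -subr_eq0; apply/eqP.
apply: (Phi_inj hL); last by rewrite (PhiB _ _ hL) E subrr.
move=> k m; rewrite /nodesym expf_neq0// /regularizer mulf_neq0 ?node_neq0//.
by rewrite invr_eq0 expf_neq0// one_node_neq0.
Qed.

Lemma imaginary_power_dom (t : R) x :
  imaginary_power opA t (x, Phi (fun _ m => cis (t * ln 17) ^+ m) x).
Proof.
have [K [K0 hK]] := powers_bounded; have p0 := pi_gt0 R.
have hs : 0 < (pi / 2 : R) < pi by apply/andP; split; lra.
exists (pi / 2); rewrite opA_sectorial_angle; split=> //.
have ae := adm_regularizerX hs (ltn0Sn 0); have ap := adm_regularizer_cpow t hs (ltn0Sn 0).
have hH : H0inf (pi / 2) (fun l : R[i] => regularizer l ^+ 1 * cpow t l).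
  by apply: adm_H0inf ap; case/andP: hs => _ /ltW.
exists 1%N; apply: (And3 (ltn0Sn 0) hH).
rewrite [LHS](calc0_Phi _ ae hs) [RHS](calc0_Phi _ ap hs).
have [L hL] := nodesym_bounded p1 ae hs.
rewrite (PhiM x hL (hK _)); apply: eq_Phi => k m _.
by rewrite /nodesym cpow_node.
Qed.

Lemma imaginary_power_bounded : exists K, 0 <= K /\ forall t : R,
  everywhere_bounded_by (imaginary_power opA t) K.
Proof.
have [K [K0 hK]] := powers_bounded; exists K; split=> // t; split.
  apply/seteqP; split=> // x _; exists (x, Phi (fun _ m => cis (t * ln 17) ^+ m) x) => //.
  exact: imaginary_power_dom.
by move=> x y /imaginary_power_sub ->; exact: Phi_bound (hK _).
Qed.

Lemma opA_BIP : BIP opA.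
Proof.
by have [K [_ hK]] := imaginary_power_bounded; move=> t; exists K.
Qed.

Lemma opA_omega_BIP : omega_BIP opA = 0%E.
Proof.
have [K [K0 hK]] := imaginary_power_bounded.
rewrite /omega_BIP asboolT; last exact: opA_BIP.
apply/eqP; rewrite eq_le; apply/andP; split.
  apply: ereal_inf_lbound; exists 0 => //; split=> //; exists K; split=> // t.
  by rewrite mul0r expR0 mulr1.
by apply: le_ereal_inf_tmp => _ [w [w0 _] <-]; rewrite lee_fin.
Qed.

End ImaginaryPowers.

(** * Unboundedness of the calculus *)

Section GaussSums.
Variable R : realType.

(* The eigenvalues omega^(m^2): completing the square, with n.+1 the inverse of 2
   modulo 2n+1, all entries of the circulant matrix have the same modulus. *)
Lemma gauss_multiplier (n : nat) : exists c : nat -> R[i], (forall m, normc (c m) = 1) /\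
  forall j : 'I_n.*2.+1, normc (kmat n.*2 c j ord0) ^+ 2 = n.*2.+1%:R^-1.
Proof.
(* As 2(n+1) = (2n+1) + 1, the mixed term of the square is a * m modulo 2n+1. *)
have natid (a m : nat) : ((a * n.+1 + m) ^ 2 =
    (a * n.+1) ^ 2 + (m ^ 2 + a * m) + n.*2.+1 * (a * m))%N.
  by rewrite -!mulnn -muln2; nia.
set N := n.*2; pose w := omega R N; pose c m := w ^+ (m ^ 2).
have c1 m : normc (c m) = 1 by rewrite /c normcX normc_omega expr1n.
have wN : w ^+ N.+1 = 1 := prim_expr_order (prim_omega R N).
exists c; split=> // j.
pose S (i : 'I_N.+1) := \sum_(m < N.+1) c m * (w ^+ i / w ^+ (ord0 : 'I_N.+1)) ^+ m.
have shift (i : 'I_N.+1) : w ^+ ((i * n.+1) ^ 2) * S i = \sum_(m < N.+1) c m.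
  pose f (m : 'I_N.+1) : 'I_N.+1 := inord ((i * n.+1 + m) %% N.+1).
  have fE (m : 'I_N.+1) : f m = ((i * n.+1 + m) %% N.+1)%N :> nat by rewrite inordK// ltn_mod.
  have injf : injective f.
    move=> a b /(congr1 val) /=; rewrite !fE => /eqP; rewrite eqn_modDl !modn_small// => /eqP h.
    exact: val_inj.
  rewrite [RHS](reindex_inj injf) /S mulr_sumr; apply: eq_bigr => m _.
  rewrite /c fE -[RHS](prim_expr_mod (prim_omega R N)) modnXm (prim_expr_mod (prim_omega R N)).
  rewrite expr0 divr1 -exprM -!exprD.
  have -> : ((i * n.+1 + m) ^ 2 = (i * n.+1) ^ 2 + (m ^ 2 + i * m) + N.+1 * (i * m))%N.
    exact: natid.
  by rewrite [RHS]exprD exprM wN expr1n mulr1.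
have nS i : normc (S i) = normc (\sum_(m < N.+1) c m).
  by rewrite -(shift i) normcM normcX normc_omega expr1n mul1r.
have nK i : normc (kmat N c i ord0) = normc (kmat N c j ord0).
  by rewrite !kmatE !normcM -/w -/(S i) -/(S j) !nS.
(* The matrix is unitary because all |c m| = 1. Column 0 thus has l_2 norm 1, which fixes the common
   modulus of its entries. *)
have U : \sum_(i < N.+1) conjc (kmat N c i ord0) * kmat N c i ord0 = 1.
  have := @kmatM R N (fun m => conjc (c m)) c => /matrixP/(_ ord0 ord0).
  rewrite mxE (@eq_kmat _ _ (fun m => conjc (c m) * c m) (fun=> 1)); last first.
    by move=> m _; rewrite mulrC mul_conjc c1 expr1n.
  rewrite kmat1 mxE eqxx => h.
  transitivity (\sum_k kmat N (fun m => conjc (c m)) ord0 k * kmat N c k ord0); last exact: h.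
  apply: eq_bigr => i _.
  by rewrite kmat_adj.
have M0 : N.+1%:R != 0 :> R by rewrite pnatr_eq0.
apply: (mulfI M0); rewrite divff//.
have : (N.+1%:R * normc (kmat N c j ord0) ^+ 2)%:C = 1 :> R[i].
  rewrite -U (eq_bigr (fun=> (normc (kmat N c j ord0) ^+ 2)%:C)).
    by rewrite sumr_const card_ord -[RHS]mulr_natl rmorphM /= rmorph_nat.
  by move=> i _; rewrite mulrC mul_conjc nK.
by move=> [].
Qed.

End GaussSums.

(** * Multipliers on a single block *)

Section BlockMultipliers.
Variables (R : realType) (p : R) (p1 : 1 < p).
Local Notation mu := (@lebesgue_measure R).
Local Notation RR := (measurableTypeR R).
Local Notation X := (Lp_R p1).
Local Notation sym_bounded := (@sym_bounded R p).
Local Notation Phi := (@Phi R p p1).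

Definition blocksym (n : nat) (c : nat -> R[i]) : symbol R := fun k m => (k == n)%:R * c m.

(** A crude bound that grows with n. It starts the iteration leading to a bound independent of n. *)
Lemma blocksym_bounded n : exists2 K, 0 < K & forall c, (forall m, normc (c m) <= 1) ->
  sym_bounded (blocksym n c) K.
Proof.
have [B B0 hB] := sym_bounded_bvar p1 (R := R).
pose W : R := 2 * n.*2.+1%:R.
exists (W * B) => [|c c1]; first by rewrite !mulr_gt0// ltr0Sn.
apply: hB => [|k]; first by rewrite mulr_gt0// ltr0Sn.
rewrite /blocksym bvarZ; have [->|kn] := eqVneq k n; last first.
  by rewrite normc0 mul0r mulr_ge0.
rewrite (normc_nat R 1) mul1r (le_trans (bvar_le_sum _ _))// ler_wpM2l//.
have h : \sum_(m < n.*2.+1) normc (c m) <= \sum_(m < n.*2.+1) 1 by apply: ler_sum => m _; exact: c1.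
by apply: (le_trans h); rewrite sumr_const card_ord.
Qed.

Lemma blocksym1_bounded n : sym_bounded (blocksym n (fun=> 1)) 1.
Proof.
split=> // k; rewrite powR1 /blocksym; have [->|kn] := eqVneq k n.
  rewrite (@eq_kmat _ _ (fun=> 1%:R * 1) (fun=> 1)) ?kmat1; last by move=> m _; rewrite mulr1.
  exact: lpb1.
have [_ h] := sym_bounded0 p1 ler01 (R := R).
have := h k; rewrite powR1; congr (lpb _ _ _); apply: eq_kmat => m _.
by rewrite mul0r.
Qed.

Definition block_bound (n : nat) (K : R) := forall c, (forall m, normc (c m) <= 1) ->
  forall x, rnorm (Phi (blocksym n c) x) <= K * rnorm x.

(** On the block c = g - r / 2 with r = 2 (g - c), which again has modulus at most 1. The bound [D]
    applies to g and the current bound [K] to r. *)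
Lemma block_bound_step n (D K : R) : 0 <= D ->
  (forall c, (forall m, normc (c m) <= 1) -> exists g : nat -> R[i],
     [/\ exists L, sym_bounded (fun _ m => g m) L,
         forall x, rnorm (Phi (fun _ m => g m) x) <= D * rnorm x
       & forall m, (m <= n.*2)%N -> normc (g m - c m) <= 1 / 2]) ->
  block_bound n K -> block_bound n (D + K / 2).
Proof.
move=> D0 hg hK c c1 x; have [g [[L hL] gD gc]] := hg c c1.
pose r m : R[i] := if (m <= n.*2)%N then 2 * (g m - c m) else 0.
have r1 m : normc (r m) <= 1.
  rewrite /r; case: ifP => mn; last by rewrite normc0.
  rewrite normcM (normc_nat R 2) -ler_pdivlMl// mulrC; exact: gc.
have [K' K0 hK'] := blocksym_bounded n.
have bg : sym_bounded (fun k m => blocksym n (fun=> 1) k m * g m) (1 * L).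
  exact: sym_boundedM (blocksym1_bounded n) hL.
have e k m : (m <= k.*2)%N -> blocksym n c k m =
    - (2^-1) * blocksym n r k m + blocksym n (fun=> 1) k m * g m.
  rewrite /blocksym; have [->|kn] := eqVneq k n; last by rewrite !mul0r mulr0 add0r.
  by move=> mn; rewrite /r mn; field.
rewrite (eq_Phi e) (Phi_sym_lin _ x (hK' _ r1) bg) -(PhiM x (blocksym1_bounded n) hL).
rewrite (le_trans (rnormD _ _))// rnormZ addrC mulrDl; apply: lerD.
  by rewrite (le_trans (Phi_bound _ (blocksym1_bounded n)))// mul1r.
rewrite normc_opp normcV (normc_nat R 2) mulrAC mulrC.
by rewrite ler_wpM2r ?invr_ge0// hK.
Qed.

(* Correcting c by twice the error of g is a contraction by 1/2 of the best bound. *)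
Lemma block_bound_limit n (D : R) : 0 <= D ->
  (forall c, (forall m, normc (c m) <= 1) -> exists g : nat -> R[i],
     [/\ exists L, sym_bounded (fun _ m => g m) L,
         forall x, rnorm (Phi (fun _ m => g m) x) <= D * rnorm x
       & forall m, (m <= n.*2)%N -> normc (g m - c m) <= 1 / 2]) ->
  block_bound n (2 * D).
Proof.
move=> D0 hg; have [K K0 hK] := blocksym_bounded n.
(* 2D is the fixed point of K |-> D + K / 2, and the distance to it is halved at each step. *)
have iter j : block_bound n (2 * D + K / 2 ^+ j).
  elim: j => [|j ih].
    move=> c c1 x; rewrite (le_trans (Phi_bound x (hK c c1)))//.
    by rewrite expr0 divr1 ler_wpM2r ?rnorm_ge0// lerDr mulr_ge0.
  have := block_bound_step D0 hg ih; congr block_bound.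
  by rewrite exprS; field; rewrite expf_neq0.
move=> c c1 x; apply/ler_addgt0Pr => e e0.
have Kx : 0 < K * (rnorm x + 1) by rewrite mulr_gt0// ltr_wpDl ?rnorm_ge0.
pose j := Num.truncn (K * (rnorm x + 1) / e).
have jl : K * (rnorm x + 1) / e < 2 ^+ j.+1.
  apply: lt_le_trans (truncnS_gt _) _; rewrite -natrX ler_nat ltnW//.
  by rewrite ltn_expl.
have j2 : 0 < 2 ^+ j.+1 :> R by rewrite exprn_gt0.
apply: (le_trans (iter j.+1 c c1 x)); rewrite mulrDl lerD2l.
rewrite mulrAC ler_pdivrMr//; rewrite ltr_pdivrMr// mulrC in jl.
rewrite [e * _]mulrC; apply: le_trans (ltW jl).
by rewrite [leLHS]mulrC ler_wpM2r ?(ltW K0)// lerDl.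
Qed.

Lemma cell0_itv n : `[n%:R, n%:R + n.*2.+1%:R^-1[%classic `<=` cell n 0 (R := R).
Proof.
move=> x; rewrite /= in_itv /= => hx.
have [|+ _] := (@cellP R n 0 (Posz n) x isT erefl).2; last by [].
by rewrite mul0r addr0 div1r.
Qed.

(** A function supported in the first cell is a point mass among the pieces: the image on piece j is
    a translate of f times the entry j of column 0. *)
Lemma integral_opf_cell n c (f : RR -> R[i]) : cmeasurable f ->
  (forall x, ~ cell n 0 x -> f x = 0) ->
  (\int[mu]_x (normc (opf (blocksym n c) f x) `^ p)%:E =
   (\sum_(j < n.*2.+1) normc (kmat n.*2 c j ord0) `^ p)%:E * \int[mu]_x (normc (f x) `^ p)%:E)%E.
Proof.
move=> mf f0; have p0 : 0 < p := lt_trans ltr01 p1.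
have mpow g : cmeasurable g -> measurable_fun setT (fun x : RR => (normc (g x) `^ p)%:E).
  move=> mg; apply/measurable_EFinP.
  apply: (measurableT_comp (measurable_powR p)); exact: measurable_normc.
have pow0 (g : RR -> R[i]) x : (0 <= (normc (g x) `^ p)%:E)%E by rewrite lee_fin powR_ge0.
have mo := mpow _ (cmeasurable_opf (blocksym n c) mf); have mf' := mpow _ mf.
have z0 : (normc (0 : R[i]) `^ p = 0)%R by rewrite normc0 powR0// gt_eqF.
have kmn : kmat n.*2 (blocksym n c n) = kmat n.*2 c.
  by apply: eq_kmat => m _; rewrite /blocksym eqxx mul1r.
transitivity (\int[mu]_(x in @blocks R n) (normc (opf (blocksym n c) f x) `^ p)%:E)%E.
  rewrite [RHS]integral_mkcond; apply: eq_integral => x _; rewrite patchE.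
  case: ifPn => // /negP; rewrite inE => xn; congr EFin.
  rewrite /opf big1 ?z0// => k _.
  rewrite kmatE big1 ?mulr0 ?mul0r// => m _; rewrite /blocksym.
  by have [e|_] := eqVneq (block x) n; [case: xn|rewrite !mul0r].
rewrite (integral_blocks _ mo (pow0 _)).
transitivity (\int[mu]_(x in cell n 0) ((\sum_(j < n.*2.+1) normc (kmat n.*2 c j ord0) `^ p)%:E * (normc (f x) `^ p)%:E))%E.
  apply: eq_integral => x /[1!inE] xE; rewrite sumEFin -EFinM mulr_suml; congr EFin.
  apply: eq_bigr => j _; have /opfE -> := cell_move (ltn_ord j) xE.
  rewrite /mv (bigD1 ord0)//= [X in normc (_ + X)]big1 ?addr0.
    by rewrite kmn move_move /move subrr mul0r addr0 normcM powRM ?normc_ge0.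
  move=> k k0; rewrite f0 ?mulr0// => -[_ h1].
  have [_ h2] := cell_move (ltn_ord k) (cell_move (ltn_ord j) xE).
  move: k0; rewrite -val_eqE /= => /eqP; apply.
  exact: etrans (esym h2) h1.
rewrite ge0_integralZl//; last 3 first.
- exact: measurable_cell.
- exact: measurable_funTS.
- by rewrite lee_fin sumr_ge0// => j _; exact: powR_ge0.
congr (_ * _)%E; rewrite integral_mkcond; apply: eq_integral => x _; rewrite patchE.
case: ifPn => // /negP; rewrite inE => xn; by rewrite f0// z0.
Qed.

Lemma rnorm_powR (f : RR -> R[i]) (h : f \in cLfun mu p%:E) :
  (((rnorm (toLp p1 h)) `^ p)%:E = \int[mu]_x (normc (f x) `^ p)%:E)%E.
Proof.
have p0 : 0 < p := lt_trans ltr01 p1.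
rewrite -poweR_EFin rnorm_toLp unlock /= -poweRrM mulVf ?gt_eqF// poweRe1.
  by apply: eq_integral => x _; rewrite /= ger0_norm ?normc_ge0.
by apply: integral_ge0 => x _; rewrite lee_fin powR_ge0.
Qed.

(** The vector is the indicator of the part of the first cell in [n, n+1[, of length 1 / (2n+1). It
    does not depend on c, and the second conclusion allows a multiplier to be followed by its
    inverse. *)
Lemma block_test n : exists2 y : X, 0 < rnorm y & forall c, (forall m, normc (c m) <= 1) ->
  rnorm (Phi (blocksym n c) y) `^ p =
    (\sum_(j < n.*2.+1) normc (kmat n.*2 c j ord0) `^ p) * rnorm y `^ p /\
  Phi (blocksym n (fun=> 1)) y = y.
Proof.
have p0 : 0 < p := lt_trans ltr01 p1.
pose I : set RR := `[n%:R, n%:R + n.*2.+1%:R^-1[%classic.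
pose f (x : RR) : R[i] := (\1_I x)%:C.
have mI : measurable I by exact: measurable_itv.
have mf : cmeasurable f.
  by split; [exact: measurable_indic|exact: measurable_cst].
have muI : mu I = (n.*2.+1%:R^-1)%:E.
  rewrite /I lebesgue_measure_itv /= lte_fin.
  by rewrite ltrDl invr_gt0 ltr0Sn -EFinB addrC addKr.
have int_f : (\int[mu]_x (normc (f x) `^ p)%:E = (n.*2.+1%:R^-1)%:E)%E.
  transitivity (\int[mu]_x (\1_I x)%:E)%E.
    apply: eq_integral => x _; rewrite /f normc_real ger0_norm//; congr EFin.
    by rewrite indicE; case: (x \in I); rewrite ?powR1// powR0// gt_eqF.
  by rewrite integral_indic// setIT; exact: muI.
have hf : f \in cLfun mu p%:E.
  apply/cLfunP; split=> //; rewrite /finite_norm unlock /=.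
  rewrite (_ : (\int[mu]_x _)%E = (\int[mu]_x (normc (f x) `^ p)%:E)%E); last first.
    by apply: eq_integral => x _; rewrite /= ger0_norm ?normc_ge0.
  by rewrite int_f poweR_EFin ltry.
have f0 x : ~ cell n 0 x -> f x = 0.
  by move=> nx; rewrite /f indicE memNset// => /cell0_itv.
have ny : rnorm (toLp p1 hf) `^ p = n.*2.+1%:R^-1.
  by apply: EFin_inj; rewrite rnorm_powR int_f.
exists (toLp p1 hf).
  rewrite lt_neqAle rnorm_ge0 andbT eq_sym; apply/negP => /eqP h0.
  move: ny; rewrite h0 powR0 ?gt_eqF// => /esym/eqP; rewrite invr_eq0 pnatr_eq0//.
move=> c c1; have [K K0 hK] := blocksym_bounded n; split.
  have bK := hK c c1; rewrite (PhiE p1 hf (opf_cLfun p1 bK hf) bK).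
  by apply: EFin_inj; rewrite EFinM !rnorm_powR (integral_opf_cell c mf f0).
rewrite (PhiE p1 hf (opf_cLfun p1 (blocksym1_bounded n) hf) (blocksym1_bounded n)).
apply/toLp_eqP; apply: nearW => x.
have [xn|xn] := eqVneq (block x) n.
  transitivity (opf (fun _ _ => 1) f x); last by rewrite opf1.
  rewrite /opf; apply: eq_bigr => k _; congr (kmat _ _ _ _ * _).
  by apply/funext => m; rewrite /blocksym xn eqxx mul1r.
rewrite f0; last by move=> [h _]; rewrite h eqxx in xn.
rewrite /opf big1// => k _; rewrite kmatE big1 ?mulr0 ?mul0r// => m _.
by rewrite /blocksym (negbTE xn) !mul0r.
Qed.

(** With M = 2n+1, the Gauss multiplier spreads a point mass evenly and changes the p-th power of
    its norm by the factor M^(1 - p/2); the conjugate sequence undoes this. Bounding both by D gives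
    M^|1 - p/2| <= D^p, which fails for large n. *)
Lemma block_bound_false (D : R) : 0 <= D -> p != 2 -> ~ (forall n, block_bound n D).
Proof.
move=> D0 p2 hD; have p0 : 0 < p := lt_trans ltr01 p1.
pose alpha : R := `|1 - p / 2|.
have a0 : 0 < alpha.
  rewrite normr_gt0 subr_eq0; apply: contra p2 => /eqP h; apply/eqP; move: h; lra.
suff H n : n.*2.+1%:R `^ alpha <= D `^ p.
  pose n := Num.truncn ((D `^ p) `^ alpha^-1).
  have nl : (D `^ p) `^ alpha^-1 < n.*2.+1%:R.
    by apply: lt_le_trans (truncnS_gt _) _; rewrite ler_nat ltnS -addnn leq_addr.
  have := H n; rewrite leNgt => /negP; apply.
  have := @gt0_ltr_powR R alpha a0 _ _ _ _ nl.
  rewrite -(powRrM _ alpha^-1 alpha) mulVf ?gt_eqF// powRr1 ?powR_ge0//.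
  by apply; rewrite nnegrE ?powR_ge0.
have [c [c1 cg]] := gauss_multiplier R n.
have [y y0 hy] := block_test n.
have cle m : normc (c m) <= 1 by rewrite c1.
have cle' m : normc (conjc (c m)) <= 1 by rewrite normc_conj c1.
have M0 : 0 < n.*2.+1%:R :> R by rewrite ltr0Sn.
set M : R := n.*2.+1%:R in M0 *.
have kE j : normc (kmat n.*2 c j ord0) = M `^ (- (1 / 2)).
  have -> : normc (kmat n.*2 c j ord0) = Num.sqrt (M^-1).
    by rewrite -(cg j) sqrtr_sqr ger0_norm ?normc_ge0.
  by rewrite -powR12_sqrt ?invr_ge0 ?(ltW M0)// -powR_inv1 ?(ltW M0)// -powRrM mulN1r div1r.
have [E1 Py] := hy c cle.
rewrite (eq_bigr (fun=> M `^ (- (p / 2)))) in E1; last first.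
  by move=> j _; rewrite kE -powRrM; congr (_ `^ _); ring.
rewrite sumr_const card_ord -[_ *+ n.*2.+1]mulr_natl -/M in E1.
have MM : M * M `^ (- (p / 2)) = M `^ (1 - p / 2).
  by rewrite powRD ?(gt_eqF M0) ?implybT// powRr1// ltW.
rewrite MM in E1.
pose z := Phi (blocksym n c) y; rewrite -/z in E1.
have h1 : rnorm z <= D * rnorm y := hD n c cle y.
have h2 : rnorm y <= D * rnorm z.
  have := hD n _ cle' z; rewrite /z.
  have [K K0 hK] := blocksym_bounded n.
  rewrite (PhiM y (hK _ cle') (hK _ cle)).
  rewrite (_ : Phi _ y = y)// -[RHS]Py; apply: eq_Phi => k m _.
  rewrite /blocksym mulrACA (mulrC _ (c m)) mul_conjc c1 expr1n mulr1.
  by case: (k == n); rewrite ?mulr1 ?mulr0.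
have yp : 0 < rnorm y `^ p by rewrite powR_gt0.
have pw (a b : R) : 0 <= a -> a <= D * b -> 0 <= b -> a `^ p <= D `^ p * b `^ p.
  move=> a0' ab b0; rewrite -powRM//; apply: ge0_ler_powR; rewrite ?nnegrE ?mulr_ge0//.
  exact: ltW.
have q1 := pw _ _ (rnorm_ge0 z) h1 (rnorm_ge0 y).
have q2 := pw _ _ (rnorm_ge0 y) h2 (rnorm_ge0 z).
rewrite E1 in q1 q2.
rewrite /alpha; case: (leP 0 (1 - p / 2)) => hp.
  by rewrite ger0_norm// -(ler_pM2r yp).
rewrite ltr0_norm// opprB -[p / 2 - 1]opprB powRN -div1r ler_pdivrMr ?powR_gt0//.
by rewrite -(ler_pM2r yp) mul1r -mulrA.
Qed.

End BlockMultipliers.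

(** * Approximation of arbitrary eigenvalues by functions bounded on sectors *)

Section UnboundedCalculus.
Variables (R : realType) (p : R) (p1 : 1 < p).
Local Notation node := (@node R).
Local Notation opA := (@opA R p p1).

Definition combination (n : nat) (c : nat -> R[i]) (l : R[i]) : R[i] :=
  \sum_(m < n.*2.+1) c m * peak (node m) l.

Lemma peak_real (a b : R) : 0 < a -> 0 < b ->
  normc (peak a b%:C) <= 4 * (b / a) /\ normc (peak a b%:C) <= 4 * (a / b).
Proof.
move=> a0 b0; pose r := b / a; have r0 : 0 < r by rewrite divr_gt0.
have -> : peak a b%:C = (4 * (r / (1 + r) ^+ 2))%:C.
  rewrite /peak /regularizer /r -(rmorph_nat (real_complex R)) -(rmorph1 (real_complex R)).
  by rewrite -!(rmorphM, fmorphV, rmorphXn, rmorphD).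
have r1 : 0 < (1 + r) ^+ 2 by rewrite exprn_gt0// addr_gt0.
rewrite normc_real ger0_norm; last by rewrite mulr_ge0// divr_ge0// ltW.
split; rewrite ler_pM2l// ler_pdivrMr//.
  by rewrite ler_peMr ?(ltW r0)// exprn_ege1// lerDl ltW.
have -> : a / b = r^-1 by rewrite /r invf_div.
rewrite ler_pdivlMl// -expr2 ler_pXn2r ?nnegrE ?(ltW r0) ?addr_ge0 ?(ltW r0)//.
by rewrite lerDr.
Qed.

(** Equal to 17^(-|m - k|) off the diagonal and 0 on it: a quarter of the bound for the value at
    node k of the peak centred at node m. *)
Let q (k m : nat) : R := if (m < k)%N then node m / node k else if m == k then 0 else node k / node m.

Let sum_q k M : \sum_(m < M) q k m <= 1 / 8.
Proof.
have n0 m := node_gt0 R m.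
(* The right-hand sides are the sums over all integers m < M, including negative ones: each of the
   two geometric series has sum 1/16. *)
suff H : \sum_(m < M) q k m <= if (M <= k)%N then node M / (16 * node k) else
    1 / 8 - 17 * node k / (16 * node M).
  apply: (le_trans H); case: leqP => h.
    rewrite ler_pdivrMr ?mulr_gt0//.
    have : node M <= node k by rewrite ler_eXn2l// ltr1n.
    by have := n0 k; lra.
  by rewrite lerBlDr lerDl divr_ge0 ?mulr_ge0 ?ltW.
elim: M => [|M ih]; first by rewrite big_ord0 leq0n divr_ge0 ?mulr_ge0 ?ltW.
rewrite big_ord_recr /=; apply: (le_trans (lerD ih (lexx _))).
have kn : node k != 0 by rewrite gt_eqF.
have Mn : node M != 0 by rewrite gt_eqF.
rewrite /q; case: (ltngtP M k) => [Mk|Mk|->].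
- rewrite nodeS le_eqVlt; apply/orP; left; apply/eqP; field; exact: kn.
- rewrite nodeS le_eqVlt; apply/orP; left; apply/eqP; field.
  by rewrite Mn.
- by rewrite nodeS addr0 le_eqVlt; apply/orP; left; apply/eqP; field; exact: kn.
Qed.

Lemma combination_node n c k : (forall m, normc (c m) <= 1) -> (k <= n.*2)%N ->
  normc (combination n c (node k)%:C - c k) <= 1 / 2.
Proof.
move=> c1 kn; have kn' : (k < n.*2.+1)%N by [].
rewrite /combination (bigD1 (Ordinal kn'))//= peak1 ?node_gt0// mulr1 addrAC subrr add0r.
apply: (le_trans (normc_sum _ _ _)).
apply: (@le_trans _ _ (\sum_(m < n.*2.+1) 4 * q k m)); last first.
  by rewrite -mulr_sumr; have := sum_q k n.*2.+1; lra.
have n0 m := node_gt0 R m.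
rewrite [leRHS](bigD1 (Ordinal kn'))//= -[leLHS]add0r lerD//.
  by rewrite /q ltnn eqxx mulr0.
apply: ler_sum => m mk; rewrite normcM.
have [b1 b2] := peak_real (n0 m) (n0 k).
apply: (@le_trans _ _ (normc (peak (node m) (node k)%:C))).
  by rewrite ler_piMl ?normc_ge0.
by move: mk; rewrite -val_eqE /q /=; case: ltngtP.
Qed.

(** The peaks are dominated by increments of the increasing sequence [phi] with values in [0, 1], so
    their sum telescopes whatever n and c are. The factor 17/16 comes from r + 17a <= 17 (r + a) and
    from node m.+1 - node m = 16 * node m. *)
Lemma combination_sup (s : R) : 0 < s < pi -> exists2 K, 0 < K & forall n c z,
  (forall m, normc (c m) <= 1) -> sector s z -> normc (combination n c z) <= K.
Proof.
move=> /andP[s0 sp]; pose k := aperture s; have k0 : 0 < k by rewrite aperture_gt0// (ltW s0).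
exists (4 * k ^- 2 * (17 / 16)); first by rewrite !mulr_gt0 ?invr_gt0 ?exprn_gt0.
move=> n c z c1 /sectorP[r [t [r0 ts ->]]].
have n0 m := node_gt0 R m; have rm m : 0 < r + node m by rewrite addr_gt0.
pose phi m : R := node m / (r + node m).
have step m : normc (peak (node m) (r%:C * cis t)) <= 4 * k ^- 2 * (17 / 16) * (phi m.+1 - phi m).
  have lb : k * (r + node m) <= normc (r%:C * cis t + (node m)%:C).
    exact: aperture_polarD (ltW r0) (ltW (n0 m)) (ltW ts) (ltW sp).
  have lp : 0 < k * (r + node m) by rewrite mulr_gt0.
  have np := lt_le_trans lp lb.
  have -> : peak (node m) (r%:C * cis t) =
      4%:R * (r%:C * cis t * (node m)%:C / (r%:C * cis t + (node m)%:C) ^+ 2).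
    have nz : r%:C * cis t + (node m)%:C != 0 by apply: contraTneq np => ->; rewrite normc0 ltxx.
    have nn := node_neq0 R m.
    rewrite /peak /regularizer; move: (r%:C * cis t) ((node m)%:C) nz nn => x y nz nn.
    by field; rewrite nn /= ?nz// addrC nz.
  rewrite normcM (normc_nat R 4) normcM normcV normcX normcM normc_polar ?(ltW r0)// normc_real (gtr0_norm (n0 m)).
  have -> : phi m.+1 - phi m = 16 * (r * node m) / ((r + node m) * (r + node m.+1)).
    by rewrite /phi nodeS; field; rewrite -nodeS !gt_eqF.
  rewrite -!mulrA ler_pM2l//.
  have h1 : normc (r%:C * cis t + (node m)%:C) ^- 2 <= k ^- 2 * (r + node m) ^- 2.
    rewrite -invfM -exprMn lef_pV2 ?posrE ?exprn_gt0//.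
    by rewrite ler_pXn2r ?nnegrE ?normc_ge0// ltW.
  have rn : 0 < r * node m by rewrite mulr_gt0.
  rewrite mulrA; apply: (le_trans (ler_wpM2l (ltW rn) h1)).
  have -> : k ^- 2 * (17 * (16^-1 * (16 * (r * (node m / ((r + node m) * (r + node m.+1))))))) =
     r * node m * (k ^- 2 * (17 / ((r + node m) * (r + node m.+1)))).
    by field; rewrite !gt_eqF.
  rewrite ler_pM2l// ler_pM2l ?invr_gt0 ?exprn_gt0//.
  rewrite ler_pdivlMr ?mulr_gt0// mulrC ler_pdivrMr ?exprn_gt0// expr2 mulrCA ler_pM2l//.
  by rewrite nodeS; have := n0 m; lra.
rewrite /combination (le_trans (normc_sum _ _ _))//.
have h : \sum_(m < n.*2.+1) normc (c m * peak (node m) (r%:C * cis t)) <=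
    \sum_(m < n.*2.+1) 4 * k ^- 2 * (17 / 16) * (phi m.+1 - phi m).
  apply: ler_sum => m _; rewrite normcM (le_trans _ (step m))// ler_piMl ?normc_ge0//.
apply: (le_trans h); rewrite -mulr_sumr.
have tel M : \sum_(m < M) (phi m.+1 - phi m) = phi M - phi 0%N.
  by elim: M => [|M ih]; rewrite ?big_ord0 ?subrr// big_ord_recr ih /=; ring.
rewrite tel ler_piMr ?mulr_ge0 ?invr_ge0 ?sqr_ge0//.
have p0 : 0 <= phi 0%N by rewrite divr_ge0 ?ltW.
have pn : phi n.*2.+1 <= 1 by rewrite /phi ler_pdivrMr// mul1r lerDr ltW.
by rewrite (le_trans _ pn)// gerBl.
Qed.

Lemma adm_combination (s : R) n c : 0 < s < pi -> adm s (combination n c).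
Proof.
move=> sp; apply: (@adm_sum R s n.*2.+1 c (fun m => peak (node m))) => m.
by apply: adm_peak => //; exact: node_gt0.
Qed.

Lemma opA_unbounded_Hinf : p != 2 -> ~ has_bounded_Hinf opA.
Proof.
move=> p2 [s [+ [C hC]]]; rewrite opA_sectorial_angle => hs.
have [K K0 hK] := combination_sup hs; have [s0 sp] := andP hs.
(* The constant [C] may be negative, hence the absolute value. *)
pose D := `|C| * K; have D0 : 0 <= D by rewrite mulr_ge0// ltW.
apply: (@block_bound_false R p p1 (2 * D)) => // [|n]; first by rewrite mulr_ge0.
apply: block_bound_limit => // c c1; exists (fun m => combination n c (node m)%:C).
have ac := adm_combination n c hs.
split.
- exact: nodesym_bounded ac hs.
- move=> x; have := hC _ (adm_H0inf (ltW sp) ac) x.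
  rewrite (calc0_Phi _ ac hs) => h; apply: (le_trans h).
  rewrite ler_wpM2r ?rnorm_ge0//; set S := sup _.
  have z0 : sector s (1%:C * cis 0 : R[i]).
    by apply: sector_polar => //; rewrite ?normr0// ltW.
  have ub : ubound [set normc (combination n c z) | z in sector s] K.
    by move=> _ [z sz <-]; exact: hK.
  have S0 : 0 <= S.
    apply: (le_trans (normc_ge0 (combination n c (1%:C * cis 0)))).
    by apply: ub_le_sup; [exists K|exists (1%:C * cis 0)].
  have SK : S <= K.
    by apply: ge_sup => //; exists (normc (combination n c (1%:C * cis 0))), (1%:C * cis 0).
  by rewrite (le_trans (ler_wpM2r S0 (ler_norm C)))// ler_wpM2l.
- by move=> m mn; exact: combination_node.
Qed.

End UnboundedCalculus.

Theorem corollary4p5 (R : realType) (p : R) (p1 : 1 < p) (p2 : p != 2) :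
  exists A : operator (Lp_R p1),
    [/\ sectorial A, BIP A, sectorial_angle A = 0, omega_BIP A = 0%E
      & ~ has_bounded_Hinf A].
Proof.
exists (@opA R p p1); split.
- exact: opA_sectorial.
- exact: opA_BIP.
- exact: opA_sectorial_angle.
- exact: opA_omega_BIP.
- exact: opA_unbounded_Hinf.
Qed.
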